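(* For all integers $L_0 \ge 0$, all $\epsilon \in (0,1)$, and all integers $L > \epsilon_0^{-2} + Y_0\,\epsilon^{-2}$, it holds that $$\frac{C(\pi_{r^*,S^*})}{\mathrm{OPT}(L)} < 1+\epsilon ,$$ where $\mathrm{OPT}(L)$ is the optimal long-run average cost of the dual-sourcing problem with express lead time $L_0$ and regular lead time $L$, $\pi_{r^*,S^*}$ is the best Tailored Base-Surge policy, and $\epsilon_0, Y_0$ are the explicit constants (not depending on $L$ or $\epsilon$) defined in the context.
   Context: **Model.** $D$ is a nonnegative random variable with finite mean and strictly positive (possibly infinite) variance. $\{D_t\}_{t\in\mathbb Z}$ and $\{D'_t\}_{t\in\mathbb Z}$ are mutually independent sequences of i.i.d. copies of $D$, and $\hat G$ is an independent random variable with $\mathbb P(\hat G=k)=2^{-k}$, $k\ge 1$. The express source has integer lead time $L_0\ge 0$, the regular source integer lead time $L>L_0+1$. Unit holding and backorder costs are $h,b>0$; the unit purchase cost of the regular source is $c_R=0$ and that of the express source is $c>0$. $x^+=\max(x,0)$, $x^-=\max(-x,0)$, $G(y)=hy^+ + by^-$. Conventions: empty sums are $0$, $1/\infty=0$. In each period $t\ge1$ nonnegative orders $q_t^R,q_t^E$ are placed at the regular and express source ($q_k^R=q_k^E=0$ for $k\le 0$). The on-hand inventory satisfies $I_1=-\sum_{i=1}^{\hat G}D'_{-i}$ and $I_{t+1}=I_t+q_{t-L}^R+q_{t-L_0}^E-D_t$. The expedited inventory position is $\hat I_t=I_t+\sum_{k=t-L_0}^{t-1}q_k^E+\sum_{k=t-L}^{t-L+L_0}q_k^R$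 and the truncated regular pipeline is $\mathcal R^t=(q^R_{t-L+L_0+1},\dots,q^R_{t-1})\in\mathbb R^{L-L_0-1}$. An admissible policy $\pi\in\hat\Pi$ is a sequence of measurable maps $\hat f_t^\pi:\mathbb R^{L-L_0}\to[0,\infty)^2$, with $(q_t^R,q_t^E)=\hat f_t^\pi(\mathcal R^t,\hat I_t)$. (It is known that restricting to $\hat\Pi$, instead of policies depending on the full state, does not change the optimal value.) For $t\ge L_0+1$ the cost is $$C_t^\pi=c\,q_{t-L_0}^E+G(I_t+q_{t-L}^R+q_{t-L_0}^E-D_t)=c\,q_{t-L_0}^E+G\Big(\hat I_{t-L_0}+q_{t-L_0}^E-\sum_{i=t-L_0}^tD_i\Big).$$ $C(\pi)=\limsup_{T\to\infty}\frac1T\sum_{t=L_0+1}^T\mathbb E[C_t^\pi]$ and $\mathrm{OPT}(L)=\inf_{\pi\in\hat\Pi}C(\pi)$. **Tailored Base-Surge (TBS) policies.** The policy $\pi_{r,S}$ sets $q_t^R=r$ and $q_t^E=\max(0,S-\hat I_t)$ for all $t\ge1$. It is known that, with $I_\infty^r=\sup_{j\ge0}(jr-\sum_{i=1}^jD_i)$, $$C(\pi_{r,S})=c(\mathbb E[D]-r)+\mathbb E\Big[G\Big(I_\infty^r+S-\sum_{i=1}^{L_0+1}D_i'\Big)\Big],$$ which does not depend on $L$. Let $F^\infty(r)=\inf_{S\in\mathbb R}C(\pi_{r,S})$. The pair $(r^*,S^* )$ is any pair with $r^*\in\operatorname{arg\,min}_{0\le r\le\mathbb E[D]}F^\infty(r)$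 and $S^*\in\operatorname{arg\,min}_{S\in\mathbb R}C(\pi_{r^*,S})$ (such a pair exists). **Constants.** For $\theta\ge0$ and $\epsilon\in(0,\mathbb E[D]]$: $\phi_\epsilon(\theta)=\exp(\theta(\mathbb E[D]-\epsilon))\,\mathbb E[\exp(-\theta D)]$, $\gamma_\epsilon=\inf_{\theta\ge0}\phi_\epsilon(\theta)$, and $\vartheta_\epsilon$ is the supremum of the set of minimizers of $\phi_\epsilon$ on $[0,\infty)$, with $\vartheta_\epsilon=\infty$ if the infimum is not attained. (One has $\gamma_\epsilon\in[0,1)$, $\vartheta_\epsilon>0$.) Further: - $g=\inf_{x\in\mathbb R}\mathbb E[G(x-\sum_{i=1}^{L_0+1}D_i')]$, $\quad U=C(\pi_{0,0})=c\,\mathbb E[D]+\mathbb E[G(-\sum_{i=1}^{L_0+1}D_i')]$; - $p_0=\mathbb P(D<\mathbb E[D])$, $\quad\hat p_0=(\tfrac12p_0(1-p_0))^{1/2}$, $\quad Q_0=\inf\{x\ge0:\mathbb P(D\le x)\ge\tfrac12p_0\}$; - $\eta_0=\inf_{z\in\mathbb R}\mathbb E|z-D|$, $\quad c_0=\frac1{240}\min(b,h)\hat p_0\eta_0$, $\quad U_0=64(L_0+1)\frac{(\max(b,h))^2}{\min(b,h)}\mathbb E[D]$; - $\epsilon_0=\min\Big(\mathbb E[D]-Q_0,\ \tfrac14(\eta_0\hat p_0)^2,\ 1-2^{-\hat p_0^2/400},\ \tfrac1{625}c_0^2\big(U_02^{L_0}+\eta_0+U+1\big)^{-2}\Big)$;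 - $Y_0=25g^{-2}\big(U_02^{L_0}+\max(b,h)\gamma_{\epsilon_0}\vartheta_{\epsilon_0}^{-1}(1-\gamma_{\epsilon_0})^{-2}\big)^2+L_0+1$. *)

(* Defs.v *)
(* MathComp-Analysis *)
From HB Require Import structures.
From mathcomp Require Import all_boot all_order all_algebra.
From mathcomp Require Import all_classical all_reals all_analysis.

Set Implicit Arguments.
Unset Strict Implicit.
Unset Printing Implicit Defensive.

Import Order.TTheory GRing.Theory Num.Theory.
Import numFieldNormedType.Exports.

Local Open Scope classical_set_scope.
Local Open Scope ring_scope.

Section Randomness.
Context {d : measure_display} {T : measurableType d} {R : realType}.
Variable P : probability T R.

Definition same_law (X Y : T -> R) : Prop :=
  forall A : set R, measurable A -> P (X @^-1` A) = P (Y @^-1` A).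

Definition mutually_independent (I : eqType) (X : I -> T -> R) : Prop :=
  forall (s : seq I) (A : I -> set R), uniq s ->
    (forall i, measurable (A i)) ->
    P (\bigcap_(i in [set` s]) (X i @^-1` A i)) =
    (\big[mule/1]_(i <- s) P (X i @^-1` A i))%E.

(* All the primitive random variables as one family, so that their joint
   independence is a single condition; the values of Ghat are cast to R, which
   does not change the sigma-algebra it generates. *)
Definition primitives (Dt Dt' : int -> T -> R) (Ghat : T -> nat)
    (i : int + int + unit) : T -> R :=
  match i with
  | inl (inl t) => Dt t
  | inl (inr t) => Dt' t
  | inr _ => fun w => (Ghat w)%:R
  end.

End Randomness.

Definition newsvendor_cost (R : realType) (h b y : R) : R :=
  h * Num.max y 0 + b * Num.max (- y) 0.

Section Dynamics.
Context {d : measure_display} {T : measurableType d} {R : realType}.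
Variable P : probability T R.
Variables (c h b : R) (L0 L : nat).
Variables (Dt Dt' : int -> T -> R) (Ghat : T -> nat).

(* On-hand inventory, together with the regular and express orders indexed by
   the period in which they were placed (0 in every other period). *)
Record state := State {
  inventory : R;
  regular : int -> R;
  express : int -> R }.

Definition expedited_position (t : nat) (x : state) : R :=
  inventory x
  + \sum_(k < L0) express x (t%:Z - L0%:Z + k%:Z)
  + \sum_(k < L0.+1) regular x (t%:Z - L%:Z + k%:Z).

Definition truncated_pipeline (t : nat) (x : state) : (L - L0 - 1).-tuple R :=
  [tuple regular x (t%:Z - L%:Z + L0%:Z + 1 + i%:Z) | i < (L - L0 - 1)%N].

(* f t maps (truncated pipeline, expedited position) to (q_t^R, q_t^E). *)
Definition policy := nat -> ((L - L0 - 1).-tuple R * R)%type -> (R * R)%type.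

Definition admissible (f : policy) : Prop :=
  forall t, measurable_fun setT (f t) /\
            forall x, 0 <= (f t x).1 /\ 0 <= (f t x).2.

Definition period (f : policy) (t : nat) (demand : R) (x : state) : state :=
  let q := f t (truncated_pipeline t x, expedited_position t x) in
  let qR := fun k : int => if k == t%:Z then q.1 else regular x k in
  let qE := fun k : int => if k == t%:Z then q.2 else express x k in
  State (inventory x + qR (t%:Z - L%:Z) + qE (t%:Z - L0%:Z) - demand) qR qE.

Definition initial_state (w : T) : state :=
  State (- \sum_(1 <= i < (Ghat w).+1) Dt' (- i%:Z) w) (fun=> 0) (fun=> 0).

(* The state at the end of period t; its inventory is
   I_(t+1) = I_t + q^R_(t-L) + q^E_(t-L0) - D_t, the argument of the holding and
   backorder cost of period t. *)
Fixpoint state_after (f : policy) (t : nat) (w : T) : state :=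
  if t is s.+1 then period f t (Dt t%:Z w) (state_after f s w)
  else initial_state w.

Definition period_cost (f : policy) (t : nat) (w : T) : R :=
  let x := state_after f t w in
  c * express x (t%:Z - L0%:Z) + newsvendor_cost h b (inventory x).

Definition long_run_cost (f : policy) : \bar R :=
  limn_esup (fun n : nat =>
    (n%:R^-1)%:E * \sum_(L0.+1 <= t < n.+1) 'E_P[period_cost f t])%E.

Definition OPT : \bar R := ereal_inf [set long_run_cost f | f in admissible].

Definition tbs (r S : R) : policy := fun _ x => (r, Num.max 0 (S - x.2)).

(* L occurs through the dynamics, but the long-run value does not depend on it. *)
Definition tbs_cost (r S : R) : \bar R := long_run_cost (tbs r S).

Definition tbs_value (r : R) : \bar R :=
  ereal_inf [set tbs_cost r S | S in [set: R]].

Definition best_tbs (mu rstar Sstar : R) : Prop :=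
  [/\ 0 <= rstar <= mu,
      forall r, 0 <= r <= mu -> (tbs_value rstar <= tbs_value r)%E &
      forall S, (tbs_cost rstar Sstar <= tbs_cost rstar S)%E].

End Dynamics.

Section Constants.
Context {d : measure_display} {T : measurableType d} {R : realType}.
Variable P : probability T R.
Variables (c h b : R) (L0 : nat) (D : T -> R) (Dt' : int -> T -> R).

Definition mean : R := fine 'E_P[D].

Definition phi (e theta : R) : R :=
  expR (theta * (mean - e)) * fine 'E_P[fun w => expR (- (theta * D w))].

Definition gamma (e : R) : R := inf [set phi e theta | theta in [set u | 0 <= u]].

Definition phi_argmin (e : R) : set R :=
  [set theta | 0 <= theta /\ forall u, 0 <= u -> phi e theta <= phi e u].

Definition vartheta (e : R) : \bar R :=
  if phi_argmin e == set0 then +oo%E else ereal_sup (EFin @` phi_argmin e).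

Definition expected_newsvendor_cost (x : R) : R :=
  fine 'E_P[fun w =>
    newsvendor_cost h b (x - \sum_(1 <= i < L0.+2) Dt' i%:Z w)].

Definition g_const : R := inf [set expected_newsvendor_cost x | x in [set: R]].

(* The (L-independent) closed form of the cost of the policy tbs 0 0. *)
Definition U_const : R := c * mean + expected_newsvendor_cost 0.

Definition p0 : R := fine (P [set w | D w < mean]).

Definition p0_hat : R := Num.sqrt (2^-1 * p0 * (1 - p0)).

Definition Q0 : R :=
  inf [set x | 0 <= x /\ 2^-1 * p0 <= fine (P [set w | D w <= x])].

Definition eta0 : R := inf [set fine 'E_P[fun w => `|z - D w|] | z in [set: R]].

Definition c0 : R := 240^-1 * Num.min b h * p0_hat * eta0.

Definition U0 : R :=
  64 * (L0%:R + 1) * (Num.max b h ^+ 2 / Num.min b h) * mean.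

Definition eps0 : R :=
  Num.min (mean - Q0)
  (Num.min (4^-1 * (eta0 * p0_hat) ^+ 2)
  (Num.min (1 - 2 `^ (- (p0_hat ^+ 2 / 400)))
           (625^-1 * c0 ^+ 2 * (U0 * 2 ^+ L0 + eta0 + U_const + 1) ^- 2))).

(* The inverse of vartheta is taken in \bar R, where (+oo)^-1 = 0. *)
Definition Y0 : R :=
  25 * g_const ^- 2
  * (U0 * 2 ^+ L0
     + Num.max b h * gamma eps0 * fine ((vartheta eps0)^-1)%E
       * (1 - gamma eps0) ^- 2) ^+ 2
  + L0%:R + 1.

End Constants.

(* Main.v *)
(** Put [n = L - L0], so that at any time the next [n] regular arrivals are
known.  A TBS policy amounts to the reflected walk
[z <- max(S, z + r - D)]; every admissible policy produces levels
[y <- y - D + arrival + express order].  Take a long horizon over which the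
arrivals average [r] and compare the two inside windows of length [n],
discounting by [1 - 1/sqrt n].  Convexity of the lead-time cost bounds the cost
of [y] below by that of [z] plus (slope at [z]) * [(y - z)].  If [S] is chosen so that
the discounted sum of the slopes along the reflected walk started at [S]
vanishes, the first-order terms telescope, express orders only help, and the
windows cost the TBS policy at most [O(1/sqrt n)] more.

This needs the reflected walk to mix, which the Chernoff bound
[gamma eps0 < 1] gives for [r <= E D - eps0].  When [r > E D - eps0], demand
fluctuations over about [1/eps0] periods, which orders placed earlier cannot
track, already make the holding cost exceed that of the policy [tbs 0 0].  Since the
optimal value is at least [g_const], the additive error turns into a ratio. *)
Require Import Defs.
From HB Require Import structures.
From mathcomp Require Import all_boot all_order all_algebra.
From mathcomp Require Import all_classical all_reals all_analysis.
From mathcomp Require Import measurable_realfun.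
From mathcomp Require Import ring lra zify.

Import Order.TTheory GRing.Theory Num.Theory.
Import numFieldNormedType.Exports.

Local Open Scope classical_set_scope.
Local Open Scope ring_scope.

Set Implicit Arguments.
Unset Strict Implicit.
Unset Printing Implicit Defensive.

(** * Expectations *)

(** What arrives inside a window is settled at its start, so it is independent of the walk driven by
    the demands of the window. The cross term therefore factors into (mean arrival minus [r]) times
    a nonnegative deterministic coefficient, and averaging over window starts makes the first factor
    nonnegative at every offset. Beyond [n] periods arrivals may react to those demands and nothing
    factors. Cutting at [n] is paid for by the discount. With [x = sqrt n] and [al = 1 - 1/x] the
    weights sum to about [x], while the boundary terms carry [al ^+ n <= 27 / x ^+ 3]. A window
    loses a bounded amount in all, hence [O(1/x)] per unit of weight, and this is why the lead time
    has to grow like [eps ^- 2]. No stationary law is constructed. Iterates of the transition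
    operator stand for it, with geometric errors whose sum over the window produces the square in
    [(1 - gamma) ^- 2]. The demand may have infinite variance. Mixing therefore rests on Laplace
    transforms, and the near-critical case on a bounded walk that only records whether each demand
    is below its mean. *)

Lemma power_sum_le (R : realType) (al : R) n : 0 <= al -> al < 1 ->
  \sum_(i < n) al ^+ i <= (1 - al)^-1.
Proof.
move=> a0 a1; have p : 0 < 1 - al by rewrite subr_gt0.
rewrite -[leRHS]mul1r ler_pdivlMr // mulrC -opprB mulNr -subrX1 opprB.
by rewrite gerBl exprn_ge0.
Qed.

Section Expectation.
Context {d : measure_display} {T : measurableType d} {R : realType}.
Variable P : probability T R.
Implicit Types (f g X : T -> R).

Definition itg f := P.-integrable setT (EFin \o f).
(** Real-valued, so that inequalities are plain arithmetic over [R]. An infinite integral is read as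
    0 by [fine], which is why most rules below ask for [itg]. *)
Definition Ex f : R := Rintegral P setT f.

Lemma itg_mfun f : itg f -> measurable_fun setT f.
Proof. by move=> /measurable_int /measurable_EFinP. Qed.

Lemma itg_cst a : itg (fun=> a).
Proof. exact: finite_measure_integrable_cst. Qed.

Lemma itg_le f g : measurable_fun setT f -> (forall w, `|f w| <= g w) ->
  itg g -> itg f.
Proof.
move=> mf fg ig; apply: le_integrable ig => //; first exact/measurable_EFinP.
move=> w _ /=; rewrite lee_fin (le_trans (fg w)) //.
exact: ler_norm.
Qed.

Lemma itgD f g : itg f -> itg g -> itg (fun w => f w + g w).
Proof. by move=> i j; have := integrableD measurableT i j. Qed.

Lemma itgN f : itg f -> itg (fun w => - f w).
Proof. by move=> i; have := integrableN i. Qed.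

Lemma itgB f g : itg f -> itg g -> itg (fun w => f w - g w).
Proof. by move=> i j; apply: itgD => //; exact: itgN. Qed.

Lemma itgZl a f : itg f -> itg (fun w => a * f w).
Proof. by move=> i; have := integrableZl measurableT a i. Qed.

Lemma itgZr a f : itg f -> itg (fun w => f w * a).
Proof. by move=> i; under eq_fun do rewrite mulrC; exact: itgZl. Qed.

Lemma itg_abs f : itg f -> itg (fun w => `|f w|).
Proof. by move=> i; have := integrable_abse i. Qed.

Lemma itg_sum (I : eqType) (s : seq I) (F : I -> T -> R) :
  (forall i, i \in s -> itg (F i)) -> itg (fun w => \sum_(i <- s) F i w).
Proof.
elim: s => [|i s IH] h.
  by under eq_fun do rewrite big_nil; exact: itg_cst.
under eq_fun do rewrite big_cons; apply: itgD.
  by apply: h; rewrite inE eqxx.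
by apply: IH => j js; apply: h; rewrite inE js orbT.
Qed.

Lemma itg_bounded f a : measurable_fun setT f -> (forall w, `|f w| <= a) ->
  itg f.
Proof. by move=> mf fa; apply: (itg_le mf fa); exact: itg_cst. Qed.

Lemma itgM_bounded X f a : itg X -> measurable_fun setT f ->
  (forall w, `|f w| <= a) -> itg (fun w => X w * f w).
Proof.
move=> iX mf fa; apply: (@itg_le _ (fun w => a * `|X w|)).
- by apply: measurable_funM => //; exact: itg_mfun.
- by move=> w; rewrite normrM mulrC ler_wpM2r.
- by apply: itgZl; exact: itg_abs.
Qed.

Lemma itg_max f g : itg f -> itg g -> itg (fun w => Num.max (f w) (g w)).
Proof.
move=> i j; apply: (@itg_le _ (fun w => `|f w| + `|g w|)).
- by apply: measurable_maxr; exact: itg_mfun.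
- by move=> w; case: (leP (f w)) => _; rewrite (lerDl, lerDr).
- by apply: itgD; exact: itg_abs.
Qed.

Lemma itg_min f g : itg f -> itg g -> itg (fun w => Num.min (f w) (g w)).
Proof.
move=> i j; apply: (@itg_le _ (fun w => `|f w| + `|g w|)).
- by apply: measurable_minr; exact: itg_mfun.
- by move=> w; case: (leP (f w)) => _; rewrite (lerDl, lerDr).
- by apply: itgD; exact: itg_abs.
Qed.

Lemma eq_Ex f g : f =1 g -> Ex f = Ex g.
Proof. by move=> fg; congr Ex; exact/funext. Qed.

Lemma Ex_cst a : Ex (fun=> a) = a.
Proof.
rewrite /Ex Rintegral_cst //.
have -> : fine (P setT) = 1 by have := probability_setT P => ->.
exact: mulr1.
Qed.

Lemma ExD f g : itg f -> itg g -> Ex (fun w => f w + g w) = Ex f + Ex g.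
Proof. exact: RintegralD. Qed.

Lemma ExB f g : itg f -> itg g -> Ex (fun w => f w - g w) = Ex f - Ex g.
Proof. exact: RintegralB. Qed.

Lemma ExZl a f : itg f -> Ex (fun w => a * f w) = a * Ex f.
Proof. exact: RintegralZl. Qed.

Lemma ExZr a f : itg f -> Ex (fun w => f w * a) = Ex f * a.
Proof. exact: RintegralZr. Qed.

Lemma ExN f : itg f -> Ex (fun w => - f w) = - Ex f.
Proof.
move=> i; under eq_Ex do rewrite -mulN1r.
by rewrite ExZl // mulN1r.
Qed.

Lemma Ex_le f g : itg f -> itg g -> (forall w, f w <= g w) -> Ex f <= Ex g.
Proof. by move=> i j fg; apply: le_Rintegral => // w _; exact: fg. Qed.

Lemma Ex_ge0 f : (forall w, 0 <= f w) -> 0 <= Ex f.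
Proof. by move=> f0; apply: Rintegral_ge0 => w _. Qed.

Lemma Ex_sum (I : eqType) (s : seq I) (F : I -> T -> R) :
  (forall i, i \in s -> itg (F i)) ->
  Ex (fun w => \sum_(i <- s) F i w) = \sum_(i <- s) Ex (F i).
Proof.
elim: s => [|i s IH] h.
  by rewrite big_nil -[RHS](Ex_cst 0); apply: eq_Ex => w; rewrite big_nil.
rewrite big_cons -IH; last by move=> j js; apply: h; rewrite inE js orbT.
rewrite -ExD; first by apply: eq_Ex => w; rewrite big_cons.
  by apply: h; rewrite inE eqxx.
by apply: itg_sum => j js; apply: h; rewrite inE js orbT.
Qed.

Lemma Ex_abs f : itg f -> `|Ex f| <= Ex (fun w => `|f w|).
Proof. exact: le_normr_Rintegral. Qed.

Lemma Ex_le_cst f a : itg f -> (forall w, f w <= a) -> Ex f <= a.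
Proof. by move=> i fa; rewrite -(Ex_cst a); apply: Ex_le => //; exact: itg_cst. Qed.

Lemma Ex_ge_cst f a : itg f -> (forall w, a <= f w) -> a <= Ex f.
Proof. by move=> i fa; rewrite -(Ex_cst a); apply: Ex_le => //; exact: itg_cst. Qed.

Lemma EFin_Ex f : itg f -> (Ex f)%:E = (\int[P]_w (f w)%:E)%E.
Proof. by move=> i; rewrite /Ex /Rintegral fineK //; exact: integrable_fin_num. Qed.

Lemma ge0_itg f : measurable_fun setT f -> (forall w, 0 <= f w) ->
  (\int[P]_w (f w)%:E < +oo)%E -> itg f.
Proof.
move=> mf f0 h; apply/integrableP; split; first exact/measurable_EFinP.
by under eq_integral => w _ do rewrite /= ger0_norm //.
Qed.

Lemma Ex_indic (A : set T) : measurable A -> Ex (\1_A : T -> R) = fine (P A).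
Proof. by move=> mA; rewrite /Ex /Rintegral integral_indic // setIT. Qed.

Lemma itg_indic (A : set T) : measurable A -> itg (\1_A : T -> R).
Proof. by move=> mA; exact: integrable_indic. Qed.

Lemma Ex_ae_eq f g : measurable_fun setT f -> measurable_fun setT g ->
  {ae P, forall w, f w = g w} -> Ex f = Ex g.
Proof.
move=> mf mg fg; rewrite /Ex /Rintegral; congr fine.
apply: ae_eq_integral => //; [exact/measurable_EFinP..|].
by apply: filterS fg => w + _ => ->.
Qed.

End Expectation.

(** * Lipschitz functions, the class stable under all the operators used below *)

Section Lipschitz.
Context {R : realType}.
Implicit Types (C : R) (f g : R -> R).

Definition lip C f := forall x y, `|f x - f y| <= C * `|x - y|.

Lemma lip_ge0 C f : lip C f -> 0 <= C.
Proof.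
move=> /(_ 1 0); rewrite subr0 normr1 mulr1; apply: le_trans; exact: normr_ge0.
Qed.

Lemma lip_le C f x y : lip C f -> f x <= f y + C * `|x - y|.
Proof. by move=> /(_ x y); rewrite ler_norml => /andP[_]; lra. Qed.

Lemma lip_continuous C f : lip C f -> continuous f.
Proof.
move=> lf x; apply/cvgrPdist_lt => e e0.
have C0 := lip_ge0 lf.
have p : 0 < e / (C + 1) by rewrite divr_gt0 //; lra.
near=> y; apply: le_lt_trans (lf x y) _.
have xy : `|x - y| < e / (C + 1).
  near: y; exact: (@cvgr_dist_lt _ _ _ _ _ id).
apply: (@le_lt_trans _ _ ((C + 1) * `|x - y|)).
  by rewrite ler_wpM2r //; lra.
by rewrite mulrC -ltr_pdivlMr //; lra.
Unshelve. all: by end_near. Qed.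

Lemma lip_mfun C f : lip C f -> measurable_fun setT f.
Proof. by move=> lf; apply: continuous_measurable_fun; exact: lip_continuous lf. Qed.

Lemma lip_shift C f a : lip C f -> lip C (fun x => f (a + x)).
Proof. by move=> lf x y; apply: le_trans (lf _ _) _; rewrite opprD addrACA subrr add0r. Qed.

Lemma lip_max a : lip 1 (Num.max a : R -> R).
Proof.
by move=> x y; rewrite mul1r; case: (leP a x); case: (leP a y) => h1 h2;
  rewrite ler_norml; apply/andP; split; have := normr_ge0 (x - y);
  have := ler_norm (x - y); have := ler_norm (y - x); rewrite distrC; lra.
Qed.

End Lipschitz.

Section LipschitzExpectation.
Context {d : measure_display} {T : measurableType d} {R : realType}.
Variable P : probability T R.

Lemma itg_lip C (f : R -> R) (X : T -> R) : lip C f -> itg P X ->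
  itg P (fun w => f (X w)).
Proof.
move=> lf iX.
apply: (@itg_le _ _ _ _ _ (fun w => `|f 0| + C * `|X w|)).
- by apply: measurableT_comp; [exact: lip_mfun lf|exact: itg_mfun iX].
- move=> w; have := lf (X w) 0; rewrite subr0 => h.
  have : `|f (X w)| <= `|f 0| + `|f (X w) - f 0|.
    by apply: le_trans (ler_normD _ _); rewrite addrC subrK.
  lra.
- by apply: itgD; [exact: itg_cst|apply: itgZl; exact: itg_abs].
Qed.

End LipschitzExpectation.

(** * Independence and conditioning on past variables *)

Section Decoupling.
Context {d d' : measure_display} {T : measurableType d} {U : measurableType d'}
  {R : realType}.
Variable P : probability T R.
Variables (V : T -> U) (Y D : T -> R).
Hypotheses (mV : measurable_fun setT V) (mY : measurable_fun setT Y)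
  (mD : measurable_fun setT D).
Hypothesis VY : forall A B, measurable A -> measurable B ->
  P (V @^-1` A `&` Y @^-1` B) = (P (V @^-1` A) * P (Y @^-1` B))%E.
Hypothesis YD : same_law P Y D.

Let V' : {mfun T >-> U} := HB.pack V (isMeasurableFun.Build _ _ _ _ V mV).
Let Y' : {mfun T >-> R} := HB.pack Y (isMeasurableFun.Build _ _ _ _ Y mY).
Let D' : {mfun T >-> R} := HB.pack D (isMeasurableFun.Build _ _ _ _ D mD).

Let mVY : measurable_fun setT (fun w => (V w, Y w)).
Proof. exact: measurable_fun_pair. Qed.
Let VY' : {mfun T >-> (U * R)%type} :=
  HB.pack (fun w => (V w, Y w)) (isMeasurableFun.Build _ _ _ _ _ mVY).

Let lawE (A : set (U * R)) : measurable A ->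
  (distribution P V' \x distribution P D')%E A = distribution P VY' A.
Proof.
apply: product_measure_unique => A1 B mA mB.
have e := VY mA mB; rewrite (YD mB) in e; exact: e.
Qed.

(** By uniqueness of product measures, the pair [(V, Y)] has the product of the two marginal laws;
    Fubini then freezes [V] and integrates over a copy of [D]. The type of [V] is arbitrary so that
    [V] can carry a whole sigma-algebra. *)
Lemma decouple (F : U * R -> R) : measurable_fun setT F ->
  itg P (fun w => F (V w, Y w)) ->
  itg P (fun w => Ex P (fun w' => F (V w, D w'))) /\
  Ex P (fun w => F (V w, Y w)) = Ex P (fun w => Ex P (fun w' => F (V w, D w'))).
Proof.
move=> mF iF.
have mEF : measurable_fun setT (EFin \o F) by exact/measurable_EFinP.
have iF1 : (distribution P VY').-integrable setT (EFin \o F).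
  exact: integrable_pushforward.
have iF2 : (distribution P V' \x distribution P D')%E.-integrable setT (EFin \o F).
  case/integrableP: iF1 => _ i1; apply/integrableP; split => //.
  by rewrite (eq_measure_integral (distribution P VY')) // => A mA _; exact: lawE.
have mG (u : U) : measurable_fun setT (fun x => F (u, x)).
  by apply: measurableT_comp => //; exact: measurable_fun_pair.
have inner (u : U) : (distribution P D').-integrable setT (fun y => (F (u, y))%:E) ->
   (\int[distribution P D']_y (F (u, y))%:E)%E = (Ex P (fun w' => F (u, D w')))%:E.
  move=> iu; have iu' : itg P (fun w' => F (u, D w')).
    apply/integrableP; split.
      by apply/measurable_EFinP; exact: (measurableT_comp (mG u) mD).
    case/integrableP: iu => _; rewrite ge0_integral_distribution //.
    by apply: measurableT_comp => //; exact/measurable_EFinP.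
  by rewrite EFin_Ex // integral_distribution //; exact/measurable_EFinP.
(* Sections of [F] are integrable only for almost every [u]. At the other points [Ex] is a default
   value, harmless once integrated. *)
have ae1 := ae_integrable1 iF2.
have mFF := measurable_fubini_F iF2.
have mEx : measurable_fun setT (fun u => Ex P (fun w' => F (u, D w'))).
  have -> : (fun u => Ex P (fun w' => F (u, D w'))) =
      (fun u => fine (\int[distribution P D']_y (F (u, y))%:E)%E).
    apply/funext => u; have mFu : measurable_fun setT (fun y => (F (u, y))%:E).
      exact/measurable_EFinP.
    suff e : (\int[P]_w (F (u, D w))%:E =
        \int[distribution P D']_y (F (u, y))%:E)%E by rewrite /Ex /Rintegral e.
    (* Measurability in [u] must hold at every point, including those with a non-integrable section,
       so the change of variables is made separately on the positive and negative parts. *)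
    rewrite integralE [RHS]integralE.
    rewrite (ge0_integral_distribution D' (measurable_funepos mFu)) //.
    rewrite (ge0_integral_distribution D' (measurable_funeneg mFu)) //.
    by congr (_ - _)%E; apply: eq_integral => w _; rewrite /= ?funeposE ?funenegE.
  have := measurableT_comp (fine_measurable (R := R) measurableT) mFF; exact.
have iH : (distribution P V').-integrable setT (EFin \o (fun u => Ex P (fun w' => F (u, D w')))).
  case/integrableP: (integrable_fubini_F iF2) => _ fin1.
  apply/integrableP; split; first exact/measurable_EFinP.
  move: fin1; congr (_ < _)%E; apply: ae_eq_integral => //.
  - by apply: measurableT_comp.
  - by apply: measurableT_comp => //; exact/measurable_EFinP.
  by apply: filterS ae1 => u iu _ /=; rewrite /fubini_F /= inner.
have iT : itg P (fun w => Ex P (fun w' => F (V w, D w'))).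
  apply/integrableP; split.
    by apply/measurable_EFinP; exact: (measurableT_comp mEx).
  case/integrableP: iH => _; rewrite ge0_integral_distribution //.
  by apply: measurableT_comp => //; exact/measurable_EFinP.
split => //.
apply: EFin_inj; rewrite !EFin_Ex //.
have -> : (\int[P]_w (F (V w, Y w))%:E =
    \int[distribution P VY']_z (F z)%:E)%E.
  by rewrite integral_distribution.
have -> : (\int[distribution P VY']_z (F z)%:E =
    \int[distribution P V' \x distribution P D']_z (EFin \o F) z)%E.
  by apply: eq_measure_integral => A mA _; apply/esym; exact: lawE.
rewrite -(integral12_prod_meas1 iF2).
have -> : (\int[P]_w (Ex P (fun w' => F (V w, D w')))%:E =
   \int[distribution P V']_u (Ex P (fun w' => F (u, D w')))%:E)%E.
  by rewrite integral_distribution //; exact/measurable_EFinP.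
apply: ae_eq_integral => //; first exact/measurable_EFinP.
by apply: filterS ae1 => u iu _ /=; rewrite /fubini_F /= inner.
Qed.

End Decoupling.

Section IndependentFamily.
Context {d : measure_display} {T : measurableType d} {R : realType}.
Variable P : probability T R.
Variables (I : eqType) (X : I -> T -> R).
Hypothesis mX : forall i, measurable_fun setT (X i).
Hypothesis indX : mutually_independent P X.
Implicit Types J : set I.

(* A pi-system generating the sigma-algebra of the variables indexed by [J]. *)
Definition cylinders J : set (set T) :=
  [set A | exists s : seq I, exists B : I -> set R,
    [/\ uniq s, forall i, i \in s -> J i, forall i, measurable (B i) &
        A = \bigcap_(i in [set` s]) (X i @^-1` B i)]].

(** The sample space with a coarser sigma-algebra. Knowledge of the variables in [J] becomes
    measurability of a map out of this type, which replaces conditional expectations throughout. *)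
Definition known J := g_sigma_algebraType (cylinders J).

Lemma cylinders_measurable J : cylinders J `<=` (@measurable d T).
Proof.
move=> _ [s [B [us sJ mB ->]]].
apply: fin_bigcap_measurable; first exact: finite_seq.
by move=> i _; rewrite -[_ @^-1` _]setTI; apply: mX.
Qed.

Lemma cylinders_setI J : setI_closed (cylinders J).
Proof.
move=> _ _ [s [B [us sJ mB ->]]] [s' [B' [us' sJ' mB' ->]]].
pose C i := (if i \in s then B i else setT) `&` (if i \in s' then B' i else setT).
exists (undup (s ++ s')), C; split.
- exact: undup_uniq.
- by move=> i; rewrite mem_undup mem_cat => /orP[/sJ|/sJ'].
- by move=> i; apply: measurableI; case: ifP.
apply/seteqP; split => w.
  move=> [h h'] i _; split; rewrite /=; case: ifPn => // is_; [exact: h|exact: h'].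
move=> h; split => i is_.
  have /h : [set` undup (s ++ s')] i by rewrite /= mem_undup mem_cat is_.
  by move=> [+ _]; rewrite /C /= (is_ : i \in s).
have /h : [set` undup (s ++ s')] i by rewrite /= mem_undup mem_cat is_ orbT.
by move=> [_]; rewrite /C /= (is_ : i \in s').
Qed.

Lemma known_sub J A : measurable (A : set (known J)) -> measurable (A : set T).
Proof.
move=> mA; apply: (smallest_sub (@sigma_algebra_measurable _ T) _ mA).
exact: cylinders_measurable.
Qed.

Lemma known_mfun J d' (U : measurableType d') (f : T -> U) :
  measurable_fun setT (f : known J -> U) -> measurable_fun setT f.
Proof. by move=> mf _ B mB; apply: (@known_sub J); exact: mf. Qed.

Lemma known_subset J J' d' (U : measurableType d') (f : T -> U) : J `<=` J' ->
  measurable_fun setT (f : known J -> U) -> measurable_fun setT (f : known J' -> U).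
Proof.
move=> JJ' mf _ B mB; have := mf measurableT B mB.
apply: smallest_sub; first exact: sigma_algebra_measurable.
move=> _ [s [C [us sJ mC ->]]]; apply: sub_sigma_algebra.
by exists s, C; split => // i /sJ; exact: JJ'.
Qed.

Lemma known_var J i : J i -> measurable_fun setT (X i : known J -> R).
Proof.
move=> Ji _ B mB; apply: sub_sigma_algebra.
exists [:: i], (fun=> B); split => //.
  by move=> j; rewrite inE => /eqP ->.
apply/seteqP; split => w; rewrite setTI.
  by move=> h j /=; rewrite inE => /eqP ->.
by apply => /=; rewrite inE.
Qed.

(** For fixed [B], both sides are finite measures in [A] (a restriction and a multiple of [P]).
    Mutual independence makes them agree on the pi-system of cylinders, hence on the sigma-algebra
    it generates. *)
Lemma known_indep J j A B : ~ J j -> measurable (A : set (known J)) ->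
  measurable B -> P (A `&` X j @^-1` B) = (P A * P (X j @^-1` B))%E.
Proof.
move=> nJ mA mB.
have mXB : measurable (X j @^-1` B) by rewrite -[_ @^-1` _]setTI; apply: mX.
pose a : {nonneg R} := NngNum (fine_ge0 (measure_ge0 P (X j @^-1` B))).
have aE : a%:num%:E = P (X j @^-1` B) by rewrite /= fineK // fin_num_measure.
transitivity (mrestr P mXB A) => //.
transitivity (mscale a P A); last by rewrite /mscale /= -aE muleC.
apply: (g_sigma_algebra_measure_unique (cylinders J) (@cylinders_measurable J)
  (fun=> setT) _ _ _ _ (@cylinders_setI J) _ _ A mA).
- move=> _; exists [::], (fun=> setT); split => //.
  by apply/seteqP; split => // w _ i.
- by rewrite bigcup_const //; exists 0%N.
- move=> C [s [B' [us sJ mB' CE]]].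
  have js : j \notin s by apply/negP => /sJ.
  pose B'' i := if i == j then B else B' i.
  have ub : uniq (j :: s) by rewrite /= js.
  have mB'' i : measurable (B'' i) by rewrite /B''; case: ifP.
  have e1 i : i \in s -> B'' i = B' i.
    by rewrite /B''; case: eqP => // -> h; rewrite h in js.
  have := indX ub mB''; rewrite big_cons {2}/B'' eqxx.
  have -> : \bigcap_(i in [set` (j :: s)]) X i @^-1` B'' i = C `&` X j @^-1` B.
    rewrite CE; apply/seteqP; split => w.
      move=> h; split; last first.
        by have := h j; rewrite /= inE eqxx /B'' eqxx; apply.
      by move=> i /= is_; rewrite -e1 //; apply: h; rewrite /= inE is_ orbT.
    move=> [h hj] i /=; rewrite inE => /orP[/eqP ->|is_]; first by rewrite /B'' eqxx.
    by rewrite /preimage /= e1 //; apply: h.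
  move=> e; transitivity (P (C `&` X j @^-1` B)) => //.
  rewrite e /mscale /= -aE; congr (_ * _)%E.
  rewrite CE; apply: etrans (esym (indX us mB')); rewrite big_seq [RHS]big_seq.
  by apply: eq_bigr => i is_; rewrite e1.
- move=> _; apply: (@le_lt_trans _ _ (P (setT `&` X j @^-1` B))) => //.
  by rewrite setTI; apply: le_lt_trans (probability_le1 _ _) _; rewrite ?ltry.
Qed.

(** This is [decouple] for the identity map from the sample space to [known X J]: whatever is
    determined by the variables in [J] can then be frozen at once. *)
Lemma known_decouple J j (D : T -> R) (F : known J * R -> R) : ~ J j ->
  measurable_fun setT D -> same_law P (X j) D -> measurable_fun setT F ->
  itg P (fun w => F (w, X j w)) ->
  itg P (fun w => Ex P (fun w' => F (w, D w'))) /\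
  Ex P (fun w => F (w, X j w)) = Ex P (fun w => Ex P (fun w' => F (w, D w'))).
Proof.
move=> nJ mD XD mF iF.
apply: (@decouple _ _ T (known J) R P id (X j) D _ _ _ _ XD F mF iF) => //.
  by move=> _ B mB; rewrite setTI; exact: (@known_sub J).
by move=> A B mA mB; exact: (@known_indep J j A B nJ mA mB).
Qed.

End IndependentFamily.

(** * The reflected walk *)

Section Lindley.
Context {d : measure_display} {T : measurableType d} {R : realType}.
Variable P : probability T R.
Variable D : T -> R.
Hypotheses (iD : itg P D) (D0 : forall w, 0 <= D w).
Implicit Types (r C x y : R) (f g : R -> R).

Let mD : measurable_fun setT D. Proof. exact: itg_mfun iD. Qed.

(* Transition operator of the reflected walk [W' = (W + r - D)^+]. *)
Definition lindley r f x : R := Ex P (fun w => f (Num.max 0 (x + r - D w))).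

Lemma itg_walk x : itg P (fun w => x - D w).
Proof. by apply: itgB => //; exact: itg_cst. Qed.

Lemma itg_lindley C r f x : lip C f ->
  itg P (fun w => f (Num.max 0 (x + r - D w))).
Proof.
move=> lf; apply: itg_lip lf _; apply: itg_lip (lip_max 0) _; exact: itg_walk.
Qed.

Lemma lip_lindley C r f : lip C f -> lip C (lindley r f).
Proof.
move=> lf x y; rewrite /lindley -ExB; [|exact: itg_lindley lf..].
have iB := itgB (itg_lindley r x lf) (itg_lindley r y lf).
apply: (le_trans (Ex_abs iB)); apply: Ex_le_cst; first exact: itg_abs.
move=> w; apply: (le_trans (lf _ _)).
have := lip_max 0 (x + r - D w) (y + r - D w); rewrite mul1r => h.
rewrite ler_wpM2l ?(lip_ge0 lf) // (le_trans h) //.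
by rewrite (_ : _ - _ = x - y) //; ring.
Qed.

Lemma lip_iter C r f k : lip C f -> lip C (iter k (lindley r) f).
Proof. by move=> lf; elim: k => // k IH; exact: lip_lindley. Qed.

(** After one step the walk is nonnegative, so an inequality on the half-line gives one at every
    starting point. *)
Lemma lindley_le C C' r f g : lip C f -> lip C' g ->
  (forall x, 0 <= x -> f x <= g x) -> forall x, lindley r f x <= lindley r g x.
Proof.
move=> lf lg fg x; apply: Ex_le; [exact: itg_lindley lf|exact: itg_lindley lg|].
by move=> w; apply: fg; rewrite le_max lexx.
Qed.

Lemma iter_lindley_le C C' r f g k : lip C f -> lip C' g ->
  (forall x, 0 <= x -> f x <= g x) ->
  forall x, 0 <= x -> iter k (lindley r) f x <= iter k (lindley r) g x.
Proof.
move=> lf lg fg; elim: k => // k IH x x0 /=.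
by apply: lindley_le => //; [exact: lip_iter lf|exact: lip_iter lg].
Qed.

Lemma lindley_affine C r f a c x : lip C f ->
  lindley r (fun y => a + c * f y) x = a + c * lindley r f x.
Proof.
move=> lf; rewrite /lindley ExD; last 2 first.
- exact: itg_cst.
- by apply: itgZl; exact: itg_lindley lf.
by rewrite Ex_cst ExZl //; exact: itg_lindley lf.
Qed.

Lemma iter_lindley_affine C r f a c k x : lip C f ->
  iter k (lindley r) (fun y => a + c * f y) x = a + c * iter k (lindley r) f x.
Proof.
move=> lf; elim: k x => // k IH x /=.
rewrite -(lindley_affine r _ _ _ (lip_iter r k lf)).
by apply: eq_Ex => w; rewrite IH.
Qed.

Lemma iter_lindley_le_cst C r f k a x : lip C f -> (forall y, f y <= a) ->
  iter k (lindley r) f x <= a.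
Proof.
move=> lf fa; elim: k x => // k IH x /=.
by apply: Ex_le_cst => //; apply: itg_lindley; exact: lip_iter lf.
Qed.

Lemma iter_lindley_ge_cst C r f k a x : lip C f -> (forall y, a <= f y) ->
  a <= iter k (lindley r) f x.
Proof.
move=> lf fa; elim: k x => // k IH x /=.
by apply: Ex_ge_cst => //; apply: itg_lindley; exact: lip_iter lf.
Qed.

Lemma iter_lindley_abs C r f k a x : lip C f -> (forall y, `|f y| <= a) ->
  `|iter k (lindley r) f x| <= a.
Proof.
move=> lf fa; rewrite ler_norml; apply/andP; split.
- by apply: (iter_lindley_ge_cst r k x lf) => y; have := fa y; rewrite ler_norml => /andP[].
- by apply: (iter_lindley_le_cst r k x lf) => y; have := fa y; rewrite ler_norml => /andP[].
Qed.

Lemma iter_lindley_nd C r f k : lip C f -> {homo f : x y / x <= y} ->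
  {homo iter k (lindley r) f : x y / x <= y}.
Proof.
move=> lf hf; elim: k => // k IH x y xy /=.
have lk := lip_iter r k lf.
apply: Ex_le; [exact: itg_lindley lk..|].
move=> w; apply: IH; rewrite ge_max le_max lexx /= le_max.
by apply/orP; right; rewrite !lerB // lerD2r.
Qed.

Lemma iter_lindley_sup C C' r f g k e x : lip C f -> lip C' g ->
  (forall y, `|f y - g y| <= e) ->
  `|iter k (lindley r) f x - iter k (lindley r) g x| <= e.
Proof.
move=> lf lg fg; elim: k x => [|k IH] x //=; rewrite /lindley -ExB; last 2 first.
- by apply: itg_lindley; exact: lip_iter lf.
- by apply: itg_lindley; exact: lip_iter lg.
have iB : itg P (fun w => iter k (lindley r) f (Num.max 0 (x + r - D w)) -
    iter k (lindley r) g (Num.max 0 (x + r - D w))).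
  by apply: itgB; apply: itg_lindley; [exact: lip_iter lf|exact: lip_iter lg].
by apply: (le_trans (Ex_abs iB)); apply: Ex_le_cst => //; exact: itg_abs.
Qed.

(** * Geometric mixing of the reflected walk under an exponential moment *)

Section Lyapunov.
Variables (r theta gam : R).
Hypotheses (theta0 : 0 < theta) (gam1 : gam < 1).
Hypothesis mgf : Ex P (fun w => expR (theta * (r - D w))) <= gam.

Lemma gam_ge0 : 0 <= gam.
Proof. by apply: le_trans mgf; apply: Ex_ge0 => w; exact: expR_ge0. Qed.

Let itg_mgf : itg P (fun w => expR (theta * (r - D w))).
Proof.
apply: (@itg_bounded _ _ _ _ _ (expR (theta * r))).
- apply: measurableT_comp => //; apply: measurable_funM => //.
  exact: measurable_funB.
- move=> w; rewrite ger0_norm ?expR_ge0 // ler_expR ler_wpM2l ?(ltW theta0) //.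
  by rewrite lerBlDr lerDl.
Qed.

Let itg_expmax x : itg P (fun w => expR (theta * Num.max 0 (x + r - D w))).
Proof.
apply: (@itg_bounded _ _ _ _ _ (expR (theta * `|x + r|))).
- apply: measurableT_comp => //; apply: measurable_funM => //.
  apply: measurable_maxr => //.
  exact: measurable_funB.
- move=> w; rewrite ger0_norm ?expR_ge0 // ler_expR ler_wpM2l ?(ltW theta0) //.
  by rewrite ge_max normr_ge0 /= lerBlDr (le_trans (ler_norm _)) // lerDl.
Qed.

(** Two walks fed by the same demand: reflection at 0 can only reduce the difference of their
    exponentials, since it raises the lower walk at least as much. *)
Lemma expmax_diff (x y t : R) : y <= x ->
  expR (theta * Num.max 0 (x + t)) - expR (theta * Num.max 0 (y + t)) <=
  expR (theta * t) * (expR (theta * x) - expR (theta * y)).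
Proof.
move=> yx; rewrite mulrBr -!expRD -!mulrDr ![t + _]addrC.
case: (leP 0 (x + t)) => hx; case: (leP 0 (y + t)) => hy; rewrite ?mulr0 ?expR0 //.
- rewrite lerD2l lerN2 -[leRHS]expR0 ler_expR.
  by rewrite pmulr_rle0 // ltW.
- by lra.
- by rewrite subrr subr_ge0 ler_expR ler_wpM2l ?(ltW theta0) //; lra.
Qed.

(** Distances are measured through [expR (theta * x)]. In this scale the synchronous coupling
    contracts by the exponential moment of one step, so every application of the operator gains a
    factor [gam]. *)
Lemma lindley_exp_diff C A f : lip C f -> 0 <= A ->
  (forall x y, 0 <= y <= x ->
    `|f x - f y| <= A * (expR (theta * x) - expR (theta * y))) ->
  forall x y, 0 <= y <= x -> `|lindley r f x - lindley r f y| <=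
    A * gam * (expR (theta * x) - expR (theta * y)).
Proof.
move=> lf A0 hf x y /andP[y0 yx]; rewrite /lindley -ExB; [|exact: itg_lindley lf..].
have iB := itgB (itg_lindley r x lf) (itg_lindley r y lf).
apply: (le_trans (Ex_abs iB)).
apply: (@le_trans _ _ (Ex P (fun w => A * (expR (theta * x) - expR (theta * y)) *
   expR (theta * (r - D w))))); last first.
  rewrite ExZl //; set a := expR _ - _.
  have a0 : 0 <= a by rewrite subr_ge0 ler_expR ler_wpM2l ?(ltW theta0).
  by rewrite -!mulrA [gam * _]mulrC; apply: ler_wpM2l => //; apply: ler_wpM2l.
apply: Ex_le; [exact: itg_abs|exact: itgZl|] => w.
rewrite -!addrA; apply: (le_trans (hf _ _ _)).
  rewrite le_max lexx /= ge_max le_max lexx /= le_max.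
  by apply/orP; right; rewrite lerD2r.
rewrite -mulrA ler_wpM2l // [leRHS]mulrC.
exact: expmax_diff.
Qed.

Lemma iter_lindley_exp_diff C f k : lip C f -> forall x y, 0 <= y <= x ->
  `|iter k (lindley r) f x - iter k (lindley r) f y| <=
    C / theta * gam ^+ k * (expR (theta * x) - expR (theta * y)).
Proof.
move=> lf; have C0 := lip_ge0 lf; have g0 := gam_ge0.
elim: k => [|k IH] x y xy.
  rewrite expr0 mulr1 (le_trans (lf _ _)) // -mulrA ler_wpM2l //.
  case/andP: xy => y0 yx.
  rewrite ger0_norm ?subr_ge0 // -(ler_pM2l theta0) mulrA divff ?gt_eqF // mul1r.
  have e1 : expR (theta * x) = expR (theta * y) * expR (theta * (x - y)).
    by rewrite -expRD; congr expR; ring.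
  have e2 : 1 <= expR (theta * y).
    by rewrite -expR0 ler_expR mulr_ge0 // ltW.
  have e3 := expR_ge1Dx (theta * (x - y)).
  have e4 : 0 <= theta * (x - y) by rewrite mulr_ge0 ?subr_ge0 // ltW.
  by rewrite e1; nra.
rewrite exprSr mulrA /=; apply: lindley_exp_diff xy => //.
  exact: lip_iter lf.
by rewrite mulr_ge0 ?exprn_ge0 // divr_ge0 // ltW.
Qed.

(** From [expR (theta * Num.max 0 z) <= 1 + expR (theta * z)]: each step multiplies the exponential
    by [gam] in mean and adds at most 1 for the reflection, whence the geometric sum. *)
Lemma iter_lindley_growth C A f k : lip C f -> 0 <= A ->
  (forall x, 0 <= x -> f x - f 0 <= A * (expR (theta * x) - 1)) ->
  forall x, 0 <= x -> iter k (lindley r) f x - f 0 <=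
    A * (gam ^+ k * expR (theta * x) + \sum_(j < k) gam ^+ j - 1).
Proof.
move=> lf A0 hf; have g0 := gam_ge0; elim: k => [|k IH] x x0.
  by rewrite big_ord0 addr0 expr0 mul1r; exact: hf.
have lk := lip_iter r k lf.
rewrite /= {1}/lindley -[f 0](Ex_cst P) -ExB; last 2 first.
- exact: itg_lindley lk.
- exact: itg_cst.
apply: (@le_trans _ _ (Ex P (fun w => A * (\sum_(j < k.+1) gam ^+ j - 1) +
   A * gam ^+ k * expR (theta * x) * expR (theta * (r - D w))))).
  apply: Ex_le.
  - by apply: itgB; [exact: itg_lindley lk|exact: itg_cst].
  - by apply: itgD; [exact: itg_cst|exact: itgZl].
  move=> w; apply: (le_trans (IH _ _)); first by rewrite le_max lexx.
  rewrite -!mulrA -mulrDr ler_wpM2l // big_ord_recr /=.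
  have : expR (theta * Num.max 0 (x + r - D w)) <=
     1 + expR (theta * x) * expR (theta * (r - D w)).
    rewrite -expRD -mulrDr -addrA.
    have e0 := expR_ge0 (theta * (x + (r - D w))).
    by case: (leP 0 (x + (r - D w))) => _; rewrite ?mulr0 ?expR0; lra.
  have : 0 <= gam ^+ k by exact: exprn_ge0.
  by nra.
rewrite ExD; [|exact: itg_cst|exact: itgZl].
rewrite Ex_cst ExZl // -!mulrA -mulrDr ler_wpM2l //.
rewrite exprSr -mulrA [gam * _]mulrC.
have : gam ^+ k * (expR (theta * x) * Ex P (fun w => expR (theta * (r - D w)))) <=
   gam ^+ k * (expR (theta * x) * gam).
  by rewrite ler_wpM2l ?exprn_ge0 // ler_wpM2l ?expR_ge0.
lra.
Qed.

Lemma iter_lindley_growth0 C A f k : lip C f -> 0 <= A ->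
  (forall x, 0 <= x -> f x - f 0 <= A * (expR (theta * x) - 1)) ->
  iter k (lindley r) f 0 <= f 0 + A * (gam / (1 - gam)).
Proof.
move=> lf A0 hf; have := iter_lindley_growth k lf A0 hf (lexx 0).
rewrite mulr0 expR0 mulr1 lerBlDl => /le_trans; apply.
rewrite lerD2l ler_wpM2l //.
have := power_sum_le k.+1 gam_ge0 gam1; rewrite big_ord_recr /=.
have p : 1 - gam != 0 by rewrite subr_eq0 gt_eqF.
have -> : gam / (1 - gam) = (1 - gam)^-1 - 1 by field.
lra.
Qed.

(** The growth bound is applied to [iter k (lindley r) f], whose increments already carry the factor
    [gam ^+ k]. It lets a finite iterate serve as an upper bound, up to a geometric error, for all
    later ones. *)
Lemma iter_lindley_tail C f k i : lip C f ->
  iter (k + i) (lindley r) f 0 <=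
  iter k (lindley r) f 0 + C / theta * gam ^+ k.+1 / (1 - gam).
Proof.
move=> lf; have C0 := lip_ge0 lf; have g0 := gam_ge0.
rewrite addnC iterD; apply: (le_trans (iter_lindley_growth0 i (lip_iter r k lf)
   (A := C / theta * gam ^+ k) _ _)).
- by rewrite mulr_ge0 ?exprn_ge0 // divr_ge0 // ltW.
- move=> x x0; have := iter_lindley_exp_diff k lf (x := x) (y := 0).
  rewrite lexx x0 mulr0 expR0 => /(_ isT); rewrite ler_norml => /andP[_] //.
by rewrite exprSr !mulrA.
Qed.

Lemma iter_lindley_id k :
  iter k (lindley r) id 0 <= theta^-1 * gam / (1 - gam).
Proof.
have l1 : lip 1 (id : R -> R) by move=> x y; rewrite mul1r.
by have := iter_lindley_tail 0 k l1; rewrite add0n /= expr1 add0r mul1r.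
Qed.

End Lyapunov.

(** Rate 0 describes the first periods, before any regular order has arrived. Nonnegative demand
    only lowers the walk there, so the growth bound survives without any contraction. *)
Lemma lindley0_exp C A f theta : lip C f -> 0 <= A -> 0 < theta ->
  (forall x, 0 <= x -> f x - f 0 <= A * (expR (theta * x) - 1)) ->
  forall x, 0 <= x -> lindley 0 f x - f 0 <= A * (expR (theta * x) - 1).
Proof.
move=> lf A0 t0 hf x x0; rewrite /lindley -[f 0](Ex_cst P) -ExB; last 2 first.
- exact: itg_lindley lf.
- exact: itg_cst.
apply: Ex_le_cst.
  by apply: itgB; [exact: itg_lindley lf|exact: itg_cst].
move=> w; apply: (le_trans (hf _ _)); first by rewrite le_max lexx.
rewrite ler_wpM2l // lerD2r ler_expR ler_wpM2l ?(ltW t0) // ge_max x0 /=.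
by rewrite addr0 lerBlDr lerDl.
Qed.

Lemma iter_lindley_fixed f k : iter k (lindley 0) f 0 = f 0.
Proof.
elim: k => // k IH /=; rewrite -[RHS]IH -[RHS](Ex_cst P).
by apply: eq_Ex => w; congr (iter _ _ _ _); apply/max_idPl; rewrite !add0r oppr_le0.
Qed.

Lemma iter_lindley0_exp C A f theta k : lip C f -> 0 <= A -> 0 < theta ->
  (forall x, 0 <= x -> f x - f 0 <= A * (expR (theta * x) - 1)) ->
  forall x, 0 <= x -> iter k (lindley 0) f x - f 0 <= A * (expR (theta * x) - 1).
Proof.
move=> lf A0 t0 hf.
elim: k => // k IH x x0; rewrite -(iter_lindley_fixed f k) /=.
by apply: lindley0_exp (lip_iter 0 k lf) A0 t0 _ _ x0 => y y0; rewrite iter_lindley_fixed; exact: IH.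
Qed.

End Lindley.

(** * Lead-time costs *)

Section Convexity.
Context {R : realType}.
Implicit Types (f : R -> R) (x y z C : R).

Definition cvx f := forall x y z, x <= y <= z ->
  (z - x) * f y <= (z - y) * f x + (y - x) * f z.

Variables (f : R -> R) (C delta : R).
Hypotheses (lf : lip C f) (cf : cvx f) (delta0 : 0 < delta).

(** A forward difference in place of a subgradient. It is Lipschitz, which makes the discounted
    slope continuous in the reorder level; the price is the term [2 * C * delta] in the gradient
    inequality. *)
Definition slope y : R := (f (y + delta) - f y) / delta.

Let slopeE y : f (y + delta) = f y + delta * slope y.
Proof. by rewrite /slope mulrC divfK ?gt_eqF //; ring. Qed.

Lemma slope_abs y : `|slope y| <= C.
Proof.
rewrite /slope normrM normfV (gtr0_norm delta0) ler_pdivrMr //.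
by have := lf (y + delta) y; rewrite addrAC subrr add0r (gtr0_norm delta0).
Qed.

Lemma slope_lip : lip (2 * C / delta) slope.
Proof.
move=> x y; rewrite /slope -mulrBl normrM normfV (gtr0_norm delta0).
rewrite ler_pdivrMr // mulrAC divfK ?gt_eqF //.
have -> : f (x + delta) - f x - (f (y + delta) - f y) =
   (f (x + delta) - f (y + delta)) + (f y - f x) by ring.
apply: (le_trans (ler_normD _ _)).
have := lf (x + delta) (y + delta); rewrite opprD addrACA subrr addr0.
by have := lf y x; rewrite (distrC y x); lra.
Qed.

Lemma slope_nd : {homo slope : x y / x <= y}.
Proof.
have d0 := delta0; move=> x y xy; rewrite /slope ler_pM2r ?invr_gt0 //.
have h1 := @cf x y (y + delta).
have h2 := @cf x (x + delta) (y + delta).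
have {}h1 := h1 ltac:(apply/andP; split; lra); have {}h2 := h2 ltac:(apply/andP; split; lra).
have L : 0 < y + delta - x by lra.
by rewrite -(ler_pM2l L); lra.
Qed.

(** Outside []y, y + delta[] the inequality without error term is convexity. Inside, both
    [f z - f y] and the linear term are at most [C * delta] in size. *)
Lemma slope_grad y z : f y + slope y * (z - y) - 2 * C * delta <= f z.
Proof.
have d0 := delta0; have C0 := lip_ge0 lf.
have pos : 0 <= 2 * C * delta by rewrite !mulr_ge0 // ltW.
have e := slopeE y.
case: (leP z y) => zy.
  have := @cf z y (y + delta) ltac:(apply/andP; split; lra); rewrite e => h.
  have {}h : delta * (f y + slope y * (z - y)) <= delta * f z by nra.
  by move: h; rewrite ler_pM2l //; lra.
case: (leP (y + delta) z) => zd.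
  have := @cf y (y + delta) z ltac:(apply/andP; split; lra); rewrite e => h.
  have {}h : delta * (f y + slope y * (z - y)) <= delta * f z by nra.
  by move: h; rewrite ler_pM2l //; lra.
have h1 := lip_le y z lf; have h2 := slope_abs y.
have h3 : slope y <= C by apply: le_trans h2; exact: ler_norm.
rewrite distrC gtr0_norm ?subr_gt0 // in h1.
nra.
Qed.

Lemma slope_ge0 y0 y : 0 < y0 -> f 0 < f y0 -> y0 <= y -> 0 <= slope y.
Proof.
have d0 := delta0; move=> y0p h yy; apply: le_trans (slope_nd yy).
have := @cf 0 y0 (y0 + delta) ltac:(apply/andP; split; lra); rewrite slopeE => k.
have {}k : 0 <= y0 * (delta * slope y0) by nra.
by move: k; rewrite pmulr_rge0 // pmulr_rge0.
Qed.

End Convexity.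

Section LeadCost.
Context {d : measure_display} {T : measurableType d} {R : realType}.
Variable P : probability T R.
Variable D : T -> R.
Hypotheses (iD : itg P D) (D0 : forall w, 0 <= D w).
Variables (h b : R).
Hypotheses (h0 : 0 < h) (b0 : 0 < b).

Local Notation mu := (Ex P D).
Local Notation m := (Num.max b h).
Local Notation mn := (Num.min b h).

Definition demand_step (f : R -> R) (y : R) : R := Ex P (fun w => f (y - D w)).

(** With [j = L0.+1] this is the cost caused by the position held after ordering: [L0] periods of
    lead time, plus the demand of the charged period itself. *)
Definition lead_cost j : R -> R := iter j demand_step (newsvendor_cost h b).

Lemma newsvendorE y : newsvendor_cost h b y = if 0 <= y then h * y else - (b * y).
Proof.
rewrite /newsvendor_cost; case: (leP 0 y) => y0.
  by rewrite (max_idPr _) ?oppr_le0 // mulr0 addr0.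
by rewrite (max_idPl _) ?oppr_ge0 ?ltW // mulr0 add0r mulrN.
Qed.

Lemma newsvendor_lip : lip m (newsvendor_cost h b).
Proof.
move=> x y; rewrite !newsvendorE.
have h1 : h <= m by rewrite le_max lexx orbT.
have h2 : b <= m by rewrite le_max lexx.
have h0' := h0; have b0' := b0; move: m h1 h2 => M h1 h2.
case: (leP 0 x) => hx; case: (leP 0 y) => hy; rewrite ler_norml; apply/andP;
  by split; case: (ger0P (x - y)) => hxy; nra.
Qed.

Lemma newsvendor_ge_mn y : mn * `|y| <= newsvendor_cost h b y.
Proof.
rewrite newsvendorE.
have h1 : mn <= h by rewrite ge_min lexx orbT.
have h2 : mn <= b by rewrite ge_min lexx.
by case: (ger0P y) => hy; nra.
Qed.

Lemma newsvendor_ge_h y : h * y <= newsvendor_cost h b y.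
Proof.
have h0' := h0; have b0' := b0.
by rewrite newsvendorE; case: (leP 0 y) => hy; nra.
Qed.

Lemma newsvendor_ge_b y : - (b * y) <= newsvendor_cost h b y.
Proof.
have h0' := h0; have b0' := b0.
by rewrite newsvendorE; case: (leP 0 y) => hy; nra.
Qed.

Lemma newsvendor_cvx : cvx (newsvendor_cost h b).
Proof.
move=> x y z /andP[xy yz]; rewrite [newsvendor_cost h b y]newsvendorE.
have p1 : 0 <= z - y by lra.
have p2 : 0 <= y - x by lra.
case: (leP 0 y) => hy.
  have := ler_wpM2l p1 (newsvendor_ge_h x); have := ler_wpM2l p2 (newsvendor_ge_h z); lra.
have := ler_wpM2l p1 (newsvendor_ge_b x); have := ler_wpM2l p2 (newsvendor_ge_b z); lra.
Qed.

Lemma itg_demand_step C f y : lip C f -> itg P (fun w => f (y - D w)).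
Proof. by move=> lf; apply: itg_lip lf _; exact: itg_walk. Qed.

Lemma demand_step_lip C f : lip C f -> lip C (demand_step f).
Proof.
move=> lf x y; rewrite /demand_step -ExB; [|exact: itg_demand_step lf..].
have iB := itgB (itg_demand_step x lf) (itg_demand_step y lf).
apply: (le_trans (Ex_abs iB)); apply: Ex_le_cst; first exact: itg_abs.
move=> w; apply: (le_trans (lf _ _)).
by rewrite (_ : x - D w - (y - D w) = x - y) //; ring.
Qed.

Lemma lead_lip j : lip m (lead_cost j).
Proof.
by elim: j => [|j IH]; [exact: newsvendor_lip|exact: demand_step_lip].
Qed.

Lemma lead_cvx j : cvx (lead_cost j).
Proof.
elim: j => [|j IH]; first exact: newsvendor_cvx.
move=> x y z xyz; rewrite /= /demand_step.
have i t := itg_demand_step t (lead_lip j).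
rewrite -!ExZl // -ExD; [|exact: itgZl..].
apply: Ex_le; [exact: itgZl|by apply: itgD; exact: itgZl|] => w.
have := IH (x - D w) (y - D w) (z - D w) ltac:(apply/andP; split; lra).
rewrite (_ : z - D w - (x - D w) = z - x); last by ring.
rewrite (_ : z - D w - (y - D w) = z - y); last by ring.
by rewrite (_ : y - D w - (x - D w) = y - x); last by ring.
Qed.

Lemma lead_ge0 j y : 0 <= lead_cost j y.
Proof.
elim: j y => [|j IH] y /=; last by apply: Ex_ge0 => w; exact: IH.
apply: le_trans (newsvendor_ge_mn y).
by rewrite mulr_ge0 // le_min !ltW.
Qed.

Lemma lead_ge_h j y : h * (y - j%:R * mu) <= lead_cost j y.
Proof.
elim: j y => [|j IH] y /=; first by rewrite mul0r subr0; exact: newsvendor_ge_h.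
apply: (@le_trans _ _ (Ex P (fun w => h * (y - j%:R * mu) + (- h) * D w))).
  rewrite ExD; [|exact: itg_cst|exact: itgZl].
  by rewrite Ex_cst ExZl // -natr1; lra.
apply: Ex_le.
- by apply: itgD; [exact: itg_cst|exact: itgZl].
- by apply: itg_demand_step; exact: lead_lip.
- by move=> w; apply: le_trans (IH _); have := h0; lra.
Qed.

Lemma lead_ge_mn j y : mn * (`|y| - j%:R * mu) <= lead_cost j y.
Proof.
have mn0 : 0 <= mn by rewrite le_min !ltW.
elim: j y => [|j IH] y /=; first by rewrite mul0r subr0; exact: newsvendor_ge_mn.
apply: (@le_trans _ _ (Ex P (fun w => mn * (`|y| - j%:R * mu) + (- mn) * D w))).
  rewrite ExD; [|exact: itg_cst|exact: itgZl].
  by rewrite Ex_cst ExZl // -natr1; lra.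
apply: Ex_le.
- by apply: itgD; [exact: itg_cst|exact: itgZl].
- by apply: itg_demand_step; exact: lead_lip.
- move=> w; apply: le_trans (IH _).
  have : `|y| <= `|y - D w| + D w.
    by rewrite -{2}(ger0_norm (D0 w)) (le_trans _ (ler_normD _ _)) // subrK.
  nra.
Qed.

(** Nonnegative demand keeps the stock negative, where the cost is linear. Slopes there are exactly
    [- b], which fixes how low the reorder level must be searched. *)
Lemma lead_neg j y : y <= 0 -> lead_cost j y = b * (j%:R * mu - y).
Proof.
elim: j y => [|j IH] y y0 /=.
  rewrite newsvendorE mul0r sub0r mulrN; case: ifPn => // y0'.
  by rewrite (_ : y = 0) ?mulr0 ?oppr0 //; apply/eqP; rewrite eq_le y0.
rewrite /demand_step (@eq_Ex _ _ _ _ _ (fun w => b * (j%:R * mu - y) + b * D w)); last first.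
  by move=> w; rewrite IH; [ring|have := D0 w; lra].
rewrite ExD; [|exact: itg_cst|exact: itgZl].
by rewrite Ex_cst ExZl // -natr1; ring.
Qed.

End LeadCost.

(** * The reorder level cancelling the discounted slopes *)

Section DiscountedSlope.
Context {d : measure_display} {T : measurableType d} {R : realType}.
Variable P : probability T R.
Variable D : T -> R.
Hypotheses (iD : itg P D) (D0 : forall w, 0 <= D w).
Variables (f : R -> R) (C delta r al : R) (n : nat).
Hypotheses (lf : lip C f) (cf : cvx f) (delta0 : 0 < delta).
Hypotheses (al0 : 0 <= al) (al1 : al < 1).

Local Notation K := (lindley P D r).

Definition shifted_slope S x : R := slope f delta (S + x).

(** The derivative in [S], with [slope] as derivative, of the discounted cost over [n] periods of
    the walk started at excess [x] above [S]. A zero at [x = 0] is the first-order condition for the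
    best reorder level. *)
Definition discounted_slope S x : R :=
  \sum_(i < n) al ^+ i * iter i K (shifted_slope S) x.

Lemma shifted_slope_lip S : lip (2 * C / delta) (shifted_slope S).
Proof. exact/lip_shift/slope_lip. Qed.

Lemma shifted_slope_abs S x : `|shifted_slope S x| <= C.
Proof. exact: slope_abs. Qed.

Lemma shifted_slope_nd S : {homo shifted_slope S : x y / x <= y}.
Proof. by move=> x y xy; apply: slope_nd => //; rewrite lerD2l. Qed.

Lemma discounted_slope_lip S :
  lip (\sum_(i < n) al ^+ i * (2 * C / delta)) (discounted_slope S).
Proof.
move=> x y; rewrite /discounted_slope -sumrB mulr_suml.
apply: le_trans (ler_norm_sum _ _ _) _; apply: ler_sum => i _.
rewrite -mulrBr normrM ger0_norm ?exprn_ge0 // -mulrA ler_wpM2l ?exprn_ge0 //.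
exact: (lip_iter iD r i (shifted_slope_lip S)).
Qed.

Lemma discounted_slope_nd S : {homo discounted_slope S : x y / x <= y}.
Proof.
move=> x y xy; apply: ler_sum => i _; rewrite ler_wpM2l ?exprn_ge0 //.
by apply: (iter_lindley_nd iD r i (shifted_slope_lip S)) => // ? ?; exact: shifted_slope_nd.
Qed.

Lemma discounted_slope_abs S x : `|discounted_slope S x| <= C / (1 - al).
Proof.
apply: le_trans (ler_norm_sum _ _ _) _.
apply: (@le_trans _ _ (\sum_(i < n) al ^+ i * C)).
  apply: ler_sum => i _; rewrite normrM ger0_norm ?exprn_ge0 //.
  rewrite ler_wpM2l ?exprn_ge0 //.
  by apply: (iter_lindley_abs iD r i x (shifted_slope_lip S)) => y; exact: shifted_slope_abs.
by rewrite -mulr_suml mulrC ler_wpM2l ?(lip_ge0 lf) // power_sum_le.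
Qed.

(** The resolvent equation of the discounted walk. Truncation after [n] terms leaves the last
    summand, small through [al ^+ n]. *)
Lemma discounted_slope_rec S x : (0 < n)%N -> discounted_slope S x =
  shifted_slope S x + al * lindley P D r (discounted_slope S) x
  - al ^+ n * iter n K (shifted_slope S) x.
Proof.
move=> n0.
have -> : lindley P D r (discounted_slope S) x =
    \sum_(i < n) al ^+ i * iter i.+1 K (shifted_slope S) x.
  rewrite /lindley /discounted_slope /= Ex_sum; last first.
    move=> i _; apply: itgZl; apply: itg_lindley => //.
    exact: lip_iter (shifted_slope_lip S).
  apply: eq_bigr => i _; rewrite ExZl //; apply: itg_lindley => //.
  exact: lip_iter (shifted_slope_lip S).
rewrite mulr_sumr.
under eq_bigr => i _ do rewrite mulrA -exprS.
have e : \sum_(i < n) al ^+ i * iter i K (shifted_slope S) x +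
    al ^+ n * iter n K (shifted_slope S) x =
    shifted_slope S x + \sum_(i < n) al ^+ i.+1 * iter i.+1 K (shifted_slope S) x.
  have := big_ord_recr n (fun i : 'I_n.+1 => al ^+ i * iter i K (shifted_slope S) x).
  by move=> <-; rewrite big_ord_recl expr0 mul1r.
rewrite /discounted_slope -[LHS](addrK (al ^+ n * iter n K (shifted_slope S) x)).
by rewrite e.
Qed.

Let cont_S : continuous (fun S => discounted_slope S 0).
Proof.
apply: (@lip_continuous _ (\sum_(i < n) al ^+ i * (2 * C / delta))) => S S'.
rewrite /discounted_slope -sumrB mulr_suml.
apply: le_trans (ler_norm_sum _ _ _) _; apply: ler_sum => i _.
rewrite -mulrBr normrM ger0_norm ?exprn_ge0 // -mulrA ler_wpM2l ?exprn_ge0 //.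
apply: (iter_lindley_sup iD r i 0 (shifted_slope_lip S) (shifted_slope_lip S')) => y.
have := slope_lip lf delta0 (S + y) (S' + y).
by rewrite opprD addrACA subrr addr0.
Qed.

(** Intermediate value theorem in [S]. From [hi] on the cost increases, so all slopes are
    nonnegative; at the lower end the walk, of mean at most [Om], spends too little weight where
    slopes are positive. *)
Lemma discounted_slope_root b hi Om : 0 < b -> 0 < hi -> f 0 < f hi ->
  (forall x y, x <= 0 -> y <= 0 -> f x - f y = b * (y - x)) ->
  0 <= Om -> (forall i, iter i K id 0 <= Om) ->
  exists S, - (2 * delta + (b + C) / b * Om) <= S <= hi /\ discounted_slope S 0 = 0.
Proof.
move=> b0 hi0 fhi fneg Om0 KOm.
set lo := - _; have d0 := delta0; have C0 := lip_ge0 lf.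
have bCO : 0 <= (b + C) / b * Om.
  by rewrite mulr_ge0 // divr_ge0 ?addr_ge0 // ltW.
have lo0 : - lo - delta > 0 by rewrite /lo opprK; lra.
have lohi : lo <= hi by lra.
have hge : 0 <= discounted_slope hi 0.
  apply: sumr_ge0 => i _; rewrite mulr_ge0 ?exprn_ge0 //.
  have l0 : lip 0 (fun _ : R => 0 : R) by move=> ? ?; rewrite subrr normr0 mul0r.
  have H := iter_lindley_le iD r i l0 (shifted_slope_lip hi).
  have z j x : iter j K (fun=> 0) x = 0.
    elim: j x => // j IH x /=; rewrite -[RHS](Ex_cst P) /lindley.
    by apply: eq_Ex => w; exact: IH.
  have := H _ 0 (lexx 0); rewrite z; apply => x x0.
  by apply: (slope_ge0 cf delta0 hi0 fhi); rewrite lerDl.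
have hle : discounted_slope lo 0 <= 0.
  rewrite -oppr_ge0 -sumrN; apply: sumr_ge0 => i _.
  rewrite -mulrN mulr_ge0 ?exprn_ge0 // oppr_ge0.
  have lid : lip 1 (id : R -> R) by move=> ? ?; rewrite mul1r.
  (* The line through [- b] at 0 that reaches [C] at [x = - lo - delta]. It dominates the shifted
     slope: that slope equals [- b] up to this point and is at most [C] after it. Being affine, it
     is integrated by the mean of the walk alone. *)
  pose c := (b + C) / (- lo - delta).
  have c0 : 0 <= c by apply: divr_ge0; [exact: addr_ge0 (ltW b0) C0|exact: ltW].
  have la : lip c (fun x : R => - b + c * x).
    move=> x y; rewrite opprD addrACA subrr add0r -mulrBr normrM.
    by rewrite ger0_norm.
  have := iter_lindley_le iD r i (shifted_slope_lip lo) la.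
  move=> /(_ _ 0 (lexx 0)) H; apply: (le_trans (H _)).
    move=> x x0; rewrite /shifted_slope /slope ler_pdivrMr //.
    case: (leP (lo + x + delta) 0) => hx.
      rewrite fneg //; last by lra.
      have : 0 <= c * x * delta by apply: mulr_ge0; [exact: mulr_ge0|exact: ltW].
      lra.
    have h1 := lip_le (lo + x + delta) (lo + x) lf.
    have e1 : lo + x + delta - (lo + x) = delta by ring.
    rewrite e1 (gtr0_norm d0) in h1.
    have : C * delta <= (- b + c * x) * delta.
      have : b + C <= c * x.
        rewrite /c mulrAC ler_pdivlMr //; apply: ler_wpM2l; last lra.
        exact: addr_ge0 (ltW b0) C0.
      by move=> h2; rewrite ler_wpM2r ?(ltW d0) //; lra.
    lra.
  rewrite (iter_lindley_affine iD r _ _ i 0 lid).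
  have : c * iter i K id 0 <= c * Om by rewrite ler_wpM2l.
  have : c * Om <= b.
    rewrite /c mulrAC ler_pdivrMr // /lo opprK.
    have e : b * ((b + C) / b * Om) = (b + C) * Om by field; rewrite gt_eqF.
    have bd : 0 <= b * delta by rewrite mulr_ge0 // ltW.
    have e2 : b * (2 * delta + (b + C) / b * Om - delta) =
      b * delta + b * ((b + C) / b * Om) by ring.
    by rewrite e2 e; lra.
  lra.
have [S Sin S0] : exists2 c, c \in `[lo, hi]%R & discounted_slope c 0 = 0.
  apply: (@IVT _ (fun S => discounted_slope S 0) lo hi 0) => //.
  - exact: continuous_subspaceT.
  - by rewrite ge_min hle /= le_max hge orbT.
by exists S; split => //; move: Sin; rewrite in_itv.
Qed.

End DiscountedSlope.

(** * Comparison inside a window *)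

Section Window.
Context {d : measure_display} {T : measurableType d} {R : realType}.
Variable P : probability T R.
Variables (I : eqType) (X : I -> T -> R).
Hypothesis mX : forall i, measurable_fun setT (X i).
Hypothesis indX : mutually_independent P X.
Variable D : T -> R.
Hypotheses (iD : itg P D) (D0 : forall w, 0 <= D w).
Variables (idx : nat -> I) (J : nat -> set I).
Hypotheses (Jmono : forall t, J t `<=` J t.+1) (Jidx : forall t, J t.+1 (idx t)).
Hypotheses (Jfresh : forall t, ~ J t (idx t)).
Hypothesis lawX : forall t, same_law P (X (idx t)) D.

Let mD : measurable_fun setT D. Proof. exact: itg_mfun iD. Qed.

(** What is known just before the demand [idx t] is revealed. The index families stay abstract
    because they are instantiated twice: with [Dt] for the dynamics and with [Dt'] for the
    constants. *)
Definition history t := known X (J t).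

Definition adapted t (Z : T -> R) := measurable_fun setT (Z : history t -> R).

Lemma history_le t t' d' (U : measurableType d') (Z : T -> U) : (t <= t')%N ->
  measurable_fun setT (Z : history t -> U) ->
  measurable_fun setT (Z : history t' -> U).
Proof.
move=> /subnK <- mZ; elim: (t' - t)%N => // k IH.
by rewrite addSn; apply: known_subset IH; exact: Jmono.
Qed.

Lemma adapted_le t t' Z : (t <= t')%N -> adapted t Z -> adapted t' Z.
Proof. exact: history_le. Qed.

Lemma adapted_mfun t Z : adapted t Z -> measurable_fun setT Z.
Proof. exact: (known_mfun mX). Qed.

Lemma adapted_demand t : adapted t.+1 (X (idx t)).
Proof. by apply: known_var; exact: Jidx. Qed.

Lemma itg_same_law Y (f : R -> R) : measurable_fun setT Y -> same_law P Y D ->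
  measurable_fun setT f -> itg P (fun w => f (D w)) -> itg P (fun w => f (Y w)).
Proof.
move=> mY YD mf.
have mef : measurable_fun setT (fun x => `|(f x)%:E|%E).
  by apply: measurableT_comp => //; exact/measurable_EFinP.
pose Y' : {mfun T >-> R} := HB.pack Y (isMeasurableFun.Build _ _ _ _ Y mY).
pose D' : {mfun T >-> R} := HB.pack D (isMeasurableFun.Build _ _ _ _ D mD).
move=> /integrableP[_ h]; apply/integrableP; split.
  by apply/measurable_EFinP; exact: (measurableT_comp mf mY).
apply: le_lt_trans h; rewrite le_eqVlt; apply/orP; left; apply/eqP.
have := ge0_integral_distribution Y' mef (fun=> abse_ge0 _) => /= <-.
have := ge0_integral_distribution D' mef (fun=> abse_ge0 _) => /= <-.
by apply: eq_measure_integral => A mA _; exact: YD.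
Qed.

Lemma itg_demand t : itg P (X (idx t)).
Proof. exact: (@itg_same_law (X (idx t)) id (mX _) (lawX t) (@measurable_id _ _ _) iD). Qed.

(** The Markov property, tested against a weight [Z] known at time [t]. Integrability is returned as
    well so that the step can be iterated. *)
Lemma one_step C t (Z V : T -> R) (f : R -> R) : lip C f ->
  adapted t Z -> adapted t V ->
  itg P (fun w => Z w * f (V w - X (idx t) w)) ->
  itg P (fun w => Z w * demand_step P D f (V w)) /\
  Ex P (fun w => Z w * f (V w - X (idx t) w)) =
  Ex P (fun w => Z w * demand_step P D f (V w)).
Proof.
move=> lf aZ aV iF.
pose F (p : history t * R) : R := Z p.1 * f (V p.1 - p.2).
have mF : measurable_fun setT F.
  apply: measurable_funM; first exact: (measurableT_comp aZ).
  apply: (measurableT_comp (lip_mfun lf)); apply: measurable_funB => //.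
  exact: (measurableT_comp aV).
have [] := known_decouple mX indX (@Jfresh t) mD (lawX t) mF iF.
have inner w : Ex P (fun w' => F (w, D w')) = Z w * demand_step P D f (V w).
  by rewrite /F /= ExZl //; apply: itg_lip lf _; exact: itg_walk.
by under eq_fun do rewrite inner.
Qed.

Lemma one_step1 C t (V : T -> R) (f : R -> R) : lip C f ->
  adapted t V -> itg P V ->
  Ex P (fun w => f (V w - X (idx t) w)) = Ex P (fun w => demand_step P D f (V w)).
Proof.
move=> lf aV iV; have [] := one_step (Z := fun=> 1) lf _ aV.
- exact: measurable_cst.
- under eq_fun do rewrite mul1r; apply: itg_lip lf _; apply: itgB => //.
  exact: itg_demand.
- by under [X in itg P X]eq_fun do rewrite mul1r; move=> _;
    under eq_Ex do rewrite mul1r; move=> ->; apply: eq_Ex => w; rewrite mul1r.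
Qed.

Lemma lead_iter C t j (V : T -> R) (f : R -> R) : lip C f ->
  adapted t V -> itg P V ->
  Ex P (fun w => f (V w - \sum_(i < j) X (idx (t + i)) w)) =
  Ex P (fun w => iter j (demand_step P D) f (V w)).
Proof.
move=> + aV iV; elim: j f => [|j IH] f lf.
  by apply: eq_Ex => w; rewrite big_ord0 subr0.
under eq_Ex do rewrite big_ord_recr opprD addrA /=.
rewrite (one_step1 (t := t + j) lf).
- by rewrite IH; [rewrite iterSr|exact: demand_step_lip].
- apply: measurable_funB; first exact: adapted_le (leq_addr _ _) aV.
  apply: measurable_sum => i; apply: adapted_le (@adapted_demand (t + i)).
  by rewrite -addnS leq_add2l.
- apply: itgB => //; apply: itg_sum => i _; exact: itg_demand.
Qed.

Variables (t0 : nat) (r : R).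

Local Notation K := (lindley P D r).

(** The excess over the reorder level of a TBS policy restarted at that level at time [t0] and fed
    by the very demands the compared policy meets. *)
Fixpoint reflected k : T -> R :=
  if k is k'.+1 then fun w => Num.max 0 (reflected k' w + r - X (idx (t0 + k')) w)
  else fun=> 0.

Lemma reflected_adapted k : adapted (t0 + k) (reflected k).
Proof.
elim: k => [|k IH] /=; first exact: measurable_cst.
apply: measurable_maxr => //; apply: measurable_funB.
  apply: measurable_funD => //.
  by apply: adapted_le IH; rewrite addnS.
by rewrite addnS; exact: adapted_demand.
Qed.

Lemma itg_reflected k : itg P (reflected k).
Proof.
elim: k => [|k IH] /=; first exact: itg_cst.
apply: itg_max; first exact: itg_cst.
apply: itgB; last exact: itg_demand.
by apply: itgD => //; exact: itg_cst.
Qed.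

Lemma reflected_ge0 k w : 0 <= reflected k w.
Proof. by case: k => //= k; rewrite le_max lexx. Qed.

Lemma lip_reflect C (f : R -> R) : lip C f -> lip C (fun x => f (Num.max 0 x)).
Proof.
move=> lf x y; apply: (le_trans (lf _ _)); rewrite ler_wpM2l ?(lip_ge0 lf) //.
by have := lip_max 0 x y; rewrite mul1r.
Qed.

Lemma reflected_step C k (Z : T -> R) (f : R -> R) : lip C f ->
  adapted (t0 + k) Z -> itg P (fun w => Z w * f (reflected k.+1 w)) ->
  itg P (fun w => Z w * K f (reflected k w)) /\
  Ex P (fun w => Z w * f (reflected k.+1 w)) = Ex P (fun w => Z w * K f (reflected k w)).
Proof.
move=> lf aZ iZ.
apply: (one_step (V := fun w => reflected k w + r) (lip_reflect lf) aZ _ iZ).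
by apply: measurable_funD => //; exact: reflected_adapted.
Qed.

(** The walk uses only demands from [t0] on, so a weight known at [t0] splits off. Used with [Z] an
    arrival of the window minus [r]. *)
Lemma reflected_iter C k (Z : T -> R) (f : R -> R) : lip C f ->
  adapted t0 Z -> itg P Z -> itg P (fun w => Z w * f (reflected k w)) ->
  Ex P (fun w => Z w * f (reflected k w)) = Ex P Z * iter k K f 0.
Proof.
move=> + aZ iZ; elim: k f => [|k IH] f lf iF; first by rewrite /= ExZr.
have [iF' ->] := reflected_step lf (adapted_le (leq_addr k t0) aZ) iF.
by rewrite IH ?iterSr //; exact: lip_lindley.
Qed.

Lemma reflected_iter1 C k (f : R -> R) : lip C f ->
  Ex P (fun w => f (reflected k w)) = iter k K f 0.
Proof.
move=> lf; have := @reflected_iter C k (fun=> 1) f lf (measurable_cst _) (itg_cst P 1).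
rewrite Ex_cst mul1r => <-; first by apply: eq_Ex => w; rewrite mul1r.
by under eq_fun do rewrite mul1r; apply: itg_lip lf _; exact: itg_reflected.
Qed.

Variables (y q arr : nat -> T -> R) (n : nat).
Hypotheses (ay : forall t, (t0 <= t)%N -> adapted t (y t)).
Hypotheses (iy : forall t, (t0 <= t)%N -> itg P (y t)).
Hypotheses (iq : forall t, (t0 < t)%N -> itg P (q t)).
Hypothesis (q0 : forall t w, 0 <= q t w).
Hypothesis (aarr : forall k, (0 < k <= n)%N -> adapted t0 (arr (t0 + k))).
Hypothesis (iarr : forall t, (t0 < t)%N -> itg P (arr t)).
Hypothesis (dyn : forall t w, (t0 <= t)%N ->
  y t.+1 w = y t w - X (idx t) w + arr t.+1 w + q t.+1 w).

Variables (f : R -> R) (C delta al S : R).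
Hypotheses (lf : lip C f) (cf : cvx f) (delta0 : 0 < delta).
Hypotheses (al0 : 0 <= al) (al1 : al < 1) (n0 : (0 < n)%N).

Local Notation sl := (shifted_slope f delta S).
Local Notation ell := (discounted_slope P D f delta r al n S).
Hypothesis ell0 : ell 0 = 0.

Let gap k w := y (t0 + k) w - (S + reflected k w).

Let itg_gap k : itg P (gap k).
Proof.
apply: itgB; first by apply: iy; rewrite leq_addr.
by apply: itgD; [exact: itg_cst|exact: itg_reflected].
Qed.

Let adapted_gap k : adapted (t0 + k) (gap k).
Proof.
apply: measurable_funB; first by apply: ay; rewrite leq_addr.
by apply: measurable_funD => //; exact: reflected_adapted.
Qed.

Let lell := discounted_slope_lip iD r n lf delta0 al0 S.
Let ell_abs := discounted_slope_abs iD r n lf delta0 al0 al1 S.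

(** The discounted slope is monotone and vanishes at 0. Its sign makes express orders favourable,
    and its zero cancels the reflection. *)
Let ell_ge0 x : 0 <= x -> 0 <= ell x.
Proof. by move=> x0; rewrite -ell0; exact: (discounted_slope_nd iD r n lf cf delta0 al0). Qed.

Let mref k : measurable_fun setT (reflected k).
Proof. exact: itg_mfun (itg_reflected k). Qed.

Let itg_ell Z k : itg P Z -> itg P (fun w => Z w * ell (reflected k w)).
Proof.
move=> iZ; apply: (itgM_bounded iZ _ (fun w => ell_abs _)).
exact: (measurableT_comp (lip_mfun lell)).
Qed.

Let itg_sl Z k j : itg P Z -> itg P (fun w => Z w * iter j K sl (reflected k w)).
Proof.
move=> iZ; apply: (itgM_bounded iZ (a := C)).
  exact: (measurableT_comp (lip_mfun (lip_iter iD r j (shifted_slope_lip lf delta0 S)))).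
move=> w; apply: (iter_lindley_abs iD r j _ (shifted_slope_lip lf delta0 S)) => x.
exact: shifted_slope_abs.
Qed.

(** The gap between policy and walk changes by the arrival minus [r], plus the express order, minus
    the push of the reflection. Weighted by [ell] at the new state, the push disappears, the order
    contributes a nonnegative amount and the arrival factors. The recursion of [ell] turns this into
    one step of a telescoping sum. *)
Lemma window_step k : (k < n)%N ->
  Ex P (fun w => gap k w * ell (reflected k w))
  - al * Ex P (fun w => gap k.+1 w * ell (reflected k.+1 w))
  + al * iter k.+1 K ell 0 * (Ex P (arr (t0 + k.+1)%N) - r)
  - al ^+ n * C * Ex P (fun w => `|gap k w|)
  <= Ex P (fun w => gap k w * sl (reflected k w)).
Proof.
move=> kn.
have ik := itg_gap k; have ik1 := itg_gap k.+1.
have iarr1 : itg P (arr (t0 + k.+1)%N) by apply: iarr; rewrite addnS ltnS leq_addr.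
have [iKg eKg] := reflected_step lell (@adapted_gap k) (itg_ell k.+1 ik).
have iAr : itg P (fun w => arr (t0 + k.+1)%N w - r) by apply: itgB => //; exact: itg_cst.
have aAr : adapted t0 (fun w => arr (t0 + k.+1)%N w - r).
  by apply: measurable_funB => //; apply: aarr; rewrite ltnS kn.
have eAr := reflected_iter lell aAr iAr (itg_ell k.+1 iAr).
rewrite ExB // ?Ex_cst in eAr; last exact: itg_cst.
have key : Ex P (fun w => gap k w * ell (reflected k.+1 w)) <=
    Ex P (fun w => gap k.+1 w * ell (reflected k.+1 w) -
                   (arr (t0 + k.+1)%N w - r) * ell (reflected k.+1 w)).
  apply: Ex_le; [exact: itg_ell|by apply: itgB; exact: itg_ell|] => w.
  rewrite -mulrBl.
  set L := ell _; have L0 : 0 <= L by exact/ell_ge0/reflected_ge0.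
  pose v := reflected k w + r - X (idx (t0 + k)) w.
  have gE : gap k.+1 w - (arr (t0 + k.+1)%N w - r) =
      gap k w + q (t0 + k.+1)%N w - (Num.max 0 v - v).
    by rewrite /gap addnS dyn ?leq_addr // /= /v; ring.
  (* Complementary slackness: the reflection pushes only when the walk lands at 0, where [ell]
     vanishes. *)
  have LS : L * (Num.max 0 v - v) = 0.
    rewrite /L /= -/v; case: (leP 0 v) => hv; first by rewrite subrr mulr0.
    by rewrite ell0 mul0r.
  rewrite gE; have := mulr_ge0 (q0 (t0 + k.+1) w) L0; lra.
rewrite ExB in key; [|exact: itg_ell..].
rewrite eAr eKg in key.
have eE : Ex P (fun w => gap k w * ell (reflected k w)) =
    Ex P (fun w => gap k w * sl (reflected k w))
    + al * Ex P (fun w => gap k w * K ell (reflected k w))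
    - al ^+ n * Ex P (fun w => gap k w * iter n K sl (reflected k w)).
  rewrite -!ExZl //; last exact: itg_sl.
  rewrite -ExD; [|exact: (itg_sl k 0 ik)|exact: itgZl].
  rewrite -ExB; last 2 first.
  - by apply: itgD; [exact: (itg_sl k 0 ik)|exact: itgZl].
  - by apply: itgZl; exact: itg_sl.
  apply: eq_Ex => w.
  rewrite (discounted_slope_rec iD r al lf delta0 S (reflected k w) n0); ring.
(* The truncation term has no useful sign and is bounded crudely; its factor [al ^+ n] pays for
   this. *)
have eN : - (C * Ex P (fun w => `|gap k w|)) <=
    Ex P (fun w => gap k w * iter n K sl (reflected k w)).
  rewrite lerNl -ExN; last exact: itg_sl.
  rewrite -ExZl; last exact: itg_abs.
  apply: Ex_le; [by apply: itgN; exact: itg_sl|by apply: itgZl; exact: itg_abs|].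
  move=> w; apply: (le_trans (ler_norm _)); rewrite normrN normrM mulrC.
  apply: ler_wpM2r => //.
  apply: (iter_lindley_abs iD r n _ (shifted_slope_lip lf delta0 S)) => x.
  exact: shifted_slope_abs.
have a0 := al0; have an0 : 0 <= al ^+ n by exact: exprn_ge0.
have := ler_wpM2l a0 key; have := ler_wpM2l an0 eN.
rewrite eE; lra.
Qed.

(** Gradient inequality in each period plus the discounted sum of [window_step]. The initial term of
    the telescope is 0 because the walk starts at 0 and [ell 0 = 0]; the final one is bounded
    through [ell <= C / (1 - al)]. *)
Lemma window_bound Om (fy : nat -> R) (Y : nat -> R) :
  (forall k, iter k K id 0 <= Om) ->
  (forall k, (k < n)%N -> Ex P (fun w => f (y (t0 + k) w)) <= fy k) ->
  (forall k, (k <= n)%N -> Ex P (fun w => `|y (t0 + k) w|) <= Y k) ->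
  \sum_(k < n) al ^+ k * (iter k K (fun x => f (S + x)) 0 - 2 * C * delta)
  + \sum_(k < n) al ^+ k.+1 * iter k.+1 K ell 0 * (Ex P (arr (t0 + k.+1)%N) - r)
  - \sum_(k < n) al ^+ k * (al ^+ n * C * (Y k + `|S| + Om))
  - al ^+ n * (C / (1 - al)) * (Y n + `|S| + Om)
  <= \sum_(k < n) al ^+ k * fy k.
Proof.
move=> KOm hfy hY.
have C0 := lip_ge0 lf; have a0 := al0; have an0 : 0 <= al ^+ n by exact: exprn_ge0.
have hgap k : (k <= n)%N -> Ex P (fun w => `|gap k w|) <= Y k + `|S| + Om.
  move=> kn.
  have ia : itg P (fun w => `|y (t0 + k) w|) by apply/itg_abs/iy/leq_addr.
  apply: (@le_trans _ _ (Ex P (fun w => (`|y (t0 + k) w| + `|S|) + reflected k w))).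
    apply: Ex_le; first exact: itg_abs.
      by apply: itgD; [apply: itgD => //; exact: itg_cst|exact: itg_reflected].
    move=> w; rewrite /gap opprD addrA.
    apply: (le_trans (ler_normB _ _)); rewrite (ger0_norm (reflected_ge0 _ _)) lerD2r.
    exact: ler_normB.
  rewrite ExD; [|by apply: itgD => //; exact: itg_cst|exact: itg_reflected].
  rewrite ExD //; last exact: itg_cst.
  rewrite Ex_cst lerD //; first by rewrite lerD2r; exact: hY.
  have l1 : lip 1 (id : R -> R) by move=> ? ?; rewrite mul1r.
  by rewrite (reflected_iter1 k l1).
have hgrad k : (k < n)%N -> iter k K (fun x => f (S + x)) 0 - 2 * C * delta
    + Ex P (fun w => gap k w * sl (reflected k w)) <= fy k.
  move=> kn; apply: le_trans (hfy k kn).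
  have ls := lip_shift S lf.
  have i1 : itg P (fun w => f (S + reflected k w)).
    by apply: (itg_lip ls); exact: itg_reflected.
  have i2 : itg P (fun w => gap k w * sl (reflected k w)) := itg_sl k 0 (itg_gap k).
  rewrite -(reflected_iter1 k ls) -[X in _ - X](Ex_cst P) -ExB //; last exact: itg_cst.
  rewrite -ExD //; last by apply: itgB => //; exact: itg_cst.
  apply: Ex_le.
  - by apply: itgD => //; apply: itgB => //; exact: itg_cst.
  - by apply: (itg_lip lf); apply: iy; rewrite leq_addr.
  move=> w; have := slope_grad lf cf delta0 (S + reflected k w) (y (t0 + k) w).
  rewrite /gap /shifted_slope; lra.
pose A k := Ex P (fun w => gap k w * ell (reflected k w)).
have A0 : A 0%N = 0.
  by rewrite /A -[RHS](Ex_cst P); apply: eq_Ex => w /=; rewrite ell0 mulr0.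
have An : al ^+ n * A n <= al ^+ n * (C / (1 - al)) * (Y n + `|S| + Om).
  rewrite -mulrA ler_wpM2l //.
  have Cal : 0 <= C / (1 - al) by rewrite divr_ge0 // subr_ge0 ltW.
  apply: (@le_trans _ _ (C / (1 - al) * Ex P (fun w => `|gap n w|))); last first.
    by rewrite ler_wpM2l // hgap.
  rewrite -ExZl; last exact: itg_abs.
  apply: Ex_le; [exact: itg_ell|by apply: itgZl; exact: itg_abs|] => w.
  apply: (le_trans (ler_norm _)); rewrite normrM mulrC ler_wpM2r //.
have tel : \sum_(k < n) (al ^+ k * A k - al ^+ k.+1 * A k.+1) = - (al ^+ n * A n).
  rewrite -(big_mkord xpredT (fun k => al ^+ k * A k - al ^+ k.+1 * A k.+1)).
  under eq_bigr do rewrite -opprB.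
  by rewrite sumrN (telescope_sumr (fun k => al ^+ k * A k)) // A0 mulr0 subr0.
suff main : \sum_(k < n) (al ^+ k * (iter k K (fun x => f (S + x)) 0 - 2 * C * delta)
   + al ^+ k.+1 * iter k.+1 K ell 0 * (Ex P (arr (t0 + k.+1)%N) - r)
   - al ^+ k * (al ^+ n * C * (Y k + `|S| + Om))
   + (al ^+ k * A k - al ^+ k.+1 * A k.+1)) <= \sum_(k < n) al ^+ k * fy k.
  apply: le_trans main; rewrite big_split /= tel sumrB big_split /=; lra.
apply: ler_sum => k _; have kn := ltn_ord k.
have ak0 : 0 <= al ^+ k by exact: exprn_ge0.
have h1 := ler_wpM2l ak0 (hgrad k kn).
have h2 := ler_wpM2l ak0 (window_step kn).
have h3 : al ^+ k * (al ^+ n * C * Ex P (fun w => `|gap k w|)) <=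
    al ^+ k * (al ^+ n * C * (Y k + `|S| + Om)).
  by rewrite ler_wpM2l // ler_wpM2l ?mulr_ge0 // hgap // ltnW.
rewrite exprS -/(A k) -/(A k.+1) in h2 *.
lra.
Qed.

End Window.

(** * Dynamics of a policy *)

Definition demand_index (t : nat) : int + int + unit := inl (inl t%:Z).

(** All of [Dt'] and [Ghat] counts as past, since the initial inventory is built from them. In
    [past'] the two demand families exchange roles. *)
Definition past (t : nat) : set (int + int + unit) :=
  [set i | if i is inl (inl s) then (s < t%:Z)%R else True].

Definition future_index (t : nat) : int + int + unit := inl (inr t%:Z).

Definition past' (t : nat) : set (int + int + unit) :=
  [set i | if i is inl (inr s) then (s < t%:Z)%R else True].

Lemma past_mono t : past t `<=` past t.+1.
Proof. by move=> [[s|s]|[]] //= h; lia. Qed.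

Lemma past_demand t : past t.+1 (demand_index t).
Proof. by rewrite /past /=; lia. Qed.

Lemma past_fresh t : ~ past t (demand_index t).
Proof. by rewrite /past /=; lia. Qed.

Lemma past'_mono t : past' t `<=` past' t.+1.
Proof. by move=> [[s|s]|[]] //= h; lia. Qed.

Lemma past'_demand t : past' t.+1 (future_index t).
Proof. by rewrite /past' /=; lia. Qed.

Lemma past'_fresh t : ~ past' t (future_index t).
Proof. by rewrite /past' /=; lia. Qed.

Section PolicyDynamics.
Context {d : measure_display} {T : measurableType d} {R : realType}.
Variable P : probability T R.
Variables (L0 L : nat).
Variables (Dt Dt' : int -> T -> R) (Ghat : T -> nat).
Hypotheses (mDt : forall t, measurable_fun setT (Dt t))
  (mDt' : forall t, measurable_fun setT (Dt' t)) (mG : measurable_fun setT Ghat).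
Hypothesis L0L : (L0 + 1 < L)%N.

Local Notation X := (primitives Dt Dt' Ghat).

Lemma measurable_primitives i : measurable_fun setT (X i).
Proof.
case: i => [[s|s]|[]] /=; [exact: mDt|exact: mDt'|].
exact: measurableT_comp.
Qed.

Variable f : @policy R L0 L.
Hypothesis af : admissible f.

Local Notation st := (state_after Dt Dt' Ghat f).
Local Notation H t := (known X (past t)).

Definition placed_regular t w : R := regular (st t w) t%:Z.
Definition placed_express t w : R := express (st t w) t%:Z.
Definition position t w : R := expedited_position L0 L t (st t.-1 w).

Let decision t w : R * R :=
  f t.+1 (truncated_pipeline L0 L t.+1 (st t w), expedited_position L0 L t.+1 (st t w)).

(** The number of summands is random, so measurability is checked on each set where [Ghat] is
    constant. *)
Let measurable_initial t : measurable_fun setT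
  ((fun w => inventory (initial_state Dt' Ghat w)) : H t -> R).
Proof.
pose E (n : nat) : set (H t) := [set w | Ghat w = n].
have mGh : measurable_fun setT ((fun w => (Ghat w)%:R) : H t -> R).
  exact: (@known_var _ _ _ _ X (past t) (inr tt)).
have mE n : measurable (E n).
  have -> : E n = setT `&` (fun w => (Ghat w)%:R : R) @^-1` [set n%:R].
    rewrite setTI; apply/seteqP; split => w /=; first by move=> ->.
    by move=> /eqP; rewrite eqr_nat => /eqP.
  by apply: mGh.
have UE : \bigcup_n E n = setT.
  by apply/seteqP; split => // w _; exists (Ghat w).
rewrite -UE; apply/measurable_fun_bigcup => // n.
apply: (eq_measurable_fun (fun w : H t => - \sum_(1 <= i < n.+1) Dt' (- i%:Z) w)).
  by move=> w; rewrite inE /E /= => ->.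
apply: measurable_funTS; apply: measurableT_comp => //; apply: measurable_sum => i.
exact: (@known_var _ _ _ _ X (past t) (inl (inr (- i%:Z)))).
Qed.

Let adapted_state t :=
  [/\ measurable_fun setT ((fun w => inventory (st t w)) : H t.+1 -> R),
      forall k, measurable_fun setT ((fun w => regular (st t w) k) : H t.+1 -> R) &
      forall k, measurable_fun setT ((fun w => express (st t w) k) : H t.+1 -> R)].

Let position_adapted0 t : adapted_state t -> measurable_fun setT
  ((fun w => expedited_position L0 L t.+1 (st t w)) : H t.+1 -> R).
Proof.
move=> [iI iR iE]; rewrite /expedited_position; apply: measurable_funD.
  by apply: measurable_funD => //; apply: measurable_sum => i; exact: iE.
by apply: measurable_sum => i; exact: iR.
Qed.

Let decision_adapted0 t : adapted_state t ->
  measurable_fun setT (decision t : H t.+1 -> (R * R)%type).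
Proof.
move=> a; have [iI iR iE] := a.
apply: (measurableT_comp (af t.+1).1); apply: measurable_fun_pair.
  apply/measurable_fun_tnthP => i.
  rewrite (_ : _ \o _ = fun w => regular (st t w)
     (t.+1%:Z - L%:Z + L0%:Z + 1 + i%:Z)); first exact: iR.
  by apply/funext => w /=; rewrite tnth_mktuple.
exact: position_adapted0.
Qed.

Lemma state_adapted t : adapted_state t.
Proof.
elim: t => [|t IH].
  by split; [exact: measurable_initial|move=> k; exact: measurable_cst..].
have [iI iR iE] := IH; have dec := decision_adapted0 IH.
have up (Z : T -> R) : measurable_fun setT (Z : H t.+1 -> R) ->
    measurable_fun setT (Z : H t.+2 -> R).
  by apply: known_subset; exact: past_mono.
have d1 : measurable_fun setT ((fun w => (decision t w).1) : H t.+2 -> R).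
  by apply: up; exact: (measurableT_comp measurable_fst dec).
have d2 : measurable_fun setT ((fun w => (decision t w).2) : H t.+2 -> R).
  by apply: up; exact: (measurableT_comp measurable_snd dec).
have mR k : measurable_fun setT ((fun w => regular (st t.+1 w) k) : H t.+2 -> R).
  by rewrite /=; case: eqP => _ //; apply: up; exact: iR.
have mE k : measurable_fun setT ((fun w => express (st t.+1 w) k) : H t.+2 -> R).
  by rewrite /=; case: eqP => _ //; apply: up; exact: iE.
split => //; apply: measurable_funB.
  apply: measurable_funD; last exact: mE.
  by apply: measurable_funD; [exact: up|exact: mR].
exact: (@known_var _ _ _ _ X (past t.+2) (demand_index t.+1) (past_demand _)).
Qed.

Lemma position_adapted t :
  measurable_fun setT (position t.+1 : H t.+1 -> R).
Proof. by have := position_adapted0 (state_adapted t). Qed.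

Lemma placed_regularS t w : placed_regular t.+1 w = (decision t w).1.
Proof. by rewrite /placed_regular /= eqxx. Qed.

Lemma placed_expressS t w : placed_express t.+1 w = (decision t w).2.
Proof. by rewrite /placed_express /= eqxx. Qed.

Lemma placed_regular_adapted t : measurable_fun setT (placed_regular t : H t -> R).
Proof.
case: t => [|t]; first exact: measurable_cst.
rewrite (_ : placed_regular _ = fun w => (decision t w).1).
  by apply: (measurableT_comp measurable_fst (decision_adapted0 (state_adapted t))).
by apply/funext => w; exact: placed_regularS.
Qed.

Lemma placed_express_adapted t : measurable_fun setT (placed_express t : H t -> R).
Proof.
case: t => [|t]; first exact: measurable_cst.
rewrite (_ : placed_express _ = fun w => (decision t w).2).
  by apply: (measurableT_comp measurable_snd (decision_adapted0 (state_adapted t))).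
by apply/funext => w; exact: placed_expressS.
Qed.

Lemma placed_regular_ge0 t w : 0 <= placed_regular t w.
Proof.
by case: t => [|t] //; rewrite placed_regularS /decision; set p := (X in f _ X);
  have [_ /(_ p) []] := af t.+1.
Qed.

Lemma placed_express_ge0 t w : 0 <= placed_express t w.
Proof.
by case: t => [|t] //; rewrite placed_expressS /decision; set p := (X in f _ X);
  have [_ /(_ p) []] := af t.+1.
Qed.

Definition extend0 (q : nat -> T -> R) (k : int) w : R :=
  if k is Posz s then q s w else 0.

Lemma regular_state t w k : regular (st t w) k =
  if k <= t%:Z then extend0 placed_regular k w else 0.
Proof.
elim: t k => [|t IH] k.
  by rewrite /=; case: k => [[|s]|s] //=; rewrite if_same.
rewrite /=; case: eqP => [->|kt].
  by rewrite lexx /extend0 placed_regularS.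
by rewrite IH; case: ifPn => h1; case: ifPn => h2 //; lia.
Qed.

Lemma express_state t w k : express (st t w) k =
  if k <= t%:Z then extend0 placed_express k w else 0.
Proof.
elim: t k => [|t IH] k.
  by rewrite /=; case: k => [[|s]|s] //=; rewrite if_same.
rewrite /=; case: eqP => [->|kt].
  by rewrite lexx /extend0 placed_expressS.
by rewrite IH; case: ifPn => h1; case: ifPn => h2 //; lia.
Qed.

Local Notation eR := (extend0 placed_regular).
Local Notation eE := (extend0 placed_express).

Lemma inventoryS t w : inventory (st t.+1 w) =
  inventory (st t w) + eR (t.+1%:Z - L%:Z) w + eE (t.+1%:Z - L0%:Z) w - Dt t.+1%:Z w.
Proof.
have -> : inventory (st t.+1 w) = inventory (st t w)
    + regular (st t.+1 w) (t.+1%:Z - L%:Z) + express (st t.+1 w) (t.+1%:Z - L0%:Z)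
    - Dt t.+1%:Z w by [].
rewrite regular_state express_state !ifT //; lia.
Qed.

Lemma positionE t w : position t.+1 w = inventory (st t w)
  + \sum_(k < L0) eE (t.+1%:Z - L0%:Z + k%:Z) w
  + \sum_(k < L0.+1) eR (t.+1%:Z - L%:Z + k%:Z) w.
Proof.
rewrite /position /expedited_position; congr (_ + _ + _); apply: eq_bigr => k _.
  by rewrite express_state ifT //; have := ltn_ord k; lia.
by rewrite regular_state ifT //; have := ltn_ord k; lia.
Qed.

(** The regular order placed [L - L0] periods earlier, which enters the expedited position in period
    [t]. With [level], the position after the express order, it reduces the state to one
    dimension. *)
Definition arriving t w : R := eR (t%:Z - L%:Z + L0%:Z) w.
Definition level t w : R := position t w + placed_express t w.

(** Both pipeline sums slide by one period. The units that leave them are exactly those that join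
    the inventory, so the net change is the express order just placed, one regular order and the
    demand. *)
Lemma positionS t w :
  position t.+2 w = level t.+1 w - Dt t.+1%:Z w + arriving t.+2 w.
Proof.
rewrite /level !positionE inventoryS /arriving.
have e1 : eE (t.+1%:Z - L0%:Z) w + \sum_(k < L0) eE (t.+2%:Z - L0%:Z + k%:Z) w =
    \sum_(k < L0) eE (t.+1%:Z - L0%:Z + k%:Z) w + placed_express t.+1 w.
  transitivity (\sum_(k < L0.+1) eE (t.+1%:Z - L0%:Z + k%:Z) w).
    rewrite [RHS]big_ord_recl addr0; congr (_ + _); apply: eq_bigr => k _.
    by congr (eE _ w); rewrite /= /bump /=; lia.
  rewrite big_ord_recr /=; congr (_ + _).
  by rewrite (_ : _ - _ + _ = t.+1%:Z) //; lia.
have e2 : eR (t.+1%:Z - L%:Z) w + \sum_(k < L0.+1) eR (t.+2%:Z - L%:Z + k%:Z) w =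
    \sum_(k < L0.+1) eR (t.+1%:Z - L%:Z + k%:Z) w + eR (t.+2%:Z - L%:Z + L0%:Z) w.
  transitivity (\sum_(k < L0.+2) eR (t.+1%:Z - L%:Z + k%:Z) w).
    rewrite [RHS]big_ord_recl addr0; congr (_ + _); apply: eq_bigr => k _.
    by congr (eR _ w); rewrite /= /bump /=; lia.
  rewrite [LHS]big_ord_recr /=; congr (_ + _).
  by congr (eR _ w); rewrite /=; lia.
lra.
Qed.

Lemma levelS t w :
  level t.+2 w = level t.+1 w - Dt t.+1%:Z w + arriving t.+2 w + placed_express t.+2 w.
Proof. by rewrite {1}/level positionS. Qed.

(** By the end of period [t.+1 + L0] everything counted in [level t.+1] has been delivered, and
    nothing that entered the position later has. *)
Lemma inventory_lead t w : inventory (st (t.+1 + L0) w) =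
  level t.+1 w - \sum_(i < L0.+1) Dt (t.+1 + i)%N%:Z w.
Proof.
have key j : (j <= L0.+1)%N -> inventory (st (t + j) w) = inventory (st t w)
    + \sum_(k < j) eE (t.+1%:Z - L0%:Z + k%:Z) w
    + \sum_(k < j) eR (t.+1%:Z - L%:Z + k%:Z) w - \sum_(i < j) Dt (t.+1 + i)%N%:Z w.
  elim: j => [|j IH] jL; first by rewrite addn0 !big_ord0; lra.
  rewrite addnS inventoryS IH; last exact: ltnW.
  rewrite !big_ord_recr /=.
  have -> : eE ((t + j).+1%:Z - L0%:Z) w = eE (t.+1%:Z - L0%:Z + j%:Z) w.
    by congr (eE _ w); lia.
  have -> : eR ((t + j).+1%:Z - L%:Z) w = eR (t.+1%:Z - L%:Z + j%:Z) w.
    by congr (eR _ w); lia.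
  by rewrite addSn; lra.
have -> : (t.+1 + L0 = t + L0.+1)%N by rewrite addSn addnS.
rewrite key // /level positionE; congr (_ - _).
rewrite big_ord_recr /=.
have -> : eE (t.+1%:Z - L0%:Z + L0%:Z) w = placed_express t.+1 w.
  by rewrite (_ : _ - _ + _ = t.+1%:Z) //; lia.
lra.
Qed.

Lemma period_costE c h b t w : period_cost c h b Dt Dt' Ghat f (t.+1 + L0) w =
  c * placed_express t.+1 w +
  newsvendor_cost h b (level t.+1 w - \sum_(i < L0.+1) Dt (t.+1 + i)%N%:Z w).
Proof.
rewrite /period_cost inventory_lead; congr (c * _ + _).
rewrite express_state ifT; last by lia.
by rewrite (_ : _ - _ = t.+1%:Z) //; lia.
Qed.

Lemma level_adapted t : measurable_fun setT (level t.+1 : H t.+1 -> R).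
Proof.
by apply: measurable_funD; [exact: position_adapted|exact: placed_express_adapted].
Qed.

Lemma arriving_ge0 t w : 0 <= arriving t w.
Proof.
by rewrite /arriving; case: (_ + _) => [s|s] //=; exact: placed_regular_ge0.
Qed.

Lemma arriving_eq0 t w : (t <= L - L0)%N -> arriving t w = 0.
Proof.
rewrite /arriving => tL.
case E : (t%:Z - L%:Z + L0%:Z) => [s|s] //=.
by have -> : s = 0%N by lia.
Qed.

Lemma arriving_placed t : arriving (L - L0 + t) = placed_regular t.
Proof.
apply/funext => w; rewrite /arriving.
by rewrite (_ : _ + _ = t%:Z) //; lia.
Qed.

(** The source of the window length: arrivals at most [L - L0] periods ahead were ordered by time
    [t] at the latest, and an order of period [t] precedes the demand of period [t]. *)
Lemma arriving_adapted t k : (k <= L - L0)%N ->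
  measurable_fun setT (arriving (t + k) : H t -> R).
Proof.
move=> kL; case: (leqP (t + k) (L - L0)) => tk.
  rewrite (_ : arriving _ = cst 0); first exact: measurable_cst.
  by apply/funext => w; exact: arriving_eq0.
rewrite -(subnKC (ltnW tk)) arriving_placed.
have le : (t + k - (L - L0) <= t)%N by lia.
exact: (history_le past_mono le (@placed_regular_adapted _)).
Qed.

Lemma position1 w : position 1 w = inventory (initial_state Dt' Ghat w).
Proof.
rewrite positionE [X in _ + X + _]big1 ?[X in _ + _ + X]big1 ?addr0 // => i _;
  have := ltn_ord i => iL.
- case E : (1%:Z - L%:Z + i%:Z) => [s|s] //=.
  by have -> : s = 0%N by lia.
- case E : (1%:Z - L0%:Z + i%:Z) => [s|s] //=.
  by have -> : s = 0%N by lia.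
Qed.

End PolicyDynamics.

Section LimitSuperior.
Context {R : realType}.
Implicit Types (u : (\bar R)^nat) (A : R).

Lemma limn_esup_le u A :
  (forall e, 0 < e -> exists N, forall n, (N <= n)%N -> (u n <= (A + e)%:E)%E) ->
  (limn_esup u <= A%:E)%E.
Proof.
move=> h; apply/lee_addgt0Pr => e e0; have [N hN] := h e e0.
rewrite /limn_esup limf_esupE.
apply: (@le_trans _ _ (ereal_sup (u @` [set n | (N <= n)%N]))).
  apply: ereal_inf_lbound; exists [set n | (N <= n)%N] => //.
  by exists N.
by apply: ge_ereal_sup => _ [n /= Nn <-]; rewrite -EFinD; exact: hN.
Qed.

Lemma limn_esup_lt u x : (limn_esup u < x)%E ->
  exists N, forall n, (N <= n)%N -> (u n < x)%E.
Proof.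
rewrite /limn_esup limf_esupE => /ereal_inf_lt[_ [V [N _ NV] <-] h].
exists N => n Nn; apply: le_lt_trans h; apply: ereal_sup_ubound.
by exists n => //; exact: NV.
Qed.

End LimitSuperior.

(** * Constants of the demand distribution *)

Section Arithmetic.
Context {R : realType}.
Implicit Types x e : R.

Lemma powR2N_lt1 x : 0 < x -> 2 `^ (- x) < 1.
Proof.
move=> x0; rewrite /powR gt_eqF // expR_lt1 mulNr oppr_lt0.
by apply: mulr_gt0 => //; apply: ln_gt0; rewrite ltr1n.
Qed.

(** [(1 - 1/x) ^+ n <= expR (- x)] because [n = x ^+ 2], and [x ^+ 3 <= 27 * expR x] is the cube of
    [x / 3 <= expR (x / 3)]. *)
Lemma discount_power (n : nat) x : 1 <= x -> x ^+ 2 = n%:R ->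
  (1 - x^-1) ^+ n * x ^+ 3 <= 27.
Proof.
move=> x1 xn; have x0 : 0 < x by exact: lt_le_trans x1.
have a0 : 0 <= 1 - x^-1 by rewrite subr_ge0 invf_le1.
have h1 : (1 - x^-1) ^+ n <= expR (- x).
  have -> : - x = n%:R * - x^-1 by rewrite -xn; field; rewrite gt_eqF.
  by rewrite expRM_natl lerXn2r ?nnegrE ?expR_ge0 // expR_ge1Dx.
have h2 : x ^+ 3 <= 27 * expR x.
  have -> : expR x = expR (x / 3) ^+ 3 by rewrite -expRM_natl; congr expR; lra.
  have -> : x ^+ 3 = 27 * (x / 3) ^+ 3 by field.
  rewrite ler_pM2l // lerXn2r ?nnegrE ?expR_ge0 ?divr_ge0 ?(ltW x0) //.
  by apply: le_trans (expR_ge1Dx _); lra.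
apply: (@le_trans _ _ (expR (- x) * (27 * expR x))).
  by apply: ler_pM => //; [exact: exprn_ge0|exact/exprn_ge0/ltW].
by rewrite expRN mulrCA mulVf ?mulr1 // gt_eqF // expR_gt0.
Qed.

(** Final accounting of a window: [x = sqrt n], [p = al ^+ n], [s] the total weight, [K2'] the
    summed mixing error, [nu / x] the step of the slopes, [W] the size of the gaps. The term in [p]
    is negligible by [p * x ^+ 3 <= 27], the others are bounded, and division by [s >= 9/10 * x]
    gives the rate [1 / x]. *)
Lemma budget x p s V A K0 K2 K2' m ra nu Om W :
  32 <= x -> 32 * ra <= x -> 1 <= ra -> 0 <= p -> p * x ^+ 3 <= 27 ->
  s = (1 - p) * x -> 0 <= nu -> 0 <= Om -> 0 <= m -> 0 <= K2 ->
  64 * (m * ra * nu) <= K0 -> K2' <= 2 * K2 + K0 -> m * Om <= K2' ->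
  W <= ra * (7 * nu + 4 * Om) ->
  s * (V - A) <= K2' + 2 * m * (nu / x) * s + 2 * (p * (m * x)) * W ->
  V <= A + 3 * (K0 + K2) / x.
Proof.
move=> x1 xra ra1 p0 p3 sE nu0 Om0 m0 K20 K0m K2b mOm Wb hV.
have x0 : 0 < x by lra.
have th : 0 < 32 :> R by rewrite ltr0n.
have px0 : 0 <= p * x by rewrite mulr_ge0 // ltW.
have pxx0 : 0 <= p * x * x by rewrite mulr_ge0 // ltW.
have e3 : p * x * x * x <= 27 by move: p3; rewrite !exprS expr0; lra.
have p2 : p * x * x <= 27 / 32.
  rewrite (ler_pdivlMr _ _ th); apply: le_trans e3; exact: ler_wpM2l.
have p1 : p * x <= 27 / 32 / 32.
  rewrite (ler_pdivlMr _ _ th); apply: le_trans p2; exact: ler_wpM2l.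
have pp : p <= 1 / 32.
  have : p * 32 <= p * x by exact: ler_wpM2l.
  lra.
have pr : p * x * ra <= 27 / 32 / 32.
  rewrite (ler_pdivlMr _ _ th); apply: le_trans p2.
  by rewrite -[leLHS]mulrA [ra * _]mulrC (ler_wpM2l px0).
have mn0 : 0 <= m * nu by exact: mulr_ge0.
have mrn : m * nu <= m * ra * nu by rewrite -mulrA ler_wpM2l // ler_peMl.
have mO0 : 0 <= m * Om by exact: mulr_ge0.
have t1 : 2 * (p * (m * x)) * W <= 14 * (p * x * (m * ra * nu)) + 8 * (p * x * ra * (m * Om)).
  have : 2 * (p * (m * x)) * W <= 2 * (p * (m * x)) * (ra * (7 * nu + 4 * Om)).
    by rewrite ler_wpM2l // mulr_ge0 // mulrCA mulr_ge0.
  have -> : 2 * (p * (m * x)) * (ra * (7 * nu + 4 * Om)) =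
     14 * (p * x * (m * ra * nu)) + 8 * (p * x * ra * (m * Om)) by ring.
  by [].
have t2 : p * x * (m * ra * nu) <= 27 / 32 / 32 * (m * ra * nu).
  by rewrite ler_wpM2r //; lra.
have t3 : p * x * ra * (m * Om) <= 27 / 32 / 32 * (m * Om) by rewrite ler_wpM2r.
have t4 : 2 * m * (nu / x) * s <= 2 * (m * nu).
  have -> : 2 * m * (nu / x) * s = 2 * (m * nu) * (1 - p) by rewrite sE; field; rewrite gt_eqF.
  by rewrite ler_piMr ?mulr_ge0 //; lra.
have [VA|VA] := lerP V A.
  apply: le_trans VA _; rewrite lerDl divr_ge0 ?(ltW x0) // mulr_ge0 //; lra.
rewrite -lerBlDl ler_pdivlMr //.
have t5 : 9 / 10 * (x * (V - A)) <= s * (V - A).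
  rewrite mulrA ler_wpM2r //; first by lra.
  by rewrite sE ler_wpM2r //; [exact: ltW|lra].
rewrite mulrC; lra.
Qed.

(** With [k * e] between 1/512 and 1/256, the drift [k * e] is at most half of the fluctuation
    [w * beta / 16]. The remaining half is large against [t]: 264 is just below
    [6000 / sqrt 512]. *)
Lemma near_critical_arith (w k e eta beta t mn B nu U : R) :
  0 <= w -> w ^+ 2 = k -> k * e <= 256^-1 -> 512^-1 <= k * e -> 0 < e ->
  0 < eta -> eta <= beta -> 0 < mn -> 0 < t ->
  e * (6000 * t) ^+ 2 <= (mn * eta) ^+ 2 -> e <= 4^-1 * eta ^+ 2 ->
  2 * (nu * mn) <= t -> U + 1 <= t ->
  w * beta / 16 - k * e <= 2 * (B / mn + 2 * nu) -> U + 1 <= B.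
Proof.
move=> w0 wk ke1 ke2 e0 eta0 etab mn0 t0 et ee nut Ut hB.
have we : w * e <= eta / 32.
  rewrite -(@ler_pXn2r _ 2) ?nnegrE ?mulr_ge0 ?(ltW e0) ?(ltW eta0) ?invr_ge0 //.
  have -> : (w * e) ^+ 2 = k * e * e by rewrite exprMn wk; ring.
  have : k * e * e <= 256^-1 * e by rewrite ler_pM2r.
  rewrite expr_div_n; lra.
have ke : k * e <= w * eta / 32.
  have -> : k * e = w * (w * e) by rewrite -wk; ring.
  by rewrite -mulrA ler_wpM2l.
have big : 264 * t <= w * (mn * eta).
  rewrite -(@ler_pXn2r _ 2) ?nnegrE ?mulr_ge0 ?(ltW t0) ?(ltW eta0) ?(ltW mn0) //.
  rewrite [leRHS]exprMn wk.
  have k0 : 0 <= k by rewrite -wk sqr_ge0.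
  apply: le_trans (ler_wpM2l k0 et); rewrite mulrA.
  apply: (@le_trans _ _ (512^-1 * (6000 * t) ^+ 2)); last first.
    by rewrite ler_wpM2r ?sqr_ge0.
  have := sqr_ge0 t; rewrite !exprMn; lra.
have wb : w * eta <= w * beta by rewrite ler_wpM2l.
have h1 : w * eta / 32 <= 2 * (B / mn + 2 * nu) by lra.
have h2 := ler_wpM2r (ltW mn0) h1.
have e1 : 2 * (B / mn + 2 * nu) * mn = 2 * B + 4 * (nu * mn).
  by field; rewrite gt_eqF.
have e2 : w * eta / 32 * mn = w * (mn * eta) / 32 by ring.
rewrite e1 e2 in h2; lra.
Qed.

(** [k] is the integer part of [1 / (256 * e)]; rounding down at most halves a number that is at
    least 1, whence the 512. *)
Lemma window_length (n : nat) e : 0 < e -> 256 * e <= 1 -> e ^- 2 <= n%:R ->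
  exists k : nat, [/\ (0 < k)%N, (k <= n)%N, k%:R * e <= 256^-1 & 512^-1 <= k%:R * e].
Proof.
move=> e0 e1 en; pose y := (256 * e)^-1.
have q0 : 0 < 256 * e by apply: mulr_gt0; [rewrite ltr0n|].
have ye : y * e = 256^-1 by rewrite /y invfM mulfVK // gt_eqF.
have y1 : 1 <= y by rewrite /y invf_ge1.
have /andP[ky yk] := truncn_itv (le_trans ler01 y1).
have k0 : (0 < Num.truncn y)%N.
  by rewrite -(ltr_nat R) -(ltrD2r 1) add0r natr1; exact: le_lt_trans yk.
have k1 : y <= 2 * (Num.truncn y)%:R.
  apply: (le_trans (ltW yk)); rewrite -natr1 mulrDl mul1r lerD2l.
  by rewrite ler1n.
have ke := ler_wpM2r (ltW e0) k1; rewrite ye in ke.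
exists (Num.truncn y); split => //.
- rewrite -(ler_nat R); apply: (le_trans ky); apply: le_trans en.
  apply: (@le_trans _ _ e^-1).
    rewrite /y invfM; apply: ler_piMl; first by rewrite invr_ge0 ltW.
    by rewrite invf_le1 ?ltr0n // ler1n.
  rewrite lef_pV2 ?posrE ?exprn_gt0 // expr2 ger_pMl //.
  by apply: le_trans e1; apply: ler_peMl; [exact: ltW|rewrite ler1n].
- by rewrite -ye ler_wpM2r // ltW.
- lra.
Qed.

(** [x >= 1/e >= (32 * ra) ^+ 2 >= 32 * ra]: the bound [n >= eps0 ^- 2] puts [sqrt n] beyond every
    threshold used later. *)
Lemma regime e ra x : 0 < e -> 1 <= ra -> e * (32 * ra) ^+ 2 <= 1 -> 0 <= x ->
  e ^- 2 <= x ^+ 2 -> [/\ 256 * e <= 1, 32 <= x & 32 * ra <= x].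
Proof.
move=> e0 ra1 ea x0 ex.
have q1 : 32 <= 32 * ra by lra.
move: ea q1; set a := 32 * ra => ea q1.
have a1 : 1 <= a by lra.
have a0 : 0 <= a := le_trans ler01 a1.
have xe : e^-1 <= x.
  by rewrite -(@ler_pXn2r _ 2) ?nnegrE ?invr_ge0 ?(ltW e0) // exprVn.
have aa : 8 * 32 <= a ^+ 2.
  by apply: (@le_trans _ _ (32 * 32)); [lra|rewrite expr2 ler_pM].
have aa1 : a <= a ^+ 2 by rewrite expr2 ler_peMl.
have ae : a ^+ 2 <= e^-1 by rewrite -[e^-1]mul1r ler_pdivlMr // mulrC.
have ax : a <= x by exact: le_trans (le_trans aa1 ae) xe.
split; [|exact: le_trans ax|exact: ax].
apply: le_trans ea; rewrite mulrC; apply: ler_wpM2l; first exact: ltW.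
by apply: le_trans aa; rewrite -natrM.
Qed.

(** [(1 - u + u ^+ 2) * (1 + u) = 1 + u ^+ 3 >= 1], while [1 + u <= expR u]. *)
Lemma expRN_le (u : R) : 0 <= u -> expR (- u) <= 1 - u + u ^+ 2.
Proof.
move=> u0; rewrite expRN; have h1 := expR_ge1Dx u.
rewrite -[_ + _ ^+ 2](@mulfK _ (expR u)) ?gt_eqF ?expR_gt0 //.
rewrite ler_peMl ?invr_ge0 ?expR_ge0 //.
have u3 : 0 <= u ^+ 3 by exact: exprn_ge0.
have h2 : 0 <= 1 - u + u ^+ 2 by nra.
apply: le_trans (ler_wpM2l h2 h1); rewrite !exprS expr0 in u3 *; lra.
Qed.

Lemma expRN_lip (x y : R) : 0 <= x -> 0 <= y -> `|expR (- x) - expR (- y)| <= `|x - y|.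
Proof.
wlog xy : x y / x <= y.
  move=> hw x0 y0; have [xy|/ltW yx] := leP x y; first exact: hw.
  by rewrite distrC (distrC x); exact: hw.
move=> x0 y0; rewrite (distrC x) [leRHS]ger0_norm ?subr_ge0 //.
rewrite ger0_norm ?subr_ge0 ?ler_expR ?lerN2 //.
have -> : expR (- y) = expR (- x) * expR (- (y - x)) by rewrite -expRD; congr expR; lra.
have h1 := expR_ge1Dx (- (y - x)).
have h2 : expR (- x) <= 1 by rewrite -expR0 ler_expR; lra.
have h3 := expR_ge0 (- x).
have h4 : 0 <= y - x by lra.
have h5 := ler_wpM2l h3 h1; nra.
Qed.

End Arithmetic.

(** * Nondegeneracy of demand and the Chernoff constants *)

Section DemandConstants.
Context {d : measure_display} {T : measurableType d} {R : realType}.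
Variable P : probability T R.
Variable D : T -> R.
Hypotheses (iD : itg P D) (D0 : forall w, 0 <= D w).

Local Notation mu := (Ex P D).

Lemma fine_expectation (f : T -> R) : fine 'E_P[f] = Ex P f.
Proof. by rewrite expectation.unlock. Qed.

Lemma mean_Ex : mean P D = mu.
Proof. exact: fine_expectation. Qed.

Let mD : measurable_fun setT D. Proof. exact: itg_mfun iD. Qed.

Let i_dev z : itg P (fun w => `|z - D w|).
Proof. by apply: itg_abs; apply: itgB => //; exact: itg_cst. Qed.

Lemma eta0_le z : eta0 P D <= Ex P (fun w => `|z - D w|).
Proof.
rewrite -fine_expectation; apply: ge_inf; last by exists z.
exists 0 => _ [x _ <-]; rewrite fine_expectation; exact: Ex_ge0.
Qed.

Lemma eta0_le_mean : eta0 P D <= mu.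
Proof.
apply: le_trans (eta0_le 0) _; rewrite le_eqVlt; apply/orP; left; apply/eqP.
by apply: eq_Ex => w; rewrite sub0r normrN ger0_norm.
Qed.

Lemma mean_dev_le_eta0 : Ex P (fun w => `|D w - mu|) / 2 <= eta0 P D.
Proof.
apply: lb_le_inf; first by exists (fine 'E_P[fun w => `|0 - D w|]); exists 0.
move=> _ [z _ <-]; rewrite fine_expectation.
have h1 : `|z - mu| <= Ex P (fun w => `|z - D w|).
  by rewrite -{1}(Ex_cst P z) -ExB //; [apply: Ex_abs; apply: itgB => //|]; exact: itg_cst.
have h2 : Ex P (fun w => `|D w - mu|) <= Ex P (fun w => `|z - D w| + `|z - mu|).
  apply: Ex_le; first by apply: itg_abs; apply: itgB => //; exact: itg_cst.
    by apply: itgD => //; exact: itg_cst.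
  by move=> w; rewrite -(distrC (D w) z) ler_distD.
rewrite ExD // in h2; last exact: itg_cst.
rewrite Ex_cst in h2; lra.
Qed.

(** The variance serves only to exclude a constant demand, so an infinite one is covered; from here
    on the mean absolute deviation measures randomness. *)
Lemma mean_dev_gt0 : (0 < 'V_P[D])%E -> 0 < Ex P (fun w => `|D w - mu|).
Proof.
move=> V0; rewrite lt_neqAle Ex_ge0 // andbT; apply/eqP => E0.
have iC : itg P (fun w => D w - mu) by apply: itgB => //; exact: itg_cst.
have ae0 : ae_eq P setT (EFin \o (fun w => D w - mu)) (cst 0%E).
  apply/(ae_eq_integral_abs _ measurableT); first exact: measurable_int iC.
  have := EFin_Ex (itg_abs iC); rewrite -E0 => e; apply: etrans (esym e).
  by apply: eq_integral => w _.
move: V0; rewrite /variance covariance.unlock expectation.unlock.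
rewrite (ae_eq_integral (cst 0%E)) //.
- by rewrite integral0 ltxx.
- apply/measurable_EFinP; apply: measurable_funM; exact: itg_mfun iC.
- apply: filterS ae0 => w h _ /=; have := h I => /= -[e].
  by apply: congr1; apply/eqP; rewrite mulf_eq0; apply/orP; left; exact/eqP.
Qed.

Section PositiveDeviation.
Hypothesis dev0 : 0 < Ex P (fun w => `|D w - mu|).

Let iC : itg P (fun w => D w - mu).
Proof. by apply: itgB => //; exact: itg_cst. Qed.

Let Ex_neg_part : Ex P (fun w => Num.max 0 (mu - D w)) = Ex P (fun w => `|D w - mu|) / 2.
Proof.
have -> : Ex P (fun w => Num.max 0 (mu - D w)) =
  Ex P (fun w => (`|D w - mu| - (D w - mu)) * 2^-1).
  apply: eq_Ex => w; case: leP => hh.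
    by rewrite ler0_norm; lra.
  by rewrite gtr0_norm; lra.
rewrite ExZr; last by apply: itgB => //; exact: itg_abs.
rewrite ExB //; last exact: itg_abs.
by rewrite ExB //; [rewrite Ex_cst subrr subr0|exact: itg_cst].
Qed.

Let Ex_pos_part : Ex P (fun w => Num.max 0 (D w - mu)) = Ex P (fun w => `|D w - mu|) / 2.
Proof.
have -> : Ex P (fun w => Num.max 0 (D w - mu)) =
  Ex P (fun w => (`|D w - mu| + (D w - mu)) * 2^-1).
  apply: eq_Ex => w; case: leP => hh.
    by rewrite ger0_norm; lra.
  by rewrite ltr0_norm; lra.
rewrite ExZr; last by apply: itgD => //; exact: itg_abs.
rewrite ExD //; last exact: itg_abs.
by rewrite ExB //; [rewrite Ex_cst subrr addr0|exact: itg_cst].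
Qed.

Let mLe x : measurable [set w | D w <= x].
Proof.
have -> : [set w | D w <= x] = setT `&` D @^-1` `]-oo, x]%classic.
  by rewrite setTI; apply/seteqP; split => w /=; rewrite in_itv.
by apply: mD => //; exact: measurable_itv.
Qed.

Let mLt x : measurable [set w | D w < x].
Proof.
have -> : [set w | D w < x] = setT `&` D @^-1` `]-oo, x[%classic.
  by rewrite setTI; apply/seteqP; split => w /=; rewrite in_itv.
by apply: mD => //; exact: measurable_itv.
Qed.

(** If demand were almost surely below its mean, [Num.max 0 (D - mu)] would have expectation 0,
    whereas it equals half the mean absolute deviation. [p0_gt0] is the mirror image. *)
Lemma p0_lt1 : p0 P D < 1.
Proof.
rewrite /p0 mean_Ex; set A := [set w | _].
rewrite lt_neqAle; apply/andP; split; last first.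
  by rewrite -lee_fin fineK ?fin_num_measure //; [apply: probability_le1|]; exact: mLt.
apply/eqP => PA.
have nA : P (~` A) = 0%E.
  rewrite probability_setC; last exact: mLt.
  by rewrite -[P A]fineK ?fin_num_measure //; [rewrite PA subee|exact: mLt].
have h0 : Ex P (fun w => Num.max 0 (D w - mu)) = Ex P (fun=> 0).
  apply: Ex_ae_eq => //.
    by apply: measurable_maxr => //; exact: itg_mfun iC.
  exists (~` A); split => //; first by apply: measurableC; exact: mLt.
  move=> w /= hw; apply: contra_not hw => hw.
  rewrite max_l // subr_le0 ltW //; exact: contrapT.
by move: dev0; rewrite Ex_pos_part Ex_cst in h0; lra.
Qed.

Lemma p0_gt0 : 0 < p0 P D.
Proof.
rewrite /p0 mean_Ex; set A := [set w | _].
rewrite lt_neqAle fine_ge0 ?measure_ge0 // andbT; apply/eqP => PA.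
have nA : P A = 0%E by rewrite -[P A]fineK ?fin_num_measure -?PA //; exact: mLt.
have h0 : Ex P (fun w => Num.max 0 (mu - D w)) = Ex P (fun=> 0).
  apply: Ex_ae_eq => //.
    apply: measurable_maxr => //; apply: measurable_funB => //.
  exists A; split => //; first exact: mLt.
  move=> w /= hw; apply: contrapT => hA; apply: hw.
  by rewrite max_l // subr_le0 leNgt; apply/negP.
by move: dev0; rewrite Ex_neg_part Ex_cst in h0; lra.
Qed.

Lemma p0_hat_gt0 : 0 < p0_hat P D.
Proof.
by rewrite /p0_hat sqrtr_gt0 !mulr_gt0 // ?subr_gt0 ?p0_lt1 // p0_gt0.
Qed.

Lemma p0_hat_le1 : p0_hat P D <= 1.
Proof.
have h1 := p0_gt0; have h2 := p0_lt1.
rewrite /p0_hat -[leRHS]sqrtr1 ler_sqrt //.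
by have := mulr_ge0 (ltW h1) (ltW h1); nra.
Qed.

Lemma eta0_gt0 : 0 < eta0 P D.
Proof. apply: lt_le_trans mean_dev_le_eta0; rewrite divr_gt0 //. Qed.

Lemma mean_gt0 : 0 < mu.
Proof. exact: lt_le_trans eta0_gt0 eta0_le_mean. Qed.

(** The probabilities of [D <= mu - 1/(n+1)] increase to [p0], so one of them exceeds [p0 / 2]. *)
Lemma Q0_lt_mean : Q0 P D < mu.
Proof.
pose F n := [set w | D w <= mu - n.+1%:R^-1].
have FU : \bigcup_n F n = [set w | D w < mu].
  apply/seteqP; split => w /=.
    by move=> [n _]; rewrite /F /= => hw; apply: le_lt_trans hw _; rewrite gtrBl.
  by move=> /ltr_add_invr [k hk]; exists k => //; rewrite /F /= lerBrDr ltW.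
have ndF : nondecreasing_seq F.
  move=> n k nk; apply/subsetPset => w; rewrite /F /= => hw; apply: le_trans hw _.
  by rewrite lerD2l lerN2 lef_pV2 ?posrE // ler_nat.
have cF : fine (P (F n)) @[n --> \oo] --> p0 P D.
  apply: fine_cvg; rewrite /p0 mean_Ex fineK ?fin_num_measure // -FU.
  apply: nondecreasing_cvg_mu => //; first by move=> n; exact: mLe.
  by rewrite FU; exact: mLt.
have p1 := p0_gt0.
have h2 : 2^-1 * p0 P D < p0 P D by lra.
have [k _ hk] := cvgr_gt _ cF _ h2.
have hkk := hk k (leqnn k).
apply: (@le_lt_trans _ _ (mu - k.+1%:R^-1)); last by rewrite gtrBl.
apply: ge_inf; first by exists 0 => x [].
split; last exact: ltW hkk.
(* [Q0] ranges over nonnegative points only. A negative candidate would make the event empty,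
   against its positive probability. *)
rewrite leNgt; apply/negP => hn; move: hkk; rewrite /F.
have -> : [set w | D w <= mu - k.+1%:R^-1] = set0.
  apply/seteqP; split => // w /= hw.
  by have := le_lt_trans (le_trans (D0 w) hw) hn; rewrite ltxx.
rewrite measure0 /=; lra.
Qed.

End PositiveDeviation.

Lemma itg_expRN (X : T -> R) theta : 0 <= theta -> measurable_fun setT X -> (forall w, 0 <= X w) ->
  itg P (fun w => expR (- (theta * X w))).
Proof.
move=> t0 mX X0; apply: (@itg_bounded _ _ _ P _ 1).
  apply: measurableT_comp; first exact: measurable_expR.
  by apply: measurable_funN; exact: measurable_funM.
move=> w; rewrite ger0_norm ?expR_ge0 // -expR0 ler_expR oppr_le0.
exact: mulr_ge0.
Qed.

Lemma phiE e theta :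
  phi P D e theta = expR (theta * (mu - e)) * Ex P (fun w => expR (- (theta * D w))).
Proof. by rewrite /phi mean_Ex fine_expectation. Qed.

Lemma phi_ge0 e theta : 0 <= phi P D e theta.
Proof.
by rewrite phiE mulr_ge0 ?expR_ge0 //; apply: Ex_ge0 => w; exact: expR_ge0.
Qed.

Lemma phi_mgf e theta : 0 <= theta ->
  phi P D e theta = Ex P (fun w => expR (theta * (mu - e - D w))).
Proof.
move=> t0; rewrite phiE -ExZl; last exact: itg_expRN.
by apply: eq_Ex => w; rewrite -expRD; congr expR; lra.
Qed.

Lemma gamma_le e theta : 0 <= theta -> gamma P D e <= phi P D e theta.
Proof.
move=> t0; apply: ge_inf; last by exists theta.
by exists 0 => _ [x _ <-]; exact: phi_ge0.
Qed.

Lemma gamma_ge0 e : 0 <= gamma P D e.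
Proof.
apply: lb_le_inf; first by exists (phi P D e 0); exists 0 => /=.
by move=> _ [x _ <-]; exact: phi_ge0.
Qed.

Lemma gamma_adherent e delta : 0 < delta ->
  exists2 theta, 0 <= theta & phi P D e theta < gamma P D e + delta.
Proof.
move=> d0; have [|_ [t t0 <-] h1] := @inf_adherent R [set phi P D e t | t in [set u | 0 <= u]] _ d0.
  split; first by exists (phi P D e 0); exists 0 => /=.
  by exists 0 => _ [x _ <-]; exact: phi_ge0.
by exists t.
Qed.

Lemma truncated_mean e : 0 < e -> exists k : nat, mu - e < Ex P (fun w => Num.min (D w) k%:R).
Proof.
move=> e0.
pose g (n : nat) w := (Num.min (D w) n%:R)%:E.
have mg n : measurable_fun setT (g n).
  by apply/measurable_EFinP; apply: measurable_minr.
have cg : (\int[P]_w g n w @[n --> \oo] --> \int[P]_w (D w)%:E)%E.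
  have -> : (\int[P]_w (D w)%:E = \int[P]_w (limn (g ^~ w)))%E.
    apply: eq_integral => w _; apply/esym/cvg_lim => //.
    apply: cvg_near_cst; exists (Num.bound (D w)) => // n /= hn.
    rewrite /g min_l //; apply: le_trans (ltW (archi_boundP (D0 w))) _.
    by rewrite ler_nat.
  apply: cvg_monotone_convergence => //.
    by move=> n w _; rewrite lee_fin le_min D0 /=.
  move=> w _ n n' nn; rewrite lee_fin le_min ge_min lexx /= ge_min ler_nat nn orbT //.
have cg2 : Ex P (fun w => Num.min (D w) n%:R) @[n --> \oo] --> mu.
  by apply: fine_cvg; rewrite -/(Ex P D) EFin_Ex.
have h2 : mu - e < mu by rewrite gtrBl.
have [k _ hk] := cvgr_gt _ cg2 _ h2.
by exists k; exact: (hk k (leqnn k)).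
Qed.

(** Only a first moment is available, so the second-order expansion is made for the demand truncated
    at [k], with [k] so large that the mean drops by less than [e / 2]. The chosen [theta] keeps the
    quadratic term below [theta * e / 4]. *)
Lemma gamma_lt1 e : 0 < e -> gamma P D e < 1.
Proof.
move=> e0; have [k hk] := truncated_mean (divr_gt0 e0 (ltr0n _ 2 : 0 < 2)).
set Dk := fun w => _ in hk.
have mDk : measurable_fun setT Dk by apply: measurable_minr.
have Dk0 w : 0 <= Dk w by rewrite /Dk le_min D0 /=.
have Dkk w : Dk w <= k%:R by rewrite /Dk ge_min lexx orbT.
have iDk : itg P Dk.
  by apply: (@itg_bounded _ _ _ P _ k%:R) => // w; rewrite ger0_norm.
pose theta := e / (4 * (k%:R ^+ 2 + 1)).
have k20 : 0 < k%:R ^+ 2 + 1 :> R by have := exprn_ge0 2 (ler0n R k); lra.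
have t0 : 0 < theta by rewrite divr_gt0 // mulr_gt0.
have tk : theta * k%:R ^+ 2 <= e / 4.
  have : theta * (k%:R ^+ 2 + 1) = e / 4 by rewrite /theta; field; rewrite gt_eqF.
  lra.
apply: le_lt_trans (gamma_le e (ltW t0)) _; rewrite phiE.
have h1 : Ex P (fun w => expR (- (theta * D w))) <= expR (- (theta * Ex P Dk) + theta ^+ 2 * k%:R ^+ 2).
  apply: le_trans (expR_ge1Dx _).
  apply: (@le_trans _ _ (Ex P (fun w => (1 + theta ^+ 2 * k%:R ^+ 2) - theta * Dk w))).
    apply: Ex_le; first exact/itg_expRN/D0/mD/ltW.
      by apply: itgB; [exact: itg_cst|exact: itgZl].
    move=> w; apply: (@le_trans _ _ (expR (- (theta * Dk w)))).
      by rewrite ler_expR lerN2 (ler_wpM2l (ltW t0)) // /Dk ge_min lexx.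
    apply: le_trans (expRN_le (mulr_ge0 (ltW t0) (Dk0 w))) _.
    have : (theta * Dk w) ^+ 2 <= theta ^+ 2 * k%:R ^+ 2.
      by rewrite exprMn ler_wpM2l ?sqr_ge0 // lerXn2r ?nnegrE.
    lra.
  rewrite ExB; [|exact: itg_cst|exact: itgZl].
  rewrite Ex_cst ExZl //; lra.
apply: le_lt_trans (ler_wpM2l (expR_ge0 _) h1) _.
rewrite -expRD expR_lt1.
have := ler_wpM2l (ltW t0) tk; have h3 : mu - e / 2 - Ex P Dk < 0 by lra.
have := mulr_gt0 t0 e0; have := ltr_pM2l t0 (mu - e / 2 - Ex P Dk) 0; rewrite h3 mulr0 => h4.
have {h4} : theta * (mu - e / 2 - Ex P Dk) < 0 by rewrite h4.
rewrite expr2; lra.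
Qed.

(** The absolute value extends [phi] to all reals, where the extreme value theorem applies
    directly. *)
Lemma phi_continuous e : continuous (fun t : R => phi P D e `|t|).
Proof.
have c1 : continuous (fun t : R => expR (`|t| * (mu - e))).
  move=> t; apply: continuous_comp; last exact: continuous_expR.
  by apply: cvgMl; exact: norm_continuous.
have c2 : continuous (fun t : R => Ex P (fun w => expR (- (`|t| * D w)))); last first.
  move=> t; under eq_fun do rewrite phiE; exact: (cvgM (c1 t) (c2 t)).
apply: (@lip_continuous _ mu) => x y.
rewrite -ExB; [|exact: itg_expRN|exact: itg_expRN].
apply: le_trans (Ex_abs _) _; first by apply: itgB; exact: itg_expRN.
have -> : mu * `|x - y| = Ex P (fun w => D w * `|x - y|) by rewrite ExZr.
apply: Ex_le.
- by apply: itg_abs; apply: itgB; exact: itg_expRN.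
- exact: itgZr.
move=> w; apply: le_trans (expRN_lip _ _) _; rewrite ?mulr_ge0 //.
rewrite -mulrBl normrM mulrC (ger0_norm (D0 w)) ler_wpM2l //.
exact: ler_dist_dist.
Qed.

(** [vartheta] need not be usable as an exponent: it may be infinite or a supremum. If minimizers
    exist, one close to their supremum works; they are positive since [phi] is 1 at 0 and
    [gamma < 1]. If none exists, near-minimizers must be arbitrarily large. *)
Lemma chernoff_choice e delta : 0 < e -> 0 < delta ->
  exists theta, [/\ 0 < theta, phi P D e theta <= gamma P D e + delta &
    theta^-1 <= fine ((vartheta P D e)^-1)%E + delta].
Proof.
move=> e0 d0; have g1 := gamma_lt1 e0.
rewrite /vartheta; case: eqP => [am0|/eqP/set0P[a0 am]].
  rewrite /inve /= add0r.
  have M0 : 0 <= delta^-1 by rewrite invr_ge0 ltW.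
  have cM : {within `[0, delta^-1], continuous (fun t : R => phi P D e `|t|)}.
    by apply: continuous_subspaceT; exact: phi_continuous.
  have [a ha hmin] := EVT_min M0 cM.
  have a0 : 0 <= a by move: ha; rewrite in_itv /= => /andP[].
  have pa t : 0 <= t -> t <= delta^-1 -> phi P D e a <= phi P D e t.
    move=> t0 tM; have := hmin t; rewrite in_itv /= t0 tM => /(_ isT).
    by rewrite !ger0_norm.
  have : ~ phi_argmin P D e a by rewrite am0.
  move=> /not_andP[//|/existsNP[u /not_implyP[u0 /negP]]]; rewrite -ltNge => hu.
  have ga : gamma P D e < phi P D e a := le_lt_trans (gamma_le e u0) hu.
  (* On [[0, 1/delta]] the minimum of [phi] exceeds [gamma] by a fixed margin, so a point that beats
     this margin lies beyond [1/delta] and its inverse is below [delta]. *)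
  have dd : 0 < Num.min delta (phi P D e a - gamma P D e) by rewrite lt_min d0 subr_gt0.
  have [v v0 hv] := gamma_adherent e dd.
  have vM : delta^-1 < v.
    rewrite ltNge; apply/negP => /(pa _ v0); apply/negP; rewrite -ltNge.
    apply: lt_le_trans hv _; rewrite -lerBrDl ge_min lexx orbT //.
  have v1 : 0 < v by apply: lt_trans vM; rewrite invr_gt0.
  exists v; split => //.
    by apply: le_trans (ltW hv) _; rewrite lerD2l ge_min lexx.
  by rewrite -[delta]invrK lef_pV2 ?posrE ?invr_gt0 // ltW.
have ph0 : phi P D e 0 = 1.
  rewrite phiE mul0r expR0 mul1r -[RHS](Ex_cst P 1); apply: eq_Ex => w.
  by rewrite mul0r oppr0 expR0.
have pg t : phi_argmin P D e t -> phi P D e t <= gamma P D e.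
  move=> [t0 ht]; apply: lb_le_inf; first by exists (phi P D e 0); exists 0 => /=.
  by move=> _ [u u0 <-]; exact: ht.
have apos t : phi_argmin P D e t -> 0 < t.
  move=> ht; rewrite lt_neqAle ht.1 andbT; apply/eqP => t0.
  by have := pg _ ht; rewrite -t0 ph0 leNgt g1.
set s := ereal_sup _.
have sa : (a0%:E <= s)%E by apply: ereal_sup_ubound; exists a0.
have s0 : (0%:E < s)%E by apply: lt_le_trans sa; rewrite lte_fin; exact: apos.
have vd : 0 < fine (s^-1)%E + delta.
  rewrite ltr_wpDl // /inve; case: (s) s0 => [r||] //=; rewrite lte_fin => r0.
  by rewrite gt_eqF //= invr_ge0 ltW.
have ts : (((fine (s^-1)%E + delta)^-1)%:E < s)%E.
  move: vd; case: (s) s0 => [r||] //=; rewrite ?ltry //.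
  rewrite /inve lte_fin => r0; rewrite gt_eqF //= => vd.
  by rewrite lte_fin -[r in ltRHS]invrK ltf_pV2 ?posrE ?invr_gt0 // ltrDl.
have [_ [x hx <-] xs] := ereal_sup_gt ts.
rewrite lte_fin in xs; have x0 := apos x hx.
exists x; split => //; first by have := pg x hx; lra.
by rewrite -[leRHS]invrK lef_pV2 ?posrE ?invr_gt0 // ltW.
Qed.

Lemma mgf_phi e theta r : 0 <= theta -> r <= mu - e ->
  Ex P (fun w => expR (theta * (r - D w))) <= phi P D e theta.
Proof.
move=> t0 re; rewrite phi_mgf //.
have i (a : R) : itg P (fun w => expR (theta * (a - D w))).
  have := itgZl (expR (theta * a)) (itg_expRN t0 mD D0).
  by under eq_fun do rewrite -expRD -mulrBr.
apply: Ex_le => // w; rewrite ler_expR ler_wpM2l // lerD2r //.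
Qed.

Lemma inv_vartheta_ge0 e : 0 < e -> 0 <= fine ((vartheta P D e)^-1)%E.
Proof.
move=> e0; apply/ler_addgt0Pr => de de0.
have [t [t0 _ h]] := chernoff_choice e0 de0.
by apply: le_trans h; rewrite invr_ge0 ltW.
Qed.

(** The loss from approximating [gamma] and [vartheta] is absorbed by a factor 2 and an additive
    [K0]. The first bound on [de] gives [(1 - gam) ^+ 2 >= 98/100 * (1 - ga) ^+ 2], the second keeps
    the numerator within [K0 / 4] of its target, up to that square. *)
Lemma chernoff_tuned e m K0 : 0 < e -> 0 <= m -> 0 < K0 ->
  exists theta gam, [/\ 0 < theta, 0 <= gam, gam < 1,
    forall r, r <= mu - e -> Ex P (fun w => expR (theta * (r - D w))) <= gam &
    m / theta * gam / (1 - gam) ^+ 2 <=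
    2 * (m * gamma P D e * fine ((vartheta P D e)^-1)%E * (1 - gamma P D e) ^- 2) + K0].
Proof.
move=> e0 m0 K00; have g1 := gamma_lt1 e0; have g0 := gamma_ge0 e.
set ga := gamma P D e in g1 g0 *; set v := fine _.
have v0 : 0 <= v by exact: inv_vartheta_ge0.
have w0 : 0 < 1 - ga by lra.
have w20 : 0 < (1 - ga) ^+ 2 by exact: exprn_gt0.
have q0 : 0 < 4 * (m + 1) * (v + 2) by rewrite !mulr_gt0 //; lra.
pose de := Num.min ((1 - ga) / 200) (K0 * (1 - ga) ^+ 2 / (4 * (m + 1) * (v + 2))).
have de0 : 0 < de by rewrite lt_min !divr_gt0 // mulr_gt0.
have de1 : de <= (1 - ga) / 200 by rewrite ge_min lexx.
have de2 : 4 * (m + 1) * (v + 2) * de <= K0 * (1 - ga) ^+ 2.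
  by rewrite mulrC -ler_pdivlMr // ge_min lexx orbT.
have [theta [t0 ht1 ht2]] := chernoff_choice e0 de0.
have ph0 := phi_ge0 e theta; have phg := gamma_le e (ltW t0).
rewrite -/ga -/v in ht1 ht2 phg.
exists theta, (phi P D e theta); split => //; first by lra.
  by move=> r re; apply: mgf_phi => //; exact: ltW.
set gam := phi P D e theta in ph0 phg ht1 *.
have w'0 : 0 < (1 - gam) ^+ 2 by apply: exprn_gt0; lra.
rewrite ler_pdivrMr //.
have w' : 98 / 100 * (1 - ga) ^+ 2 <= (1 - gam) ^+ 2.
  apply: (@le_trans _ _ ((99 / 100 * (1 - ga)) ^+ 2)); first by rewrite exprMn; lra.
  by rewrite lerXn2r ?nnegrE //; lra.
set K2 := m * ga * v * (1 - ga) ^- 2.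
have K2E : K2 * (1 - ga) ^+ 2 = m * ga * v by rewrite /K2 divfK // gt_eqF.
have K20 : 0 <= K2 by rewrite /K2 !mulr_ge0 ?invr_ge0 // ltW.
have r0 : 0 <= 2 * K2 + K0 by lra.
apply: le_trans (ler_wpM2l r0 w').
have -> : (2 * K2 + K0) * (98 / 100 * (1 - ga) ^+ 2) =
    98 / 100 * (2 * (K2 * (1 - ga) ^+ 2) + K0 * (1 - ga) ^+ 2) by ring.
rewrite K2E.
have ti0 : 0 <= theta^-1 by rewrite invr_ge0 ltW.
have h1 : theta^-1 * gam <= (v + de) * (ga + de) by exact: ler_pM.
have h2 : m * (theta^-1 * gam) <= m * (v * ga) + m * (v + 2) * de.
  apply: le_trans (ler_wpM2l m0 h1) _; rewrite -mulrA -mulrDr ler_wpM2l //.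
  have : de * (ga + de) <= de * 2 by rewrite ler_wpM2l ?(ltW de0) //; lra.
  have -> : (v + de) * (ga + de) = v * ga + v * de + de * (ga + de) by ring.
  lra.
have h3 : 0 <= (v + 2) * de by rewrite mulr_ge0 ?(ltW de0) //; lra.
have h4 : m * (v + 2) * de * 4 <= K0 * (1 - ga) ^+ 2.
  by apply: le_trans de2; rewrite -!mulrA; lra.
have h5 : 0 <= m * (v * ga) by rewrite !mulr_ge0.
have h6 : 0 <= K0 * (1 - ga) ^+ 2 by apply: mulr_ge0; exact: ltW.
rewrite -(mulrA m theta^-1 gam) -(mulrA m ga v) (mulrC ga v).
lra.
Qed.

End DemandConstants.

(** * Policies and their long-run costs *)

Section Policies.
Context {d : measure_display} {T : measurableType d} {R : realType}.
Variable P : probability T R.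
Variables (c h b : R) (L0 L : nat).
Variables (D : T -> R) (Dt Dt' : int -> T -> R) (Ghat : T -> nat).
Hypotheses (iD : itg P D) (D0 : forall w, 0 <= D w).
Hypotheses (mDt : forall t, measurable_fun setT (Dt t))
  (mDt' : forall t, measurable_fun setT (Dt' t)) (mG : measurable_fun setT Ghat).
Hypotheses (lawDt : forall t, same_law P (Dt t) D)
  (lawDt' : forall t, same_law P (Dt' t) D).
Hypothesis lawG : forall k : nat, (1 <= k)%N -> P [set w | Ghat w = k] = (2 ^- k)%:E.
Hypothesis indep : mutually_independent P (primitives Dt Dt' Ghat).
Hypotheses (c0 : 0 < c) (h0 : 0 < h) (b0 : 0 < b) (L0L : (L0 + 1 < L)%N).

Local Notation X := (primitives Dt Dt' Ghat).
Local Notation mu := (Ex P D).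
Local Notation m := (Num.max b h).
Local Notation mn := (Num.min b h).
Local Notation n := (L - L0)%N.
Local Notation nu := (L0.+1%:R * mu).
Local Notation lead := (lead_cost P D h b L0.+1).
Local Notation level := (level Dt Dt' Ghat).
Local Notation placed_express := (placed_express Dt Dt' Ghat).
Local Notation arriving := (arriving Dt Dt' Ghat).
Local Notation position := (position Dt Dt' Ghat).
Local Notation long_run_cost := (@long_run_cost _ _ _ P c h b L0 L Dt Dt' Ghat).
Local Notation H t := (known X (past t)).

Let mX := measurable_primitives mDt mDt' mG.

Let m0 : 0 < m. Proof. by rewrite lt_max b0. Qed.
Let mn0 : 0 < mn. Proof. by rewrite lt_min h0 b0. Qed.
Let ra1 : 1 <= m / mn. Proof. by rewrite ler_pdivlMr // mul1r le_max ge_min lexx. Qed.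

Let mD : measurable_fun setT D. Proof. exact: itg_mfun iD. Qed.

Lemma itg_Dt t : itg P (Dt t).
Proof. exact: (itg_same_law (f := id) iD (mDt t) (lawDt t) (@measurable_id _ _ _) iD). Qed.

Lemma itg_Dt' t : itg P (Dt' t).
Proof. exact: (itg_same_law (f := id) iD (mDt' t) (lawDt' t) (@measurable_id _ _ _) iD). Qed.

Lemma Ex_same_law (Y : T -> R) (f : R -> R) : measurable_fun setT Y -> same_law P Y D ->
  measurable_fun setT f -> itg P (fun w => f (D w)) ->
  Ex P (fun w => f (Y w)) = Ex P (fun w => f (D w)).
Proof.
move=> mY YD mf iF; have iY := itg_same_law iD mY YD mf iF.
pose Y' : {mfun T >-> R} := HB.pack Y (isMeasurableFun.Build _ _ _ _ Y mY).
pose D' : {mfun T >-> R} := HB.pack D (isMeasurableFun.Build _ _ _ _ D mD).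
have mef : measurable_fun setT (fun x => (f x)%:E) by exact/measurable_EFinP.
have e1 := @integral_distribution _ _ _ _ _ P Y' _ mef iY.
have e2 := @integral_distribution _ _ _ _ _ P D' _ mef iF.
rewrite /Ex /Rintegral; congr fine.
apply: etrans (esym e1) _; apply: etrans e2.
by apply: eq_measure_integral => A mA _; exact: YD.
Qed.

Lemma Ex_Dt t : Ex P (Dt t) = mu.
Proof. exact: (@Ex_same_law (Dt t) id (mDt t) (lawDt t) (@measurable_id _ _ _) iD). Qed.

(** [D] is nonnegative everywhere, but its copies share only its law, so their sign is known almost
    surely. *)
Lemma ae_Dt'_ge0 : {ae P, forall w, forall s, 0 <= Dt' s w}.
Proof.
have nn s : {ae P, forall w, 0 <= Dt' s w}.
  exists (Dt' s @^-1` `]-oo, 0[%classic); split.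
  - by rewrite -[_ @^-1` _]setTI; apply: mDt' => //.
  - rewrite lawDt' //; have -> : D @^-1` `]-oo, 0[%classic = set0.
      by apply/seteqP; split => // w /=; rewrite in_itv /= ltNge D0.
    exact: measure0.
  - by move=> w /= /negP; rewrite -ltNge in_itv.
have p : {ae P, forall w, forall n, 0 <= Dt' (Posz n) w}.
  by apply/ae_foralln => n; exact: nn.
have m : {ae P, forall w, forall n, 0 <= Dt' (Negz n) w}.
  by apply/ae_foralln => n; exact: nn.
by apply: filterS2 p m => w hp hm [s|s].
Qed.

Let mtail i : measurable [set w | (i < Ghat w)%N].
Proof.
have -> : [set w | (i < Ghat w)%N] = setT `&` Ghat @^-1` [set k | (i < k)%N].
  by rewrite setTI.
by apply: mG.
Qed.

Lemma Ghat_tail n : fine (P [set w | (n < Ghat w)%N]) <= (2^-1) ^+ n.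
Proof.
have mE k : measurable [set w | Ghat w = k].
  by rewrite -[X in measurable X]setTI; exact: (mG measurableT (Y := [set k])).
elim: n => [|n IH].
  rewrite expr0 -lee_fin fineK ?fin_num_measure //; exact: probability_le1.
have e : P [set w | (n < Ghat w)%N] =
    (P [set w | (n.+1 < Ghat w)%N] + P [set w | Ghat w = n.+1])%E.
  rewrite -measureU //.
    congr (P _); apply/seteqP; split => w /=.
      by rewrite leq_eqVlt => /orP[/eqP|]; [right|left].
    by move=> [/ltnW|->].
  by apply/seteqP; split => // w [/= + e]; rewrite e ltnn.
rewrite lawG // in e.
have e1 : fine (P [set w | (n < Ghat w)%N]) =
    fine (P [set w | (n.+1 < Ghat w)%N]) + 2 ^- n.+1 :> R.
  by rewrite e fineD // fin_num_measure.
rewrite exprVn in IH; rewrite exprVn.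
have e2 : (2 : R) ^- n = 2 ^- n.+1 + 2 ^- n.+1.
  rewrite exprS; field; exact: expf_neq0.
by move: IH; rewrite e1 e2 lerD2r.
Qed.

Lemma initial_stateE w : inventory (initial_state Dt' Ghat w) =
  - \sum_(1 <= i < (Ghat w).+1) Dt' (- i%:Z) w.
Proof. by []. Qed.

Lemma measurable_initial_inventory :
  measurable_fun setT (fun w => inventory (initial_state Dt' Ghat w)).
Proof.
have UE : \bigcup_n [set w | Ghat w = n] = setT.
  by apply/seteqP; split => // w _; exists (Ghat w).
rewrite -UE; apply/measurable_fun_bigcup => n.
  by rewrite -[X in measurable X]setTI; exact: (mG measurableT (Y := [set n])).
apply: (eq_measurable_fun (fun w => - \sum_(1 <= i < n.+1) Dt' (- i%:Z) w)).
  by move=> w; rewrite inE /= => ->.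
by apply: measurable_funTS; apply: measurableT_comp => //; exact: measurable_sum.
Qed.

Let term i w : R := \1_[set w | (i < Ghat w)%N] w * `|Dt' (- i.+1%:Z) w|.

Let mterm i : measurable_fun setT (term i).
Proof.
apply: measurable_funM; first exact: measurable_indic.
exact: measurableT_comp.
Qed.

Let iterm i : itg P (term i).
Proof.
apply: (itg_le (mterm i) _ (itg_abs (itg_Dt' (- i.+1%:Z)))) => w.
rewrite /term normrM normr_id; apply: ler_piMl => //.
by rewrite indicE; case: (_ \in _); rewrite ?normr1 ?normr0.
Qed.

Let Ex_term i : Ex P (term i) <= (2^-1) ^+ i * mu.
Proof.
pose J : set (int + int + unit) := [set inr tt].
have mind : measurable_fun setT (\1_[set w | (i < Ghat w)%N] : known X J -> R).
  apply: measurable_indic.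
  have mGh : measurable_fun setT ((fun w => (Ghat w)%:R) : known X J -> R).
    by apply: (@known_var _ _ _ _ X J (inr tt)).
  have -> : [set w | (i < Ghat w)%N] = setT `&` (fun w => (Ghat w)%:R : R) @^-1` `]i%:R, +oo[%classic.
    by rewrite setTI; apply/seteqP; split => w /=; rewrite in_itv /= andbT ltr_nat.
  by apply: mGh.
have mF : measurable_fun setT
    (fun p : known X J * R => \1_[set w | (i < Ghat w)%N] p.1 * `|p.2| : R).
  apply: measurable_funM; first exact: (measurableT_comp mind).
  by apply: measurableT_comp.
have nJ : ~ J (inl (inr (- i.+1%:Z))) by [].
have [_ e] := known_decouple mX indep nJ mD (lawDt' _) mF (iterm i).
rewrite /= in e; rewrite /term e.
under eq_Ex => w.
  rewrite ExZl; last exact: itg_abs.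
  rewrite (_ : Ex P (fun w' => `|D w'|) = mu); last first.
    by apply: eq_Ex => w'; rewrite ger0_norm.
  over.
rewrite ExZr; last exact: itg_indic.
rewrite ler_wpM2r //; first exact: Ex_ge0.
rewrite Ex_indic //; exact: Ghat_tail.
Qed.

(** A Wald-type bound: the sum is dominated by the series of [term i], whose means are at most
    [2^-i * mu] because [Ghat] is independent of the demands. *)
Lemma itg_initial : itg P (fun w => inventory (initial_state Dt' Ghat w)).
Proof.
have mu0 : 0 <= mu by exact: Ex_ge0.
have mI := measurable_initial_inventory.
apply/integrableP; split; first exact/measurable_EFinP.
apply: (@le_lt_trans _ _ (\int[P]_w (\sum_(i <oo) (term i w)%:E))%E).
  apply: ge0_le_integral => //.
  - by apply: measurableT_comp => //; exact/measurable_EFinP.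
  - apply: ge0_emeasurable_sum => [i w _ _|i _]; first by rewrite lee_fin mulr_ge0.
    exact/measurable_EFinP.
  move=> w _; apply: (@le_trans _ _ (\sum_(0 <= i < Ghat w) (term i w)%:E)%E); last first.
    apply: nneseries_lim_ge => i _ _; by rewrite lee_fin mulr_ge0.
  rewrite sumEFin /= lee_fin normrN.
  apply: (le_trans (ler_norm_sum _ _ _)); rewrite big_add1 /=.
  rewrite big_nat [leRHS]big_nat; apply: ler_sum => i iG.
  by rewrite /term indicE mem_set ?mul1r //=; case/andP: iG.
rewrite integral_nneseries //; last 2 first.
- by move=> i; exact/measurable_EFinP.
- by move=> i w _; rewrite lee_fin mulr_ge0.
apply: (@le_lt_trans _ _ (2 * mu)%:E); last exact: ltry.
apply: lime_le.
  by apply: is_cvg_nneseries => i _ _; apply: integral_ge0 => w _; rewrite lee_fin mulr_ge0.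
apply: nearW => n.
have -> : (\sum_(0 <= i < n) \int[P]_w (term i w)%:E)%E = (\sum_(0 <= i < n) Ex P (term i))%:E.
  by rewrite -sumEFin; apply: eq_bigr => i _; rewrite EFin_Ex.
rewrite lee_fin; apply: (@le_trans _ _ (\sum_(0 <= i < n) (2^-1) ^+ i * mu)).
  by apply: ler_sum.
rewrite -mulr_suml ler_wpM2r // big_mkord.
apply: le_trans (power_sum_le n _ _) _; rewrite ?invr_ge0 ?invf_lt1 ?ltr1n //.
by rewrite (_ : 1 - 2^-1 = 2^-1) ?invrK //; lra.
Qed.

Lemma ae_initial_le0 : {ae P, forall w, inventory (initial_state Dt' Ghat w) <= 0}.
Proof.
apply: filterS ae_Dt'_ge0 => w nn.
by rewrite initial_stateE oppr_le0; apply: sumr_ge0 => i _; exact: nn.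
Qed.

Let I0 w := inventory (initial_state Dt' Ghat w).
Let iI0 : itg P I0.
Proof. exact: itg_initial. Qed.

(** * Expected period costs in terms of levels and express orders *)

Section PeriodCosts.
Variable f : @policy R L0 L.
Hypothesis af : admissible f.

Local Notation cost := (period_cost c h b Dt Dt' Ghat f).
Local Notation y := (level f).
Local Notation q := (placed_express f).
Local Notation net t := (fun w => y t.+1 w - \sum_(i < L0.+1) Dt (t.+1 + i)%N%:Z w).

Lemma level_mfun t : measurable_fun setT (y t.+1).
Proof.
have a : adapted X past t.+1 (y t.+1) by exact: (level_adapted af).
exact: (adapted_mfun mX a).
Qed.

Lemma express_mfun t : measurable_fun setT (q t).
Proof.
have a : adapted X past t (q t) by exact: (placed_express_adapted af).
exact: (adapted_mfun mX a).
Qed.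

Lemma itg_lead_demand t : itg P (fun w => \sum_(i < L0.+1) Dt (t.+1 + i)%N%:Z w).
Proof. by apply: itg_sum => i _; exact: (itg_Dt). Qed.

Lemma cost_ge0 t w : 0 <= cost (t.+1 + L0) w.
Proof.
rewrite period_costE //; apply: addr_ge0.
  by apply: mulr_ge0; [exact: ltW|exact: placed_express_ge0].
apply: le_trans (newsvendor_ge_mn h b _).
by rewrite mulr_ge0 // le_min !ltW.
Qed.

Lemma Ex_newsvendor_lead t : itg P (y t.+1) ->
  Ex P (fun w => newsvendor_cost h b (net t w)) = Ex P (fun w => lead (y t.+1 w)).
Proof.
move=> iy; have a : adapted X past t.+1 (y t.+1) by exact: (level_adapted af).
have e := lead_iter mX indep iD past_mono past_demand past_fresh
  (fun t => lawDt t%:Z) L0.+1 (newsvendor_lip h0 b0) a iy.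
exact: e.
Qed.

Lemma expectation_cost t : itg P (y t.+1) -> itg P (q t.+1) ->
  ('E_P[cost (t.+1 + L0)] = (c * Ex P (q t.+1) + Ex P (fun w => lead (y t.+1 w)))%:E)%E.
Proof.
move=> iy iq; rewrite unlock.
have i2 : itg P (fun w => newsvendor_cost h b (net t w)).
  by apply: itg_lip (newsvendor_lip h0 b0) _; apply: itgB => //; exact: itg_lead_demand.
have i1 : itg P (fun w => c * q t.+1 w) by exact: itgZl.
rewrite -Ex_newsvendor_lead // -ExZl // -ExD // EFin_Ex; last exact: itgD.
by apply: eq_integral => w _; rewrite period_costE.
Qed.

Lemma finite_cost_itg t : ('E_P[cost (t.+1 + L0)] < +oo)%E ->
  itg P (y t.+1) /\ itg P (q t.+1).
Proof.
rewrite unlock => fin.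
have mnet : measurable_fun setT (net t).
  by apply: measurable_funB; [exact: level_mfun|exact: itg_mfun (itg_lead_demand t)].
have mnv : measurable_fun setT (fun w => newsvendor_cost h b (net t w)).
  exact: (measurableT_comp (lip_mfun (newsvendor_lip h0 b0)) mnet).
have costE w : cost (t.+1 + L0) w = c * q t.+1 w + newsvendor_cost h b (net t w).
  by rewrite period_costE.
have mc : measurable_fun setT (cost (t.+1 + L0)).
  rewrite (_ : cost _ = fun w => c * q t.+1 w + newsvendor_cost h b (net t w)).
    apply: measurable_funD => //; apply: measurable_funM => //; exact: express_mfun.
  exact/funext.
have ic : itg P (cost (t.+1 + L0)) by apply: ge0_itg => // w; exact: cost_ge0.
have nv0 w : 0 <= newsvendor_cost h b (net t w).
  apply: le_trans (newsvendor_ge_mn h b _).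
  by rewrite mulr_ge0 // le_min !ltW.
have q0 w : 0 <= q t.+1 w by exact: placed_express_ge0.
split.
  have inet : itg P (net t).
    apply: (itg_le mnet _ (itgZl mn^-1 ic)) => w.
    rewrite mulrC ler_pdivlMr // mulrC (le_trans (newsvendor_ge_mn h b _)) // costE lerDr.
    by rewrite mulr_ge0 // ltW.
  have := itgD inet (itg_lead_demand t).
  by under eq_fun do rewrite subrK.
apply: (itg_le (express_mfun _) _ (itgZl c^-1 ic)) => w.
rewrite (ger0_norm (q0 w)) mulrC ler_pdivlMr // mulrC costE lerDl.
exact: nv0.
Qed.

(** Costs are nonnegative, so one period of infinite expected cost would make every later average
    infinite. Hence a finite long-run cost yields integrability in each single period. *)
Lemma finite_long_run t : (long_run_cost f < +oo)%E ->
  itg P (y t.+1) /\ itg P (q t.+1).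
Proof.
move=> fin; apply: finite_cost_itg; rewrite ltNge leye_eq; apply/negP => /eqP oo.
have [N /(_ (maxn N (t.+1 + L0)) (leq_maxl _ _))] := limn_esup_lt fin.
apply/negP; rewrite -leNgt leye_eq; apply/eqP.
set n := maxn _ _; have n1 : (t.+1 + L0 <= n)%N by rewrite leq_maxr.
suff -> : (\sum_(L0.+1 <= s < n.+1) 'E_P[cost s])%E = +oo%E.
  by rewrite gt0_muley // lte_fin invr_gt0 ltr0n; lia.
rewrite (bigD1_seq (t.+1 + L0)%N) ?iota_uniq //=; last first.
  by rewrite mem_index_iota; lia.
rewrite oo addye // gt_eqF // (@lt_le_trans _ _ 0%E) // ?ltNyr //.
rewrite big_seq_cond; apply: sume_ge0 => s; rewrite mem_index_iota => /andP[/andP[h1 _] _].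
rewrite unlock; apply: integral_ge0 => w _; rewrite lee_fin.
have -> : s = ((s - L0).-1.+1 + L0)%N by lia.
exact: cost_ge0.
Qed.

Lemma long_run_sum n : (forall t, itg P (y t.+1)) -> (forall t, itg P (q t.+1)) ->
  ((n%:R^-1)%:E * \sum_(L0.+1 <= t < n.+1) 'E_P[cost t])%E =
  (n%:R^-1 * \sum_(0 <= t < n - L0)
     (c * Ex P (q t.+1) + Ex P (fun w => lead (y t.+1 w))))%:E.
Proof.
move=> iy iq; rewrite EFinM; congr (_ * _)%E.
rewrite -{1}[L0.+1]add0n big_addn subSS -sumEFin; apply: eq_bigr => t _.
by rewrite addnS -addSn expectation_cost.
Qed.

End PeriodCosts.

Section AnyPolicy.
Variable f : @policy R L0 L.
Hypothesis af : admissible f.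

Local Notation y := (level f).
Local Notation q := (placed_express f).
Local Notation pos := (position f).
Local Notation arr := (arriving f).

Hypothesis iy : forall t, itg P (y t.+1).
Hypothesis iq : forall t, itg P (q t.+1).

(** Index [t] stands for period [t.+1], as orders start in period 1; the cost concerned is charged
    [L0] periods later. *)
Definition holding t := Ex P (fun w => lead (y t.+1 w)).
Definition ordered t := Ex P (q t.+1).
Definition arrived t := Ex P (arr t.+1).
Definition magnitude t := Ex P (fun w => `|y t.+1 w|).

Lemma holding_ge0 t : 0 <= holding t.
Proof. by apply: Ex_ge0 => w; exact: lead_ge0. Qed.

Lemma ordered_ge0 t : 0 <= ordered t.
Proof. by apply: Ex_ge0 => w; exact: placed_express_ge0. Qed.

Lemma arrived_ge0 t : 0 <= arrived t.
Proof. by apply: Ex_ge0 => w; exact: arriving_ge0. Qed.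

Lemma arrived_eq0 t : (t < n)%N -> arrived t = 0.
Proof.
move=> tn; rewrite -[RHS](Ex_cst P); apply: eq_Ex => w; exact: arriving_eq0.
Qed.

Lemma magnitude_ge0 t : 0 <= magnitude t.
Proof. by apply: Ex_ge0. Qed.

Lemma magnitude_le t : magnitude t <= holding t / mn + nu.
Proof.
have h1 : Ex P (fun w => mn * (`|y t.+1 w| - nu)) <= holding t.
  apply: Ex_le.
  - by apply: itgZl; apply: itgB; [exact: itg_abs|exact: itg_cst].
  - by apply: (itg_lip (lead_lip iD h0 b0 _)); exact: iy.
  - by move=> w; exact: lead_ge_mn.
rewrite ExZl ?ExB ?Ex_cst in h1; [|exact: itg_abs|exact: itg_cst|].
  by rewrite mulrC -ler_pdivlMr // in h1; rewrite /magnitude; lra.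
by apply: itgB; [exact: itg_abs|exact: itg_cst].
Qed.

(** Regular orders cost nothing, so the cost gives no direct control over them. Their integrability
    is read off the recursion of the levels. *)
Lemma itg_arriving t : itg P (arr t.+1).
Proof.
case: t => [|t].
  rewrite (_ : arr 1 = fun=> 0); first exact: itg_cst.
  by apply/funext => w; rewrite arriving_eq0 //; clear -L0L; lia.
have i1 := itgB (itgB (iy t.+1) (iq t.+1)) (iy t).
have := itgD i1 (itg_Dt t.+1%:Z).
congr (itg P _); apply/funext => w.
by rewrite levelS //; ring.
Qed.

Lemma express_sum N w : \sum_(t < N.+1) q t.+1 w =
  y N.+1 w - I0 w + \sum_(t < N) Dt t.+1%:Z w - \sum_(t < N) arr t.+2 w.
Proof.
elim: N => [|N IH].
  by rewrite big_ord_recr !big_ord0 /= /level position1 //; rewrite /I0; ring.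
rewrite big_ord_recr IH ![\sum_(t < N.+1) _]big_ord_recr /=.
by rewrite [y N.+2 w]levelS //; ring.
Qed.

Lemma ordered_sum N : \sum_(t < N.+1) ordered t =
  Ex P (y N.+1) - Ex P I0 + N%:R * mu - \sum_(t < N) arrived t.+1.
Proof.
rewrite -Ex_sum; last by move=> t _; exact: iq.
under eq_Ex do rewrite express_sum.
have iS : itg P (fun w => \sum_(t < N) Dt t.+1%:Z w).
  by apply: itg_sum => t _; exact: (itg_Dt).
have iA : itg P (fun w => \sum_(t < N) arr t.+2 w).
  by apply: itg_sum => t _; exact: itg_arriving.
rewrite ExB; [|by apply: itgD => //; exact: itgB|exact: iA].
rewrite ExD; [|exact: itgB|exact: iS].
rewrite ExB // Ex_sum; last by move=> t _; exact: (itg_Dt).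
rewrite Ex_sum; last by move=> t _; exact: itg_arriving.
have -> : \sum_(t < N) Ex P (Dt t.+1%:Z) = N%:R * mu.
  rewrite (eq_bigr (fun=> mu)); last by move=> t _; exact: (Ex_Dt).
  by rewrite sumr_const card_ord mulr_natl.
by [].
Qed.

(** The arrivals lost at the start of a shifted range are zero, the ones gained at its end are
    nonnegative. So each offset within a window sees an average arrival of at least [r]. *)
Lemma arrived_shift N j : (j <= n)%N ->
  \sum_(t < N) arrived t <= \sum_(t < N) arrived (t + j)%N.
Proof.
move=> jn; apply: (@le_trans _ _ (\sum_(t < j + N) arrived t)).
  by rewrite addnC big_split_ord /= lerDl; apply: sumr_ge0 => t _; exact: arrived_ge0.
rewrite big_split_ord /= big1 ?add0r; last first.
  by move=> t _; apply: arrived_eq0; exact: leq_trans jn.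
by under eq_bigr do rewrite addnC.
Qed.

Lemma shifted_sum_le (F : nat -> R) N j : (forall t, 0 <= F t) -> (j <= n)%N ->
  \sum_(t < N) F (t + j)%N <= \sum_(t < N + n) F t.
Proof.
move=> F0 jn; apply: (@le_trans _ _ (\sum_(t < j + N) F t)).
  rewrite big_split_ord /=; under eq_bigr do rewrite addnC.
  by rewrite lerDr; exact: sumr_ge0.
have -> : (N + n = (j + N) + (n - j))%N by clear -jn; lia.
by rewrite [leRHS]big_split_ord /= lerDl; exact: sumr_ge0.
Qed.

Section Averages.
Variables (N : nat) (r B : R).
Hypotheses (N0 : (0 < N)%N) (nN : (n <= N)%N).
Hypothesis rE : r = (\sum_(t < N) arrived t) / N%:R.
Hypothesis BE : B = (\sum_(t < N + n) holding t) / N%:R.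

Let NR0 : 0 < N%:R :> R. Proof. by rewrite ltr0n. Qed.

Lemma magnitude_sum : \sum_(t < N + n) magnitude t <= N%:R * (B / mn + 2 * nu).
Proof.
have mu0 : 0 <= mu by exact: Ex_ge0.
apply: (@le_trans _ _ (\sum_(t < N + n) (holding t / mn + nu))).
  by apply: ler_sum => t _; exact: magnitude_le.
rewrite big_split /= -mulr_suml sumr_const card_ord -mulr_natl BE.
have e1 : N%:R * ((\sum_(t < N + n) holding t) / N%:R / mn) =
    (\sum_(t < N + n) holding t) / mn.
  by field; rewrite !gt_eqF.
have e2 : (N + n)%:R <= 2 * N%:R :> R.
  by rewrite natrD; have : n%:R <= N%:R :> R by [rewrite ler_nat]; lra.
have nu0 : 0 <= nu by rewrite mulr_ge0.
have := ler_wpM2r nu0 e2; rewrite mulrDr e1; lra.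
Qed.

Variables (delta al S Om : R).
Hypotheses (delta0 : 0 < delta) (al0 : 0 < al) (al1 : al < 1).
Hypothesis root : discounted_slope P D lead delta r al n S 0 = 0.
Hypothesis KOm : forall k, iter k (lindley P D r) id 0 <= Om.

(** [window_bound] averaged over [N] starting times. [B] divides by [N] the holding costs of [N + n]
    periods, because the last windows overshoot by [n]; since [n <= N], the gap sizes at most
    double. *)
Lemma window_average :
  \sum_(k < n) al ^+ k * iter k (lindley P D r) (fun x => lead (S + x)) 0
  - 2 * m * delta * (\sum_(k < n) al ^+ k)
  - 2 * (al ^+ n * (m / (1 - al))) * (B / mn + 2 * nu + `|S| + Om)
  <= (\sum_(k < n) al ^+ k) * B.
Proof.
have n0 : (0 < n)%N by clear -L0L; lia.
have llead := lead_lip iD h0 b0 L0.+1.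
have clead := lead_cvx iD h0 b0 L0.+1.
have m00 := ltW m0.
have al0' := ltW al0.
set V := B / mn + _ + _ + _.
have Om0 : 0 <= Om := KOm 0.
pose lam k := iter k.+1 (lindley P D r) (discounted_slope P D lead delta r al n S) 0.
have lam0 k : 0 <= lam k.
  have l0 : lip 0 (fun _ : R => 0 : R) by move=> ? ?; rewrite subrr normr0 mul0r.
  have le := discounted_slope_lip iD r n llead delta0 al0' S.
  have H := iter_lindley_le iD r k.+1 l0 le.
  have z j x : iter j (lindley P D r) (fun=> 0) x = 0.
    elim: j x => // j IH x /=; rewrite -[RHS](Ex_cst P) /lindley.
    by apply: eq_Ex => w; exact: IH.
  have := H _ 0 (lexx 0); rewrite z; apply => x x0.
  rewrite -root; exact: (discounted_slope_nd iD r n llead clead delta0 al0' S).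
have win t := window_bound (t0 := t.+1) (r := r) (y := y) (q := q) (arr := arr) (n := n)
  (Om := Om) (fy := fun k => holding (t + k)) (Y := fun k => magnitude (t + k))
  mX indep iD past_mono past_demand past_fresh (fun t => lawDt t%:Z)
  _ _ (placed_express_ge0 Dt Dt' Ghat af) _ _ _ llead clead delta0 al0' al1 n0 root KOm _ _.
pose W1 := \sum_(k < n) al ^+ k * (iter k (lindley P D r) (fun x => lead (S + x)) 0 - 2 * m * delta).
have {}win (t : 'I_N) : W1
  + \sum_(k < n) al ^+ k.+1 * lam k * (arrived (t + k.+1)%N - r)
  - \sum_(k < n) al ^+ k * (al ^+ n * m * (magnitude (t + k)%N + `|S| + Om))
  - al ^+ n * (m / (1 - al)) * (magnitude (t + n)%N + `|S| + Om)
  <= \sum_(k < n) al ^+ k * holding (t + k)%N.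
  apply: win => //.
  - move=> t' [|s] ts; [by rewrite ltn0 in ts|exact: (level_adapted af)].
  - move=> t' [|s] ts; [by rewrite ltn0 in ts|exact: iy].
  - move=> t' k /andP[_ kn]; exact: (arriving_adapted L0L af kn).
  - move=> t' [|s] ts; [by rewrite ltn0 in ts|exact: itg_arriving].
  - move=> t' [|s] w ts; [by rewrite ltn0 in ts|exact: levelS].
have {}win := ler_sum (index_enum 'I_N) (fun t (_ : xpredT t) => win t).
move: win.
rewrite exchange_big /=.
under [X in _ <= X -> _]eq_bigr do rewrite -mulr_sumr.
rewrite 2!sumrB big_split /= sumr_const card_ord -[W1 *+ N]mulr_natl => win.
(* The averaged arrival terms have the favourable sign: nonnegative coefficients [lam], times a mean
   arrival not below [r]. *)
have armean : 0 <= \sum_(t < N) \sum_(k < n) al ^+ k.+1 * lam k * (arrived (t + k.+1)%N - r).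
  rewrite exchange_big /=; apply: sumr_ge0 => k _; rewrite -mulr_sumr.
  apply: mulr_ge0; first by rewrite mulr_ge0 // exprn_ge0.
  rewrite sumrB sumr_const card_ord -mulr_natl subr_ge0.
  have -> : N%:R * r = \sum_(t < N) arrived t by rewrite rE mulrC divfK // gt_eqF.
  by apply: arrived_shift; exact: ltn_ord.
have hold k : (k < n)%N -> \sum_(t < N) holding (t + k)%N <= N%:R * B.
  move=> kn; rewrite BE mulrC divfK ?gt_eqF //.
  by apply: shifted_sum_le; [exact: holding_ge0|exact: ltnW].
have mag k : (k <= n)%N -> \sum_(t < N) (magnitude (t + k)%N + `|S| + Om) <= N%:R * V.
  move=> kn; rewrite !big_split /= !sumr_const card_ord -[X in _ + X + _]mulr_natl -[X in _ + X]mulr_natl.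
  have := shifted_sum_le N magnitude_ge0 kn; have := magnitude_sum.
  rewrite /V; lra.
have aln0 : 0 <= al ^+ n by exact: exprn_ge0.
have p1 : 0 < 1 - al by rewrite subr_gt0.
have err1 : \sum_(t < N) \sum_(k < n) al ^+ k *
    (al ^+ n * m * (magnitude (t + k)%N + `|S| + Om)) <=
    N%:R * (al ^+ n * (m / (1 - al)) * V).
  rewrite exchange_big /=.
  apply: (@le_trans _ _ (\sum_(k < n) al ^+ k * (al ^+ n * m * (N%:R * V)))).
    apply: ler_sum => k _; rewrite -mulr_sumr ler_wpM2l ?exprn_ge0 // -mulr_sumr.
    by rewrite ler_wpM2l ?mulr_ge0 // mag // ltnW.
  have V0 : 0 <= V.
    have := mag 0%N isT; have : 0 <= \sum_(t < N) (magnitude (t + 0)%N + `|S| + Om).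
      by apply: sumr_ge0 => t _; rewrite !addr_ge0 // magnitude_ge0.
    by move=> h1 h2; have := le_trans h1 h2; rewrite pmulr_rge0.
  rewrite -mulr_suml.
  have -> : N%:R * (al ^+ n * (m / (1 - al)) * V) =
      (1 - al)^-1 * (al ^+ n * m * (N%:R * V)) by ring.
  rewrite ler_wpM2r ?mulr_ge0 //; exact: power_sum_le.
have err2 : \sum_(t < N) al ^+ n * (m / (1 - al)) * (magnitude (t + n)%N + `|S| + Om) <=
    N%:R * (al ^+ n * (m / (1 - al)) * V).
  have cA : 0 <= al ^+ n * (m / (1 - al)) by rewrite mulr_ge0 // divr_ge0 // ltW.
  by rewrite -mulr_sumr; have := ler_wpM2l cA (mag n (leqnn _)); lra.
have hold2 : \sum_(k < n) al ^+ k * \sum_(t < N) holding (t + k)%N <=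
    N%:R * ((\sum_(k < n) al ^+ k) * B).
  rewrite mulrCA mulr_suml; apply: ler_sum => k _.
  by rewrite ler_wpM2l ?exprn_ge0 // hold.
rewrite -(ler_pM2l NR0); apply: le_trans hold2; apply: le_trans win.
have e : W1 = \sum_(k < n) al ^+ k * iter k (lindley P D r) (fun x => lead (S + x)) 0
      - (\sum_(k < n) al ^+ k) * (2 * m * delta).
  by rewrite /W1; under eq_bigr do rewrite mulrBr; rewrite sumrB -mulr_suml.
rewrite e; lra.
Qed.

End Averages.

End AnyPolicy.

Lemma lead_lipm : lip m lead. Proof. exact: lead_lip. Qed.
Lemma decaying_sum (e : nat -> R) A M ga t1 : (forall t, 0 <= e t) -> 0 <= A -> 0 <= M ->
  0 <= ga < 1 -> (forall j, e (t1 + j)%N <= A + M * ga ^+ j) ->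
  exists B, (forall t, e t <= B) /\ forall N, \sum_(t < N) e t <= N%:R * A + B.
Proof.
move=> e0 A0 M0 /andP[g0 g1] he.
have s0 : 0 <= \sum_(t < t1) e t by exact: sumr_ge0.
have M1 : M <= M / (1 - ga).
  by rewrite ler_peMr // invf_ge1 ?subr_gt0 // lerBlDr lerDl.
exists (\sum_(t < t1) e t + A + M / (1 - ga)); split.
  move=> t; case: (ltnP t t1) => tt.
    have : e t <= \sum_(s < t1) e s.
      rewrite (bigD1 (Ordinal tt)) //= lerDl; exact: sumr_ge0.
    lra.
  have := he (t - t1)%N; rewrite subnKC //.
  have : M * ga ^+ (t - t1) <= M by rewrite ler_piMr // exprn_ile1 // ltW.
  lra.
move=> N; apply: (@le_trans _ _ (\sum_(t < t1 + N) e t)).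
  by rewrite addnC big_split_ord /= lerDl; exact: sumr_ge0.
rewrite big_split_ord /=.
have : \sum_(j < N) e (t1 + j)%N <= \sum_(j < N) (A + M * ga ^+ j) by apply: ler_sum.
rewrite big_split /= sumr_const card_ord -mulr_sumr.
have : M * \sum_(j < N) ga ^+ j <= M / (1 - ga).
  by apply: ler_wpM2l => //; exact: power_sum_le.
rewrite -mulr_natl; lra.
Qed.

(** * Upper bound for the long-run cost of a TBS policy *)

Section TailoredBaseSurge.
Variables (r S theta gam : R) (k : nat).
Hypotheses (r0 : 0 <= r) (rmu : r <= mu) (theta0 : 0 < theta) (gam1 : gam < 1).
Hypothesis mgf : Ex P (fun w => expR (theta * (r - D w))) <= gam.

Let f : @policy R L0 L := tbs r S.

Lemma tbs_admissible : admissible f.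
Proof.
move=> t; split; last by move=> x; rewrite /f /tbs /= le_max lexx.
apply: measurable_fun_pair => //; apply: measurable_maxr => //.
exact: measurable_funB.
Qed.

Local Notation y := (level f).
Local Notation q := (placed_express f).
Local Notation pos := (position f).
Local Notation arr := (arriving f).

Let ar t : R := if (L - L0 < t)%N then r else 0.

Lemma tbs_express t w : q t.+1 w = Num.max 0 (S - pos t.+1 w).
Proof. by rewrite placed_expressS. Qed.

Lemma tbs_arriving t w : arr t w = ar t.
Proof.
rewrite /ar; case: ltnP => hh; last by rewrite arriving_eq0.
rewrite -(subnKC (ltnW hh)) arriving_placed //.
have : (0 < t - (L - L0))%N by rewrite subn_gt0.
by case: (t - (L - L0))%N => // s _; rewrite placed_regularS.
Qed.

Let exc t w := y t.+1 w - S.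

Lemma tbs_excess t w : exc t w = Num.max 0 (pos t.+1 w - S).
Proof.
rewrite /exc /level tbs_express.
case: (leP 0 (S - pos t.+1 w)) => h1; case: (leP 0 (pos t.+1 w - S)) => h2; lra.
Qed.

Lemma tbs_excessS t w : exc t.+1 w = Num.max 0 (exc t w + ar t.+2 - Dt t.+1%:Z w).
Proof.
rewrite tbs_excess positionS // tbs_arriving /exc; congr Num.max; ring.
Qed.

Let aexc t : adapted X past t.+1 (exc t).
Proof.
have a : adapted X past t.+1 (y t.+1) by exact: (level_adapted tbs_admissible).
by apply: measurable_funB => //.
Qed.

Let iexc t : itg P (exc t).
Proof.
elim: t => [|t IH].
  rewrite (_ : exc 0 = fun w => Num.max 0 (I0 w - S)).
    by apply: itg_max; [exact: itg_cst|apply: itgB => //; exact: itg_cst].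
  by apply/funext => w; rewrite tbs_excess position1.
rewrite (_ : exc t.+1 = fun w => Num.max 0 (exc t w + ar t.+2 - Dt t.+1%:Z w)).
  apply: itg_max; first exact: itg_cst.
  apply: itgB; last exact: (itg_Dt).
  by apply: itgD => //; exact: itg_cst.
by apply/funext => w; rewrite tbs_excessS.
Qed.

Let iy t : itg P (y t.+1).
Proof.
have := itgD (iexc t) (itg_cst P S).
by rewrite /exc; under eq_fun do rewrite subrK.
Qed.

Let ipos t : itg P (pos t.+1).
Proof.
case: t => [|t].
  by rewrite (_ : pos 1 = I0) //; apply/funext => w; exact: position1.
rewrite (_ : pos t.+2 = fun w => y t.+1 w - Dt t.+1%:Z w + ar t.+2).
  apply: itgD; last exact: itg_cst.
  by apply: itgB => //; exact: (itg_Dt).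
by apply/funext => w; rewrite positionS // tbs_arriving.
Qed.

Let iq t : itg P (q t.+1).
Proof.
have := itgB (iy t) (ipos t); rewrite /level.
by under eq_fun do rewrite addrAC subrr add0r.
Qed.

Lemma tbs_excess_step C t (g : R -> R) : lip C g ->
  Ex P (fun w => g (exc t.+1 w)) = Ex P (fun w => lindley P D (ar t.+2) g (exc t w)).
Proof.
move=> lg.
have a : adapted X past t.+1 (fun w => exc t w + ar t.+2).
  by apply: measurable_funD => //; exact: aexc.
have i : itg P (fun w => exc t w + ar t.+2) by apply: itgD => //; exact: itg_cst.
have := one_step1 mX indep iD past_fresh (fun t => lawDt t%:Z) (lip_reflect lg) a i.
by rewrite /= => <-; apply: eq_Ex => w; rewrite tbs_excessS.
Qed.

Lemma tbs_excess_idle C t (g : R -> R) : lip C g -> (t < L - L0)%N ->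
  Ex P (fun w => g (exc t w)) = Ex P (fun w => iter t (lindley P D 0) g (exc 0 w)).
Proof.
elim: t g => // t IH g lg tL; rewrite (@tbs_excess_step C t g lg) /ar ltnNge tL /=.
by rewrite IH ?(ltnW tL) -?iterSr //; exact: lip_lindley.
Qed.

Lemma tbs_excess_run C j (g : R -> R) : lip C g ->
  Ex P (fun w => g (exc ((L - L0).-1 + j)%N w)) =
  Ex P (fun w => iter j (lindley P D r) g (exc (L - L0).-1 w)).
Proof.
elim: j g => [|j IH] g lg; first by rewrite addn0.
rewrite addnS (@tbs_excess_step C ((L - L0).-1 + j) g lg) /ar ifT; last by clear -L0L; lia.
by rewrite IH -?iterSr //; exact: lip_lindley.
Qed.

(** Initial inventory is almost surely nonpositive, so the excess starts at most at [|S|]. The idle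
    phase before the first arrival does not worsen this bound, and the [j] periods after it contract
    it by [gam ^+ j]. *)
Lemma tbs_excess_decay C j (g : R -> R) : lip C g ->
  Ex P (fun w => g (exc ((L - L0).-1 + j)%N w)) <=
  iter j (lindley P D r) g 0 + C / theta * gam ^+ j * (expR (theta * `|S|) - 1).
Proof.
move=> lg; rewrite (@tbs_excess_run C j g lg).
have g0 := gam_ge0 mgf; have C0 := lip_ge0 lg.
have lgj := lip_iter iD r j lg.
have lt1 : ((L - L0).-1 < L - L0)%N by clear -L0L; lia.
rewrite (@tbs_excess_idle C (L - L0).-1 _ lgj lt1).
set G := iter j _ g; set n := (L - L0).-1.
have A0 : 0 <= C / theta * gam ^+ j.
  by rewrite mulr_ge0 ?exprn_ge0 // divr_ge0 // ltW.
have hG x : 0 <= x -> G x - G 0 <= C / theta * gam ^+ j * (expR (theta * x) - 1).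
  move=> x0; have := iter_lindley_exp_diff iD D0 theta0 mgf j lg (x := x) (y := 0).
  by rewrite lexx x0 mulr0 expR0 => /(_ isT); rewrite ler_norml => /andP[_].
have hn := iter_lindley0_exp iD D0 n lgj A0 theta0 hG.
have ln := lip_iter iD 0 n lgj.
have ms := lip_mfun ln.
have mI : measurable_fun setT I0 by exact: itg_mfun iI0.
rewrite (_ : exc 0 = fun w => Num.max 0 (I0 w - S)); last first.
  by apply/funext => w; rewrite tbs_excess position1.
(* Capping the initial inventory at 0 changes it on a null set only and makes the bound by [|S|]
   hold pointwise. *)
rewrite (@Ex_ae_eq _ _ _ P _ (fun w => iter n (lindley P D 0) G (Num.max 0 (Num.min 0 (I0 w) - S)))); last 3 first.
- apply: (measurableT_comp ms); apply: measurable_maxr => //.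
  exact: measurable_funB.
- apply: (measurableT_comp ms); apply: measurable_maxr => //.
  by apply: measurable_funB => //; apply: measurable_minr.
- apply: filterS ae_initial_le0 => w hh.
  by rewrite (min_idPr hh).
apply: Ex_le_cst.
  apply: (itg_lip ln); apply: itg_max; first exact: itg_cst.
  by apply: itgB; [apply: itg_min => //; exact: itg_cst|exact: itg_cst].
move=> w; have mx0 : 0 <= Num.max 0 (Num.min 0 (I0 w) - S) by rewrite le_max lexx.
have := hn _ mx0; rewrite lerBlDl => /le_trans; apply.
rewrite lerD2l ler_wpM2l // lerD2r ler_expR ler_wpM2l ?(ltW theta0) //.
rewrite ge_max normr_ge0 /=.
have : Num.min 0 (I0 w) <= 0 by rewrite ge_min lexx.
have := ler_norm (- S); rewrite normrN; lra.
Qed.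

Local Notation shifted := (fun x => lead (S + x)).

(** Bounds the stationary holding cost: the [k]-th iterate from 0 plus a geometric remainder for all
    later ones. *)
Let A := iter k (lindley P D r) shifted 0 + m / theta * gam ^+ k.+1 / (1 - gam).

Let lshift : lip m shifted. Proof. exact/lip_shift/lead_lipm. Qed.

Let A0 : 0 <= A.
Proof.
have g0 := gam_ge0 mgf; have m00 := ltW m0.
rewrite addr_ge0 //.
  apply: (iter_lindley_ge_cst iD r k 0 lshift) => x; exact: lead_ge0.
by rewrite divr_ge0 ?subr_ge0 ?(ltW gam1) // mulr_ge0 ?exprn_ge0 // divr_ge0 // ltW.
Qed.

Let e t := Ex P (fun w => lead (y t.+1 w)).

Lemma tbs_holding : exists B, (forall t, e t <= B) /\
  forall N, \sum_(t < N) e t <= N%:R * A + B.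
Proof.
have g0 := gam_ge0 mgf; have m00 := ltW m0.
have E0 : 0 <= expR (theta * `|S|) - 1.
  by rewrite subr_ge0 -expR0 ler_expR mulr_ge0 // ltW.
apply: (@decaying_sum _ _ (m / theta * (expR (theta * `|S|) - 1)) gam ((L - L0).-1 + k)).
- by move=> t; apply: Ex_ge0 => w; exact: lead_ge0.
- exact: A0.
- by rewrite mulr_ge0 // divr_ge0 // ltW.
- by rewrite g0.
move=> j; have := tbs_excess_decay (k + j) lshift.
rewrite addnA => hh.
have -> : e ((L - L0).-1 + k + j) = Ex P (fun w => lead (S + exc ((L - L0).-1 + k + j)%N w)).
  by apply: eq_Ex => w; rewrite /exc addrC subrK.
apply: (le_trans hh); apply: lerD.
  exact: (iter_lindley_tail iD D0 theta0 gam1 mgf k j lshift).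
rewrite mulrAC ler_wpM2l //; first by rewrite mulr_ge0 // divr_ge0 // ltW.
by rewrite exprD ler_piMl ?exprn_ge0 // exprn_ile1 // ltW.
Qed.

Lemma ar_sum N : r * (N%:R - (L - L0)%:R) <= \sum_(t < N) ar t.+2.
Proof.
elim: N => [|N IH]; first by rewrite big_ord0; have : (0:R) <= (L - L0)%:R by []; have := r0; nra.
rewrite big_ord_recr /= -natr1 /ar; case: ltnP => hh.
  by have := r0; move: IH; rewrite /ar; lra.
have : 0 <= \sum_(t < N) ar t.+2 by apply: sumr_ge0 => t _; rewrite /ar; case: ifP.
have : N%:R + 1 <= (L - L0)%:R :> R by rewrite natr1 ler_nat; exact: ltnW.
rewrite /ar; have := r0; nra.
Qed.

(** By mass balance the express source supplies per period what regular arrivals leave of the mean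
    demand, up to a bounded total. This gives [mu - r]; the initial transient disappears in the
    average. *)
Lemma tbs_upper : (long_run_cost f <= (c * (mu - r) + A)%:E)%E.
Proof.
have [B [eB sB]] := tbs_holding.
pose Q := B / mn + nu + `|Ex P I0| + r * (L - L0)%:R.
have qsum N : \sum_(t < N.+1) Ex P (q t.+1) <= N%:R * (mu - r) + Q.
  apply: (@le_trans _ _ (\sum_(t < N.+1) ordered f t)) => //.
  rewrite (ordered_sum iy iq).
  have -> : \sum_(t < N) arrived f t.+1 = \sum_(t < N) ar t.+2.
    apply: eq_bigr => t _; rewrite -(Ex_cst P (ar t.+2)); apply: eq_Ex => w.
    exact: tbs_arriving.
  have h1 : Ex P (y N.+1) <= B / mn + nu.
    apply: (@le_trans _ _ (magnitude f N)).
      by apply: Ex_le; [exact: iy|exact/itg_abs/iy|move=> w; exact: ler_norm].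
    by apply: le_trans (magnitude_le iy N) _; rewrite lerD2r ler_pM2r ?invr_gt0 //; exact: eB.
  have := ar_sum N; have := ler_norm (- Ex P I0); rewrite normrN.
  by rewrite /Q; lra.
have Q0 : 0 <= Q.
  have := qsum 0%N; rewrite mul0r add0r; apply: le_trans.
  apply: sumr_ge0 => t _; apply: Ex_ge0 => w; exact: placed_express_ge0 tbs_admissible _ _.
have B0 : 0 <= B by apply: le_trans (eB 0%N); apply: Ex_ge0 => w; exact: lead_ge0.
pose A2 := c * (mu - r) + A.
have A20 : 0 <= A2 by rewrite addr_ge0 // mulr_ge0 ?(ltW c0) // subr_ge0.
pose B2 := c * Q + B.
have total N : \sum_(0 <= t < N) (c * Ex P (q t.+1) + e t) <= N%:R * A2 + B2.
  rewrite big_mkord big_split /= -mulr_sumr.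
  have h1 := sB N.
  have h2 : \sum_(t < N) Ex P (q t.+1) <= N%:R * (mu - r) + Q.
    case: N {h1} => [|N]; first by rewrite big_ord0 mul0r add0r.
    apply: (le_trans (qsum N)); rewrite lerD2r ler_wpM2r ?subr_ge0 //.
    by rewrite ler_nat.
  have := ler_wpM2l (ltW c0) h2; rewrite /A2 /B2; lra.
apply: limn_esup_le => eps eps0.
have B20 : 0 <= B2 by rewrite addr_ge0 // mulr_ge0 // ltW.
have [N hN] : exists N : nat, B2 / eps < N%:R.
  exists (Num.bound (B2 / eps)); apply: archi_boundP.
  by rewrite divr_ge0 // ltW.
exists N.+1 => n Nn.
rewrite (long_run_sum tbs_admissible n iy iq) lee_fin.
have n0 : 0 < n%:R :> R by rewrite ltr0n; exact: leq_ltn_trans Nn.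
rewrite mulrC ler_pdivrMr //; apply: (le_trans (total _)).
have : (n - L0)%:R * A2 <= n%:R * A2 by rewrite ler_wpM2r // ler_nat leq_subr.
have : B2 <= eps * n%:R.
  rewrite mulrC -ler_pdivrMr //; apply: ltW; apply: (lt_le_trans hN).
  by rewrite ler_nat ltnW.
rewrite /A2; lra.
Qed.

End TailoredBaseSurge.

(** Pigeonhole over the second half of the range: if all its values exceeded [a * K], the sum would
    be too large. *)
Lemma bounded_somewhere (F : nat -> R) K (a Bd : R) : (0 < K)%N -> (forall t, 0 <= F t) ->
  \sum_(t < K + K) F t <= (K + K)%:R * Bd -> 2 * Bd <= a * K%:R ->
  exists t, (K <= t < K + K)%N /\ F t <= a * K%:R.
Proof.
move=> K0 F0 sF hBd; apply: contrapT => /forallNP hn.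
have hj (j : 'I_K) : a * K%:R < F (K + j)%N.
  rewrite ltNge; apply/negP => hle; apply: (hn (K + j)%N); split => //.
  by rewrite leq_addr ltn_add2l ltn_ord.
have KR : 0 < K%:R :> R by rewrite ltr0n.
have : \sum_(j < K) a * K%:R < \sum_(j < K) F (K + j)%N.
  by apply: ltr_sum => //; apply/hasP; exists (Ordinal K0); rewrite // mem_index_enum.
rewrite sumr_const card_ord -[(a * _) *+ _]mulr_natl => h1.
have h2 : \sum_(j < K) F (K + j)%N <= \sum_(t < K + K) F t.
  by rewrite [leRHS]big_split_ord /= lerDr; exact: sumr_ge0.
have := ler_wpM2l (ltW KR) hBd; move: sF; rewrite natrD; lra.
Qed.

Section Horizon.
Variable f : @policy R L0 L.
Hypothesis af : admissible f.
Variables (Cst delta : R) (T0 : nat).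
Hypotheses (delta0 : 0 < delta)
  (fin : (long_run_cost f < Cst%:E)%E).

Local Notation holding := (holding f).
Local Notation ordered := (ordered f).
Local Notation arrived := (arrived f).
Local Notation magnitude := (magnitude f).

Lemma policy_integrable t : itg P (level f t.+1) /\
  itg P (placed_express f t.+1).
Proof.
apply: (finite_long_run af t).
exact: lt_trans fin (ltry _).
Qed.

(* The averages of [magnitude] stay bounded, so some late period has a level
   negligible against its date; stopping there makes the end effect in the
   balance between orders and demand negligible. *)
Lemma choose_horizon : exists N, [/\ (T0 <= N)%N, (0 < N)%N, (n <= N)%N &
  c * (mu - (\sum_(t < N) arrived t) / N%:R - delta)
  + (\sum_(t < N + n) holding t) / N%:R <= Cst + delta /\
  (\sum_(t < N + n) holding t) / N%:R <= Cst + delta].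
Proof.
have iy t := (policy_integrable t).1; have iq t := (policy_integrable t).2.
have mu0 : 0 <= mu by exact: Ex_ge0.
have e0 t : 0 <= holding t by exact: holding_ge0.
have q0 t : 0 <= ordered t by exact: ordered_ge0.
have [N0 hN0] := limn_esup_lt fin.
pose Sm M := \sum_(t < M) (c * ordered t + holding t).
have Sm0 M : 0 <= Sm M.
  by apply: sumr_ge0 => t _; rewrite addr_ge0 // mulr_ge0 // ltW.
have hS M : (N0 < M)%N -> Sm M <= (M + L0)%:R * Cst.
  move=> NM; have := hN0 (M + L0)%N (leq_trans (ltnW NM) (leq_addr _ _)).
  rewrite (long_run_sum af _ iy iq) lte_fin.
  rewrite addnK big_mkord => hlt.
  have p : 0 < (M + L0)%:R :> R.
    by rewrite ltr0n addn_gt0 (leq_ltn_trans (leq0n _) NM).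
  by rewrite mulrC ltr_pdivrMr // in hlt; rewrite mulrC; exact: ltW.
have C0 : 0 <= Cst.
  have p : 0 < (N0.+1 + L0)%:R :> R by rewrite ltr0n.
  by have := le_trans (Sm0 _) (hS N0.+1 (ltnSn _)); rewrite pmulr_rge0.
pose Bd := (1 + L0)%:R * Cst / mn + nu.
have nu0 : 0 <= nu by rewrite mulr_ge0.
have Bd0 : 0 <= Bd.
  by rewrite addr_ge0 // divr_ge0 ?(ltW mn0) // mulr_ge0.
have hY M : (N0 < M)%N -> \sum_(t < M) magnitude t <= M%:R * Bd.
  move=> NM; have M1 : (0 < M)%N by exact: leq_ltn_trans NM.
  apply: (@le_trans _ _ (\sum_(t < M) (holding t / mn + nu))).
    apply: ler_sum => t _; exact: (magnitude_le iy).
  rewrite big_split /= -mulr_suml sumr_const card_ord -[nu *+ M]mulr_natl.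
  have h1 : \sum_(t < M) holding t <= M%:R * ((1 + L0)%:R * Cst).
    apply: (@le_trans _ _ (Sm M)).
      by apply: ler_sum => t _; rewrite lerDr mulr_ge0 // ltW.
    apply: (le_trans (hS M NM)); rewrite mulrA ler_wpM2r // -natrM ler_nat.
    by rewrite mulnDr muln1 leq_add2l leq_pmull.
  have h2 : (\sum_(t < M) holding t) / mn <= M%:R * ((1 + L0)%:R * Cst) / mn.
    by rewrite ler_wpM2r // invr_ge0 ltW.
  rewrite /Bd; lra.
pose EI := `|Ex P (fun w => inventory (initial_state Dt' Ghat w))|.
(* Three end effects to be made smaller than [delta] per period: the search for a small level, the
   [n + L0] periods beyond the horizon, and the initial inventory with one boundary demand. *)
pose big := 4 * Bd / delta + (n + L0)%:R * Cst / delta + 2 * (EI + mu) / delta.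
have EI0 : 0 <= EI by exact: normr_ge0.
have dl := ltW delta0.
have b1 : 0 <= 4 * Bd / delta by rewrite divr_ge0 // mulr_ge0.
have b2 : 0 <= (n + L0)%:R * Cst / delta by rewrite divr_ge0 // mulr_ge0.
have b3 : 0 <= 2 * (EI + mu) / delta by rewrite divr_ge0 // mulr_ge0 // addr_ge0.
pose K := (Num.bound big + N0 + T0 + n).+1.
have bK : big <= K%:R.
  have h1 : big < (Num.bound big)%:R by apply: archi_boundP; rewrite !addr_ge0.
  apply: (le_trans (ltW h1)); rewrite ler_nat /K; clear; lia.
have K0 : (0 < K)%N by [].
have KN0 : (N0 < K)%N by rewrite /K; clear; lia.
have mag0 t : 0 <= magnitude t by exact: magnitude_ge0.
have k1 : 4 * Bd <= K%:R * delta by rewrite -ler_pdivrMr //; rewrite /big in bK; lra.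
have k2 : (n + L0)%:R * Cst <= K%:R * delta.
  by rewrite -ler_pdivrMr //; rewrite /big in bK; lra.
have k3 : 2 * (EI + mu) <= K%:R * delta.
  by rewrite -ler_pdivrMr //; rewrite /big in bK; lra.
have [t [/andP[Kt tK] mt]] : exists t, (K <= t < K + K)%N /\ magnitude t <= delta / 2 * K%:R.
  apply: (bounded_somewhere (Bd := Bd)) => //.
    by apply: hY; rewrite /K; clear; lia.
  by rewrite /K in k1 *; lra.
have KRt : K%:R <= t.+1%:R :> R by rewrite ler_nat; exact: leqW.
exists t.+1; split => //.
- by rewrite /K in Kt; clear -Kt; lia.
- by rewrite /K in Kt; clear -Kt; lia.
have tR : 0 < t.+1%:R :> R by rewrite ltr0n.
have i1 : c * \sum_(s < t.+1) ordered s + \sum_(s < t.+1 + n) holding s <=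
    t.+1%:R * (Cst + delta).
  apply: (@le_trans _ _ (Sm (t.+1 + n)%N)).
    rewrite /Sm big_split /= lerD2r -mulr_sumr ler_wpM2l ?(ltW c0) //.
    by rewrite [leRHS]big_split_ord /= lerDl; exact: sumr_ge0.
  have NN : (N0 < t.+1 + n)%N by clear -KN0 Kt; lia.
  apply: (le_trans (hS _ NN)); rewrite -addnA natrD.
  have : K%:R * delta <= t.+1%:R * delta by rewrite ler_wpM2r.
  lra.
have i2 : t.+1%:R * (mu - (\sum_(s < t.+1) arrived s) / t.+1%:R - delta) <=
    \sum_(s < t.+1) ordered s.
  have -> : t.+1%:R * (mu - (\sum_(s < t.+1) arrived s) / t.+1%:R - delta) =
      t.+1%:R * mu - \sum_(s < t.+1) arrived s - t.+1%:R * delta.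
    by field; rewrite gt_eqF.
  rewrite (ordered_sum iy iq).
  have a1 : \sum_(s < t) arrived s.+1 <= \sum_(s < t.+1) arrived s.
    rewrite big_ord_recl lerDr; exact: arrived_ge0.
  have y1 : - (delta / 2 * K%:R) <= Ex P (level f t.+1).
    rewrite lerNl; apply: le_trans mt; rewrite -ExN //.
    apply: Ex_le; [exact: itgN|exact: itg_abs|].
    by move=> w; rewrite -normrN ler_norm.
  have I1 := ler_norm (Ex P (fun w => inventory (initial_state Dt' Ghat w))).
  rewrite -/EI in I1.
  have kt : K%:R * delta <= t.+1%:R * delta by rewrite ler_wpM2r.
  move: y1 k3 I1 a1 kt; rewrite -[t.+1%:R]natr1; lra.
have o0 : 0 <= \sum_(s < t.+1) ordered s by apply: sumr_ge0 => s _; exact: ordered_ge0.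
split; last first.
  rewrite ler_pdivrMr // mulrC; apply: le_trans i1.
  by rewrite lerDr mulr_ge0 // ltW.
rewrite -(ler_pM2l tR); apply: le_trans i1.
rewrite mulrDr mulrCA; apply: lerD; first by rewrite ler_wpM2l // ltW.
by rewrite mulrC divfK // gt_eqF.
Qed.

End Horizon.

(** * Fluctuations of the demand that earlier orders cannot track *)

Section Oscillation.
Definition clip (a u : R) : R := Num.max (- a) (Num.min a u).

(** A ramp from 0 to 1 used as a smoothed indicator of low demand. Values in [[0, 1]] let it weight
    an inequality, and Lipschitz continuity lets it pass through the averaging operators. *)
Definition tilt (a u : R) : R := (1 + clip a u / a) / 2.

Lemma clip_nd a : {homo clip a : u v / u <= v}.
Proof.
move=> u v uv; rewrite /clip ge_max le_max lexx /= le_max; apply/orP; right.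
by rewrite le_min ge_min lexx /= ge_min uv orbT.
Qed.

Lemma clip_id a u : `|u| <= a -> clip a u = u.
Proof.
rewrite ler_norml => /andP[h1 h2]; rewrite /clip (min_idPr h2).
exact/max_idPr.
Qed.

Lemma clip_abs a u : 0 <= a -> `|clip a u| <= a.
Proof.
move=> a0; rewrite ler_norml /clip le_max lexx /= ge_max.
by rewrite ge_min lexx /= andbT; lra.
Qed.

Lemma tilt_itv a u : 0 < a -> 0 <= tilt a u <= 1.
Proof.
move=> a0; have := clip_abs u (ltW a0); rewrite ler_norml => /andP[h1 h2].
have k1 : -1 <= clip a u / a by rewrite ler_pdivlMr // mulN1r.
have k2 : clip a u / a <= 1 by rewrite ler_pdivrMr // mul1r.
by rewrite /tilt; apply/andP; split; lra.
Qed.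

Lemma tilt_mfun a : measurable_fun setT (tilt a).
Proof.
apply: measurable_funM => //; apply: measurable_funD => //.
apply: measurable_funM => //; rewrite /clip.
by apply: measurable_maxr => //; apply: measurable_minr.
Qed.

(* A unit step raises [tilt] by [1 / 2a] inside the clipping range, and the
   quadratic term makes the bound trivial outside of it. *)
Lemma tilt_step a p u : 1 < a -> 0 <= p <= 1 ->
  (2 * a)^-1 * (1 - u ^+ 2 / (a - 1) ^+ 2) <= tilt a (u + (1 - p)) - tilt a (u - p).
Proof.
move=> a1 /andP[p0 p1]; have a0 : 0 < a by lra.
have am : 0 < a - 1 by lra.
have eE : tilt a (u + (1 - p)) - tilt a (u - p) =
    (2 * a)^-1 * (clip a (u + (1 - p)) - clip a (u - p)).
  by rewrite /tilt; field; rewrite gt_eqF.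
rewrite eE ler_wpM2l ?invr_ge0 ?mulr_ge0 ?(ltW a0) //.
case: (leP `|u| (a - 1)) => hu.
  have k1 : `|u + (1 - p)| <= a.
    apply: (le_trans (ler_normD _ _)); have : `|1 - p| <= 1 by rewrite ler_norml; apply/andP; split; lra.
    lra.
  have k2 : `|u - p| <= a.
    apply: (le_trans (ler_normB _ _)); have : `|p| <= 1 by rewrite ler_norml; apply/andP; split; lra.
    lra.
  rewrite !clip_id //.
  have : 0 <= u ^+ 2 / (a - 1) ^+ 2 by rewrite divr_ge0 ?sqr_ge0.
  lra.
have k1 : 1 <= u ^+ 2 / (a - 1) ^+ 2.
  rewrite ler_pdivlMr ?exprn_gt0 // mul1r -[u ^+ 2]real_normK ?num_real //.
  by rewrite !expr2; apply: ler_pM; exact: ltW.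
have k2 : clip a (u - p) <= clip a (u + (1 - p)) by apply: clip_nd; lra.
lra.
Qed.

Let below : R := Ex P (fun w => \1_(`]-oo, mu[%classic) (D w)).
(** A bounded centered substitute for [mu - x], needed because the latter may have infinite
    variance: the step is [1 - below] for a demand under the mean and [- below] otherwise. *)
Let sgn x : R := \1_(`]-oo, mu[%classic) x - below.
Let beta : R := Ex P (fun w => `|D w - mu|).

Let msgn : measurable_fun setT sgn.
Proof.
apply: measurable_funB; last exact: measurable_cst.
by apply: measurable_indic; exact: measurable_itv.
Qed.

Let ind01 x : 0 <= (\1_(`]-oo, mu[%classic) x : R) <= 1.
Proof. by rewrite indicE; case: (_ \in _); rewrite /= ?ler01 ?lexx. Qed.

Let iind : itg P (fun w => \1_(`]-oo, mu[%classic) (D w) : R).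
Proof.
apply: (@itg_bounded _ _ _ P _ 1).
  by apply: (measurableT_comp _ mD); apply: measurable_indic; exact: measurable_itv.
by move=> w; have /andP[i0 i1] := ind01 (D w); rewrite ger0_norm.
Qed.

Let below01 : 0 <= below <= 1.
Proof.
apply/andP; split; first by apply: Ex_ge0 => w; case/andP: (ind01 (D w)).
by apply: Ex_le_cst => // w; case/andP: (ind01 (D w)).
Qed.

Let sgn_abs x : `|sgn x| <= 1.
Proof.
have /andP[b1 b2] := below01; have /andP[i1 i2] := ind01 x.
by rewrite /sgn ler_norml; apply/andP; split; lra.
Qed.

Let isgnD : itg P (fun w => sgn (D w)).
Proof. by apply: itgB => //; exact: itg_cst. Qed.

Let Ex_sgn : Ex P (fun w => sgn (D w)) = 0.
Proof. by rewrite /sgn ExB // ?Ex_cst ?subrr //; exact: itg_cst. Qed.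

Let isgn t : itg P (fun w => sgn (Dt t w)).
Proof. by apply: (@itg_bounded _ _ _ P _ 1) => //; exact: measurableT_comp. Qed.

(** The parts of [mu - D] on the two sides of the mean integrate to [beta / 2] and [- beta / 2]. *)
Let Ex_centered (g1 g2 : R) :
  Ex P (fun w => (mu - D w) * (if D w < mu then g1 else g2)) = beta / 2 * (g1 - g2).
Proof.
have eE w : (mu - D w) * (if D w < mu then g1 else g2) =
    (g1 - g2) / 2 * `|D w - mu| + (g1 + g2) / 2 * (mu - D w).
  rewrite distrC; case: ltP => hD.
    by rewrite ger0_norm ?subr_ge0 ?ltW //; lra.
  by rewrite ler0_norm ?subr_le0 //; lra.
have i1 : itg P (fun w => `|D w - mu|) by apply: itg_abs; apply: itgB => //; exact: itg_cst.
have i2 : itg P (fun w => mu - D w) by exact: itg_walk.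
under eq_Ex do rewrite eE.
rewrite ExD; [|exact: itgZl..].
by rewrite !ExZl // ExB ?Ex_cst ?subrr //; [rewrite /beta; lra|exact: itg_cst].
Qed.

Section Fluctuation.
Variables (t0 k : nat).
Hypothesis k0 : (0 < k)%N.

(* Wide enough for the quadratic error in [tilt_step] to average at most 1/4. *)
Let a : R := 3 * Num.sqrt k%:R.
Let kR : 1 <= k%:R :> R. Proof. by rewrite ler1n. Qed.
Let sk : 1 <= Num.sqrt k%:R :> R.
Proof. by have := ler_wsqrtr kR; rewrite sqrtr1. Qed.
Let a1 : 1 < a. Proof. rewrite /a; have := sk; lra. Qed.
Let a0 : 0 < a. Proof. have := a1; lra. Qed.

Let sg i w := sgn (Dt (t0 + i)%N%:Z w).

Definition clipped_walk w : R := tilt a (\sum_(i < k) sg i w).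

Let msg i : measurable_fun setT (sg i).
Proof. exact: measurableT_comp. Qed.

Lemma clipped_walk_mfun : measurable_fun setT clipped_walk.
Proof. by apply: (measurableT_comp (tilt_mfun a)); exact: measurable_sum. Qed.

Lemma clipped_walk_itv w : 0 <= clipped_walk w <= 1.
Proof. exact: tilt_itv. Qed.

Let sg_uncorrelated i j : i != j -> Ex P (fun w => sg i w * sg j w) = 0.
Proof.
move=> ij.
pose J : set (int + int + unit) := [set demand_index (t0 + i)].
have nJ : ~ J (demand_index (t0 + j)).
  by rewrite /J /= => -[] /eqP; rewrite eqn_add2l eq_sym (negbTE ij).
have mF : measurable_fun setT
    (fun p : known X J * R => sg i p.1 * sgn p.2 : R).
  apply: measurable_funM; last exact: measurableT_comp.
  have aD : measurable_fun setT (Dt (t0 + i)%N%:Z : known X J -> R).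
    exact: (@known_var _ _ _ _ X J (demand_index (t0 + i))).
  have aS : measurable_fun setT (sg i : known X J -> R) by exact: (measurableT_comp msgn aD).
  exact: (measurableT_comp aS).
have iF : itg P (fun w => sg i w * sgn (X (demand_index (t0 + j)) w)).
  by apply: (itgM_bounded (isgn _) _ (fun w => sgn_abs _)); exact: msg.
have [_ e] := known_decouple mX indep nJ mD (lawDt _) mF iF.
rewrite /= in e; rewrite {2}/sg e -[RHS](Ex_cst P); apply: eq_Ex => w.
by rewrite ExZl // Ex_sgn mulr0.
Qed.

Let rest i w := \sum_(j < k | j != i) sg j w.

(** The steps are centered, uncorrelated and bounded by 1, so only the diagonal of the squared sum
    survives. *)
Let rest_sqr (i : 'I_k) : itg P (fun w => rest i w ^+ 2) /\
  Ex P (fun w => rest i w ^+ 2) <= k%:R.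
Proof.
have ip j j' : itg P (fun w => sg j w * sg j' w).
  by apply: (itgM_bounded (isgn _) _ (fun w => sgn_abs _)); exact: msg.
have eE w : rest i w ^+ 2 = \sum_(j < k) \sum_(j' < k)
    (((j != i) && (j' != i))%:R * (sg j w * sg j' w)).
  rewrite expr2 /rest mulr_suml big_mkcond /=; apply: eq_bigr => j _.
  case: eqP => ji /=; first by rewrite big1 // => j' _; rewrite mul0r.
  rewrite mulr_sumr big_mkcond /=; apply: eq_bigr => j' _.
  by case: eqP => _ /=; rewrite ?mul0r ?mul1r.
have iS j : itg P (fun w => \sum_(j' < k) (((j != i) && (j' != i))%:R * (sg j w * sg j' w))).
  by apply: itg_sum => j' _; exact: itgZl.
split; first by under eq_fun do rewrite eE; apply: itg_sum => j _.
under eq_Ex do rewrite eE.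
rewrite Ex_sum; last by move=> j _; exact: iS.
apply: (@le_trans _ _ (\sum_(j < k) 1)); last by rewrite sumr_const card_ord.
apply: ler_sum => j _; rewrite Ex_sum; last by move=> j' _; exact: itgZl.
rewrite (bigD1 j) //= big1 ?addr0; last first.
  move=> j' j'j; rewrite ExZl // sg_uncorrelated ?mulr0 // eq_sym.
  by apply: contra_neq j'j => /val_inj.
rewrite ExZl //.
have h1 : Ex P (fun w => sg j w * sg j w) <= 1.
  apply: Ex_le_cst => // w; apply: (le_trans (ler_norm _)).
  by rewrite normrM; apply: mulr_ile1 => //; exact: sgn_abs.
have h2 : 0 <= Ex P (fun w => sg j w * sg j w).
  by apply: Ex_ge0 => w; rewrite -expr2 sqr_ge0.
by case: (_ && _); rewrite ?mul1r ?mul0r.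
Qed.

(** With all other demands frozen, the expectation is [beta / 2] times the rise of [tilt] over a
    unit step. By [tilt_step] and the second moment of the remaining sum, this rise is on average at
    least three quarters of [1 / (2 * a)]. *)
Let term_lower (i : 'I_k) : beta / (16 * Num.sqrt k%:R) <=
  Ex P (fun w => (mu - Dt (t0 + i)%N%:Z w) * clipped_walk w).
Proof.
pose J : set (int + int + unit) := [set j | j <> demand_index (t0 + i)].
have nJ : ~ J (demand_index (t0 + i)) by apply.
have aR : measurable_fun setT (rest i : known X J -> R).
  rewrite /rest; under eq_fun do rewrite big_mkcond /=.
  apply: measurable_sum => j; case: eqP => ji //=.
  have aD : measurable_fun setT (Dt (t0 + j)%N%:Z : known X J -> R).
    apply: (@known_var _ _ _ _ X J (demand_index (t0 + j))) => -[] /eqP.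
    by rewrite eqn_add2l => /eqP /val_inj.
  exact: (measurableT_comp msgn aD).
have mF : measurable_fun setT
    (fun p : known X J * R => (mu - p.2) * tilt a (rest i p.1 + sgn p.2)).
  apply: measurable_funM; first exact: measurable_funB.
  apply: (measurableT_comp (tilt_mfun a)); apply: measurable_funD.
    exact: (measurableT_comp aR).
  exact: (measurableT_comp msgn).
have splitE w : \sum_(j < k) sg j w = rest i w + sgn (Dt (t0 + i)%N%:Z w).
  by rewrite (bigD1 i) //= addrC.
have iDt : itg P (fun w => mu - Dt (t0 + i)%N%:Z w).
  by apply: itgB; [exact: itg_cst|exact: (itg_Dt)].
have iF : itg P (fun w => (mu - X (demand_index (t0 + i)) w) *
    tilt a (rest i w + sgn (X (demand_index (t0 + i)) w))).
  apply: (itgM_bounded (a := 1) iDt).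
    apply: (measurableT_comp (tilt_mfun a)); apply: measurable_funD => //.
      by apply: (@known_mfun _ _ _ _ _ mX J).
    exact: msg.
  by move=> w; have /andP[h1 h2] := tilt_itv (rest i w + sgn (Dt (t0 + i)%N%:Z w)) a0;
    rewrite ger0_norm.
have [iE eE] := known_decouple mX indep nJ mD (lawDt _) mF iF.
rewrite (@eq_Ex _ _ _ P _ (fun w => (mu - X (demand_index (t0 + i)) w) *
    tilt a (rest i w + sgn (X (demand_index (t0 + i)) w)))); last first.
  by move=> w; rewrite /clipped_walk splitE.
rewrite eE.
have inner w : Ex P (fun w' => (mu - D w') * tilt a (rest i w + sgn (D w'))) =
    beta / 2 * (tilt a (rest i w + (1 - below)) - tilt a (rest i w - below)).
  rewrite -Ex_centered; apply: eq_Ex => w'; congr (_ * _).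
  rewrite /sgn indicE; case: ltP => hD.
    by rewrite mem_set //= in_itv.
  by rewrite memNset /= ?sub0r // in_itv /=; apply/negP; rewrite -leNgt.
have beta0 : 0 <= beta by exact: Ex_ge0.
have [iR ER] := rest_sqr i.
have am : 0 < (a - 1) ^+ 2 by rewrite exprn_gt0 // subr_gt0.
apply: (@le_trans _ _ (Ex P (fun w => beta / 2 * ((2 * a)^-1 *
   (1 - rest i w ^+ 2 / (a - 1) ^+ 2))))); last first.
  apply: Ex_le => //.
    apply: itgZl; apply: itgZl; apply: itgB; first exact: itg_cst.
    exact: itgZr.
  move=> w /=; rewrite inner; apply: ler_wpM2l; first by rewrite divr_ge0.
  exact: tilt_step.
have i1 : itg P (fun w => rest i w ^+ 2 / (a - 1) ^+ 2) by exact: itgZr.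
have i2 : itg P (fun w => 1 - rest i w ^+ 2 / (a - 1) ^+ 2).
  by apply: itgB => //; exact: itg_cst.
rewrite ExZl; last exact: itgZl.
rewrite ExZl // ExB // ?Ex_cst; last exact: itg_cst.
rewrite ExZr //.
have sq : Num.sqrt k%:R ^+ 2 = k%:R :> R by rewrite sqr_sqrtr.
(* [a - 1 >= 2 * sqrt k] because [a = 3 * sqrt k] and [sqrt k >= 1]. *)
have q1 : Ex P (fun w => rest i w ^+ 2) / (a - 1) ^+ 2 <= 4^-1.
  rewrite ler_pdivrMr // (le_trans ER) // -sq.
  have := sk; rewrite /a; nra.
have s0 : 0 < Num.sqrt k%:R :> R by have := sk; lra.
have -> : beta / (16 * Num.sqrt k%:R) = beta / 2 * ((2 * a)^-1 * (3 / 4)).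
  by rewrite /a; field; rewrite gt_eqF.
rewrite ler_wpM2l ?divr_ge0 // ler_wpM2l ?invr_ge0 ?mulr_ge0 ?(ltW a0) //; lra.
Qed.

Lemma fluctuation_lower : Num.sqrt k%:R * beta / 16 <=
  Ex P (fun w => (\sum_(i < k) (mu - Dt (t0 + i)%N%:Z w)) * clipped_walk w).
Proof.
under eq_Ex do rewrite mulr_suml.
rewrite Ex_sum; last first.
  move=> i _; apply: (itgM_bounded (a := 1)).
  - by apply: itgB; [exact: itg_cst|exact: (itg_Dt)].
  - exact: clipped_walk_mfun.
  - by move=> w; have /andP[h1 h2] := clipped_walk_itv w; rewrite ger0_norm.
apply: (@le_trans _ _ (\sum_(i < k) beta / (16 * Num.sqrt k%:R))); last exact: ler_sum.
have -> : \sum_(i < k) beta / (16 * Num.sqrt k%:R) = k%:R * (beta / (16 * Num.sqrt k%:R)).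
  by rewrite sumr_const card_ord [k%:R * _]mulr_natl.
have s0 : 0 < Num.sqrt k%:R :> R by have := sk; lra.
have sq : k%:R = Num.sqrt k%:R ^+ 2 :> R by rewrite sqr_sqrtr.
rewrite [X in X * (beta / _)]sq le_eqVlt; apply/orP; left; apply/eqP.
by field; rewrite gt_eqF.
Qed.

Let add_step (g : R -> R) u : R := Ex P (fun w => g (u + sgn (D w))).

Let add_step_lip C g : lip C g -> lip C (add_step g).
Proof.
move=> lg u v; rewrite /add_step.
have i x : itg P (fun w => g (x + sgn (D w))).
  by apply: (itg_lip lg); apply: itgD => //; exact: itg_cst.
rewrite -ExB //; have iB := itgB (i u) (i v).
apply: (le_trans (Ex_abs iB)); apply: Ex_le_cst; first exact: itg_abs.
by move=> w; apply: (le_trans (lg _ _)); rewrite opprD addrACA subrr addr0.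
Qed.

Let factor (Z : T -> R) C j (g : R -> R) : lip C g -> adapted X past t0 Z ->
  itg P Z -> (forall u, `|g u| <= 1) ->
  Ex P (fun w => Z w * g (\sum_(i < j) sg i w)) = Ex P Z * iter j add_step g 0.
Proof.
move=> + aZ iZ; elim: j g => [|j IH] g lg g1.
  by under eq_Ex do rewrite big_ord0; rewrite ExZr.
under eq_Ex do rewrite big_ord_recr /=.
have aS : adapted X past (t0 + j) (fun w => \sum_(i < j) sg i w).
  apply: measurable_sum => i; apply: (measurableT_comp msgn).
  apply: (@adapted_le _ _ _ _ X past past_mono (t0 + i).+1).
    by rewrite -addnS leq_add2l.
  exact: (@known_var _ _ _ _ X (past (t0 + i).+1) (demand_index (t0 + i)) (@past_demand _)).
have aZ' : adapted X past (t0 + j) Z.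
  exact: (adapted_le past_mono (leq_addr j t0) aZ).
have mF : measurable_fun setT
    (fun p : known X (past (t0 + j)) * R => Z p.1 * g (\sum_(i < j) sg i p.1 + sgn p.2)).
  apply: measurable_funM; first exact: (measurableT_comp aZ').
  apply: (measurableT_comp (lip_mfun lg)); apply: measurable_funD.
    exact: (measurableT_comp aS).
  exact: (measurableT_comp msgn).
have iF : itg P (fun w => Z w * g (\sum_(i < j) sg i w + sgn (X (demand_index (t0 + j)) w))).
  apply: (itgM_bounded iZ (a := 1)) => //.
  apply: (measurableT_comp (lip_mfun lg)); apply: measurable_funD; last exact: msg.
  exact: measurable_sum.
have [_ eE] := known_decouple mX indep (@past_fresh (t0 + j)) mD (lawDt _) mF iF.
rewrite (_ : Ex P _ = Ex P (fun w => Z w * add_step g (\sum_(i < j) sg i w))); last first.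
  rewrite eE; apply: eq_Ex => w /=; rewrite ExZl //.
  by apply: (itg_lip lg); apply: itgD => //; exact: itg_cst.
rewrite IH -?iterSr //; first exact: add_step_lip lg.
move=> u; have i1 : itg P (fun w => g (u + sgn (D w))).
  by apply: (itg_lip lg); apply: itgD => //; exact: itg_cst.
apply: (le_trans (Ex_abs i1)); apply: Ex_le_cst => //; exact: itg_abs.
Qed.

Let tilt_lip : lip (2 * a)^-1 (tilt a).
Proof.
move=> u v; rewrite /tilt -mulrBl.
have -> : 1 + clip a u / a - (1 + clip a v / a) = (clip a u - clip a v) / a by ring.
rewrite -mulrA -invfM mulrC normrM [a * 2]mulrC ger0_norm; last first.
  by rewrite invr_ge0 mulr_ge0 // ltW.
rewrite ler_wpM2l ?invr_ge0 ?mulr_ge0 ?(ltW a0) // /clip.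
have h1 := lip_max (- a) (Num.min a u) (Num.min a v); rewrite mul1r in h1.
apply: (le_trans h1); rewrite ler_norml.
by case: (leP a u) => au; case: (leP a v) => av; apply/andP; split;
  case: (ger0P (u - v)) => huv; lra.
Qed.

(** Anything known at [t0], in particular the arrivals of the coming window, is independent of the
    weight built on later demands. The common factor does not depend on [t0]. *)
Lemma clipped_walk_indep (Z : T -> R) : adapted X past t0 Z -> itg P Z ->
  Ex P (fun w => Z w * clipped_walk w) = Ex P Z * iter k add_step (tilt a) 0.
Proof.
move=> aZ iZ; apply: (factor k tilt_lip aZ iZ) => u.
by have /andP[h1 h2] := tilt_itv u a0; rewrite ger0_norm.
Qed.

Definition clipped_mean : R := iter k add_step (tilt a) 0.

Lemma clipped_mean_itv : 0 <= clipped_mean <= 1.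
Proof.
have ac : adapted X past t0 (fun=> 1) by exact: measurable_cst.
have := clipped_walk_indep ac (itg_cst P 1).
rewrite Ex_cst mul1r -/clipped_mean => <-.
have i : itg P (fun w => 1 * clipped_walk w).
  apply: (itgM_bounded (itg_cst P 1) clipped_walk_mfun (a := 1)) => w.
  by have /andP[h1 h2] := clipped_walk_itv w; rewrite ger0_norm.
apply/andP; split.
  by apply: Ex_ge_cst => // w; rewrite mul1r; case/andP: (clipped_walk_itv w).
by apply: Ex_le_cst => // w; rewrite mul1r; case/andP: (clipped_walk_itv w).
Qed.

End Fluctuation.

End Oscillation.

(** * Holding cost when regular supply nearly matches mean demand *)

Section NearCritical.
Variable f : @policy R L0 L.
Hypothesis af : admissible f.

Local Notation y := (level f).
Local Notation q := (placed_express f).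
Local Notation arr := (arriving f).
Local Notation holding := (holding f).
Local Notation arrived := (arrived f).
Local Notation magnitude := (magnitude f).
Local Notation beta := (Ex P (fun w => `|D w - mu|)).

Hypothesis iy : forall t, itg P (y t.+1).
Hypothesis iq : forall t, itg P (q t.+1).

Lemma level_increase t k w : \sum_(j < k) arr (t.+1 + j.+1)%N w
  - \sum_(i < k) Dt (t.+1 + i)%N%:Z w <= y (t.+1 + k)%N w - y t.+1 w.
Proof.
elim: k => [|k IH]; first by rewrite !big_ord0 addn0 !subrr.
have e : (t.+1 + k.+1 = (t + k).+2)%N by clear; lia.
rewrite !big_ord_recr e levelS //.
have := placed_express_ge0 Dt Dt' Ghat af (t + k).+2 w.
move: IH; rewrite /= !addSn; lra.
Qed.

(** The rise of the level over [k] periods, weighted by the clipped walk, is at most the sum of the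
    two end magnitudes. The demand part contributes the fluctuation; the arrivals, independent of
    the weight, take back at most [k * e] on average, as the mean weight lies in [[0, 1]]. *)
Lemma near_critical N r B k e : (0 < N)%N -> (n <= N)%N ->
  r = (\sum_(t < N) arrived t) / N%:R ->
  B = (\sum_(t < N + n) holding t) / N%:R ->
  (0 < k <= n)%N -> 0 <= e -> mu - r <= e ->
  Num.sqrt k%:R * beta / 16 - k%:R * e <= 2 * (B / mn + 2 * nu).
Proof.
move=> N0 nN rE BE /andP[k0 kn] e0 re.
have NR0 : 0 < N%:R :> R by rewrite ltr0n.
pose chi t := clipped_walk t.+1 k.
pose cm := clipped_mean k.
have mchi t : measurable_fun setT (chi t) by exact: clipped_walk_mfun.
have chi_itv t w : 0 <= chi t w <= 1 by exact: clipped_walk_itv.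
have /andP[cm0 cm1] : 0 <= cm <= 1 by exact: (clipped_mean_itv 0%N k0).
have step (t : 'I_N) : cm * (\sum_(j < k) (arrived (t + j.+1)%N - mu))
    + Num.sqrt k%:R * beta / 16 <= magnitude (t + k)%N + magnitude t.
  have iarr j : itg P (arr (t.+1 + j.+1)%N).
    by rewrite addSn; exact: (itg_arriving iy iq).
  have iam j : itg P (fun w => arr (t.+1 + j.+1)%N w - mu).
    by apply: itgB => //; exact: itg_cst.
  have ia : itg P (fun w => \sum_(j < k) (arr (t.+1 + j.+1)%N w - mu)).
    by apply: itg_sum.
  have iDm : itg P (fun w => \sum_(i < k) (mu - Dt (t.+1 + i)%N%:Z w)).
    apply: itg_sum => i _; apply: itgB; first exact: itg_cst.
    exact: (itg_Dt).
  have bnd w : `|chi t w| <= 1 by have /andP[h1 h2] := chi_itv t w; rewrite ger0_norm.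
  have i1 := itgM_bounded ia (mchi t) bnd.
  have i2 := itgM_bounded iDm (mchi t) bnd.
  have eA : Ex P (fun w => (\sum_(j < k) (arr (t.+1 + j.+1)%N w - mu)) * chi t w) =
      cm * (\sum_(j < k) (arrived (t + j.+1)%N - mu)).
    have aA : adapted X past t.+1 (fun w => \sum_(j < k) (arr (t.+1 + j.+1)%N w - mu)).
      rewrite (_ : (fun w => _) = fun w => \sum_(j <- index_enum 'I_k) (if (j < k)%N then arr (t.+1 + j.+1)%N w - mu else 0)); last first.
        by apply/funext => w; apply: eq_bigr => j _; rewrite ltn_ord.
      apply: measurable_sum => j; rewrite ltn_ord.
      apply: measurable_funB => //; apply: (arriving_adapted L0L af).
      exact: leq_trans (ltn_ord j) kn.
    rewrite (clipped_walk_indep k0 aA ia) mulrC; congr (_ * _).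
    rewrite Ex_sum //; apply: eq_bigr => j _.
    by rewrite ExB ?Ex_cst //; exact: itg_cst.
  have fl := fluctuation_lower t.+1 k0.
  rewrite -eA; apply: (le_trans (lerD (lexx _) fl)).
  rewrite -ExD // /magnitude -ExD; last 2 first.
  - by apply: itg_abs; exact: iy.
  - by apply: itg_abs; exact: iy.
  apply: Ex_le => [||w].
  - exact: itgD.
  - by apply: itgD; apply: itg_abs; exact: iy.
  rewrite -/(chi t w) -mulrDl.
  have /andP[c0' c1'] := chi_itv t w.
  have := level_increase t k w.
  have -> : \sum_(j < k) (arr (t.+1 + j.+1)%N w - mu) + \sum_(i < k) (mu - Dt (t.+1 + i)%N%:Z w)
    = \sum_(j < k) arr (t.+1 + j.+1)%N w - \sum_(i < k) Dt (t.+1 + i)%N%:Z w.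
    by rewrite -big_split -sumrB; apply: eq_bigr => j _ /=; ring.
  rewrite addSn; set v := _ - _; move=> hv.
  have h1 := ler_norm (y (t + k).+1 w); have h2 := ler_norm (- y t.+1 w).
  rewrite normrN in h2.
  have n1 := normr_ge0 (y (t + k).+1 w); have n2 := normr_ge0 (y t.+1 w).
  case: (leP 0 v) => v0.
    by apply: (@le_trans _ _ v); [rewrite ler_piMr|lra].
  by apply: (@le_trans _ _ 0); [rewrite nmulr_rle0|lra].
have := ler_sum (index_enum 'I_N) (fun t (_ : xpredT t) => step t).
rewrite !big_split /= sumr_const card_ord -mulr_sumr exchange_big /=.
rewrite -[(_ / 16) *+ N]mulr_natl => tot.
have h1 : - (N%:R * (k%:R * e)) <= cm * \sum_(j < k) \sum_(t < N) (arrived (t + j.+1)%N - mu).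
  apply: (@le_trans _ _ (cm * \sum_(j < k) (- (N%:R * e)))); last first.
    rewrite ler_wpM2l //; apply: ler_sum => j _.
    rewrite sumrB sumr_const card_ord -[mu *+ N]mulr_natl.
    have sh := arrived_shift af N (leq_trans (ltn_ord j) kn).
    have eN : \sum_(t < N) arrived t = N%:R * r by rewrite rE mulrC divfK // gt_eqF.
    rewrite eN in sh; have := ler_wpM2l (ltW NR0) re; lra.
  rewrite sumr_const card_ord -[(- _) *+ k]mulr_natl.
  have p : 0 <= N%:R * (k%:R * e) by rewrite !mulr_ge0 // ltW.
  have := ler_wpM2r p cm1; lra.
have h2 := magnitude_sum iy N0 nN BE.
have mag0 t : 0 <= magnitude t by exact: magnitude_ge0.
have h3 := shifted_sum_le N mag0 kn.
have h4 : \sum_(t < N) magnitude t <= \sum_(t < N + n) magnitude t.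
  by rewrite [leRHS]big_split_ord /= lerDl; exact: sumr_ge0.
rewrite -(ler_pM2l NR0).
move: tot h1 h2 h3 h4; lra.
Qed.

End NearCritical.

(** * Estimates for the explicit constants *)

Hypothesis var0 : (0 < 'V_P[D])%E.

Local Notation g := (g_const P h b L0 Dt').
Local Notation U := (U_const P c h b L0 D Dt').
Local Notation e0 := (eps0 P c h b L0 D Dt').
Local Notation K0 := (U0 P h b L0 D * 2 ^+ L0).

Let dev0 := mean_dev_gt0 iD var0.
Lemma expected_newsvendor_lead x : expected_newsvendor_cost P h b L0 Dt' x = lead x.
Proof.
rewrite /expected_newsvendor_cost fine_expectation.
have a : adapted X past' 1 (fun=> x) by exact: measurable_cst.
have e := lead_iter mX indep iD past'_mono past'_demand past'_fresh
  (fun t => lawDt' t%:Z) L0.+1 (newsvendor_lip h0 b0) a (itg_cst P x).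
rewrite /lead_cost -[RHS](Ex_cst P) -e.
apply: eq_Ex => w; congr (newsvendor_cost _ _ (_ - _)).
by rewrite big_add1 big_mkord.
Qed.

Lemma g_const_le x : g <= lead x.
Proof.
rewrite -expected_newsvendor_lead; apply: ge_inf; last by exists x.
exists 0 => _ [y _ <-]; rewrite expected_newsvendor_lead; exact: lead_ge0.
Qed.

(** Already one random demand forces a mean cost of [mn * eta0] at any position, and averaging over
    further demands preserves a uniform lower bound. *)
Lemma g_const_gt0 : 0 < g.
Proof.
apply: (@lt_le_trans _ _ (mn * eta0 P D)); first by rewrite mulr_gt0 // eta0_gt0.
apply: lb_le_inf; first by exists (expected_newsvendor_cost P h b L0 Dt' 0); exists 0.
move=> _ [x _ <-]; rewrite expected_newsvendor_lead.
elim: L0 x => [|j IH] x.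
  apply: (@le_trans _ _ (mn * Ex P (fun w => `|x - D w|))).
    by rewrite ler_wpM2l ?(ltW mn0) //; exact: eta0_le.
  have ix : itg P (fun w => x - D w) by apply: itgB => //; exact: itg_cst.
  rewrite -ExZl; last exact: itg_abs.
  apply: Ex_le; [exact/itgZl/itg_abs|exact: itg_demand_step (newsvendor_lip h0 b0)|].
  by move=> w; exact: newsvendor_ge_mn.
change (mn * eta0 P D <= Ex P (fun w => lead_cost P D h b j.+1 (x - D w))).
apply: Ex_ge_cst => //.
exact: itg_demand_step (lead_lip iD h0 b0 _).
Qed.

Lemma lead_at0 : lead 0 = b * nu.
Proof. by rewrite (lead_neg iD D0 h b L0.+1 (lexx 0)) subr0. Qed.

Lemma U_constE : U = c * mu + b * nu.
Proof. by rewrite /U_const mean_Ex expected_newsvendor_lead lead_at0. Qed.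

Lemma nu_ge : eta0 P D <= nu.
Proof.
apply: le_trans (eta0_le_mean P D0) _.
by rewrite ler_peMl ?ler1n // Ex_ge0.
Qed.

Lemma K0_ge : 64 * (m * (m / mn) * nu) <= K0.
Proof.
have e : 64 * (m * (m / mn) * nu) = U0 P h b L0 D.
  by rewrite /U0 mean_Ex -[L0.+1%:R]natr1; field; rewrite gt_eqF.
rewrite e ler_peMr ?exprn_ege1 // ?ler1n // -e.
by rewrite !mulr_ge0 ?invr_ge0 ?Ex_ge0 ?(ltW mn0) ?(ltW m0).
Qed.

Lemma U_const_ge0 : 0 <= U.
Proof. by rewrite U_constE addr_ge0 // !mulr_ge0 ?Ex_ge0 // ltW. Qed.

Local Notation total := (K0 + eta0 P D + U + 1).

Lemma K0_gt0 : 0 < K0.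
Proof.
apply: lt_le_trans K0_ge; rewrite !mulr_gt0 ?invr_gt0 //.
exact: mean_gt0 iD D0 dev0.
Qed.

Lemma total_ge1 : 1 <= total.
Proof.
have k1 := K0_gt0; have k2 := U_const_ge0; have k3 := eta0_gt0 iD dev0.
rewrite -subr_ge0; have -> : total - 1 = K0 + eta0 P D + U by ring.
by apply: addr_ge0 => //; apply: addr_ge0; exact: ltW.
Qed.

Let c0_gt0 : 0 < Defs.c0 P h b D.
Proof.
rewrite /Defs.c0; apply: mulr_gt0; last exact: eta0_gt0.
apply: mulr_gt0; last exact: p0_hat_gt0.
by apply: mulr_gt0; [rewrite invr_gt0 ltr0n|exact: mn0].
Qed.

Lemma eps0_gt0 : 0 < e0.
Proof.
rewrite /eps0 !lt_min; apply/and4P; split.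
- by rewrite subr_gt0 mean_Ex; exact: Q0_lt_mean.
- by rewrite mulr_gt0 // exprn_gt0 // mulr_gt0 //; [exact: eta0_gt0|exact: p0_hat_gt0].
- rewrite subr_gt0; apply: powR2N_lt1.
  by apply: divr_gt0; [apply: exprn_gt0; exact: p0_hat_gt0|rewrite ltr0n].
- apply: mulr_gt0; last first.
    by rewrite invr_gt0; apply: exprn_gt0; apply: lt_le_trans total_ge1; exact: ltr01.
  by apply: mulr_gt0; [rewrite invr_gt0 ltr0n|apply: exprn_gt0; exact: c0_gt0].
Qed.

Lemma eps0_le_eta0 : e0 <= 4^-1 * eta0 P D ^+ 2.
Proof.
apply: (@le_trans _ _ (4^-1 * (eta0 P D * p0_hat P D) ^+ 2)).
  by rewrite /eps0 ge_min; apply/orP; right; rewrite ge_min lexx.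
have p1 := p0_hat_le1 iD dev0; have p2 := p0_hat_gt0 iD dev0.
rewrite ler_wpM2l // exprMn ler_piMr ?sqr_ge0 //.
by rewrite expr_le1 // ltW.
Qed.

(** The last entry of the minimum defining [eps0], with [6000 = 25 * 240], from [625 = 25 ^ 2] and
    the 240 in [c0]; the factor [p0_hat <= 1] is dropped. *)
Lemma eps0_le_total : e0 * (6000 * total) ^+ 2 <= (mn * eta0 P D) ^+ 2.
Proof.
have t1 := total_ge1; have t0 : 0 < total by exact: lt_le_trans t1.
have p1 := p0_hat_le1 iD dev0; have p2 := p0_hat_gt0 iD dev0.
have k3 := eta0_gt0 iD dev0.
apply: (@le_trans _ _ ((625^-1 * Defs.c0 P h b D ^+ 2 * total ^- 2) * (6000 * total) ^+ 2)).
  rewrite ler_wpM2r ?sqr_ge0 //.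
  by rewrite /eps0 ge_min; apply/orP; right; rewrite ge_min; apply/orP; right; rewrite ge_min lexx orbT.
have -> : 625^-1 * Defs.c0 P h b D ^+ 2 * total ^- 2 * (6000 * total) ^+ 2 =
  (mn * eta0 P D) ^+ 2 * p0_hat P D ^+ 2.
  by rewrite /Defs.c0; field; rewrite gt_eqF.
by rewrite ler_piMr ?sqr_ge0 // expr_le1 // ltW.
Qed.

(** [total] contains [K0], which exceeds [64 * (m / mn) ^+ 2 * (mn * eta0)], so the previous bound
    already caps [eps0] by the squared inverse of [32 * (m / mn)]. *)
Lemma eps0_small : e0 * (32 * (m / mn)) ^+ 2 <= 1.
Proof.
have k0 := K0_ge; have t1 := total_ge1; have k3 := eta0_gt0 iD dev0.
have kU := U_const_ge0; have kn := nu_ge; have ke := eps0_gt0.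
set ra := m / mn in k0 *.
have r1 : 1 <= ra by exact: ra1.
have tt : 64 * (m * ra * eta0 P D) <= total.
  have : 64 * (m * ra * eta0 P D) <= K0.
    by apply: le_trans k0; rewrite ler_wpM2l // ler_wpM2l // mulr_ge0 ?(ltW m0) //; lra.
  lra.
have mE : m = ra * mn by rewrite /ra divfK // gt_eqF.
have q0 : 0 < mn * eta0 P D by rewrite mulr_gt0.
have h0' : ra * (mn * eta0 P D) <= ra * (ra * (mn * eta0 P D)).
  apply: ler_wpM2l; first exact: le_trans r1.
  by rewrite ler_peMl // ltW.
have h1 : 32 * ra * (mn * eta0 P D) <= 6000 * total.
  have tt' : 64 * (ra * (ra * (mn * eta0 P D))) <= total.
    by have -> : ra * (ra * (mn * eta0 P D)) = (ra * mn) * ra * eta0 P D; [ring|rewrite -mE].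
  have := mulr_ge0 (le_trans ler01 r1) (ltW q0).
  move: tt' h0'; rewrite -mulrA; set u := ra * (mn * _); set v := ra * u; lra.
have h4 : 0 <= 32 * ra * (mn * eta0 P D).
  apply: mulr_ge0; last exact: ltW.
  by apply: mulr_ge0; [exact: ler0n|exact: le_trans r1].
have h2 := eps0_le_total.
rewrite -(ler_pM2r (exprn_gt0 2 q0)) mul1r -mulrA -exprMn; move: h1 h4 h2.
set u := 32 * ra * _; set v := 6000 * total => h1 h4; apply: le_trans.
apply: ler_wpM2l; first exact: ltW.
by rewrite lerXn2r ?nnegrE //; exact: le_trans h1.
Qed.

(** * Average arrivals below the mean demand by a margin *)

Section Subcritical.
Variable f : @policy R L0 L.
Hypothesis af : admissible f.
Local Notation holding := (holding f).
Local Notation arrived := (arrived f).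
Hypothesis iy : forall t, itg P (level f t.+1).
Hypothesis iq : forall t, itg P (placed_express f t.+1).
Variables (N : nat) (r B : R).
Hypotheses (N0 : (0 < N)%N) (nN : (n <= N)%N).
Hypothesis rE : r = (\sum_(t < N) arrived t) / N%:R.
Hypothesis BE : B = (\sum_(t < N + n) holding t) / N%:R.
Variables (theta gam : R).
Hypotheses (theta0 : 0 < theta) (gam0 : 0 <= gam) (gam1 : gam < 1)
  (mgf : Ex P (fun w => expR (theta * (r - D w))) <= gam).
Variable V : R.
Hypothesis HV : forall k S, V <= c * (mu - r) +
  (iter k (lindley P D r) (fun x => lead (S + x)) 0 + m / theta * gam ^+ k.+1 / (1 - gam)).
Variables (x K0 K2 : R).
Hypothesis mu_gt0 : 0 < mu.
Hypotheses (xn : x ^+ 2 = n%:R) (x32 : 32 <= x) (xra : 32 * (m / mn) <= x).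
Hypotheses (K20 : 0 <= K2) (K0m : 64 * (m * (m / mn) * nu) <= K0)
  (K2m : m / theta * gam / (1 - gam) ^+ 2 <= 2 * K2 + K0).

Let x0 : 0 < x. Proof. have := x32; lra. Qed.
Let mu0 : 0 <= mu. Proof. exact: Ex_ge0. Qed.
Let nu0 : 0 <= nu. Proof. exact: mulr_ge0. Qed.
Let w0 : 0 < 1 - gam. Proof. by rewrite subr_gt0. Qed.

Let Om := theta^-1 * gam / (1 - gam).

Let Om0 : 0 <= Om.
Proof. by rewrite /Om !mulr_ge0 // invr_ge0 ltW. Qed.

Let mOm : m * Om <= m / theta * gam / (1 - gam) ^+ 2.
Proof.
rewrite /Om !mulrA; apply: ler_wpM2l.
  by rewrite !mulr_ge0 ?invr_ge0 // ltW.
by rewrite lef_pV2 ?posrE ?exprn_gt0 // expr2 ger_pMl // gerBl.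
Qed.

Lemma root_bound S delta : 0 <= delta ->
  - (2 * delta + (b + m) / b * Om) <= S <= nu * (b + h) / h + delta ->
  `|S| <= 2 * delta + 2 * (m / mn) * (nu + Om).
Proof.
move=> d0; have mm : mn * (m / mn) = m by rewrite mulrC divfK // gt_eqF.
have mb : m <= m / mn * b.
  rewrite mulrAC ler_pdivlMr // ler_wpM2l ?ge_min ?lexx // ltW //.
have mh : m <= m / mn * h.
  rewrite mulrAC ler_pdivlMr // ler_wpM2l ?ge_min ?lexx ?orbT // ltW //.
have bm : b <= m by rewrite le_max lexx.
have hm : h <= m by rewrite le_max lexx orbT.
have e1 : (b + m) / b <= 2 * (m / mn) by rewrite ler_pdivrMr //; lra.
have e2 : (b + h) / h <= 2 * (m / mn) by rewrite ler_pdivrMr //; lra.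
have f1 := ler_wpM2r Om0 e1; have f2 := ler_wpM2l nu0 e2.
have r0 : 0 <= m / mn by exact: le_trans ra1.
have g1 : 0 <= m / mn * nu by exact: mulr_ge0.
have g2 : 0 <= m / mn * Om by exact: mulr_ge0.
rewrite ler_norml mulrDr; move: f1 f2 g1 g2; rewrite -!(mulrA 2) (mulrA nu 2) (mulrC nu 2) -(mulrA 2 nu) (mulrC nu (m / mn)) (mulrA nu).
move=> f1 f2 g1 g2 /andP[h1 h2]; apply/andP; split; lra.
Qed.

(** Either [B] is so large that a TBS policy with reorder level 0 is already at least as cheap, or
    [B], and with it the mean size of the levels, is bounded and the window comparison applies. *)
Lemma subcritical_bound : V <= c * (mu - r) + B + 3 * (K0 + K2) / x.
Proof.
have K00 : 0 <= K0.
  by apply: le_trans K0m; rewrite !mulr_ge0 ?invr_ge0 // ltW.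
have [hB|hB] := lerP (b * nu + m * Om) B.
  apply: (@le_trans _ _ (c * (mu - r) + B)); last first.
    by rewrite lerDl divr_ge0 ?(ltW x0) // mulr_ge0 // addr_ge0.
  apply: le_trans (HV 0 0) _; rewrite lerD2l.
  change (lead (0 + 0) + m / theta * gam ^+ 1 / (1 - gam) <= B).
  rewrite addr0 lead_at0 expr1.
  by apply: le_trans hB; rewrite /Om !mulrA.
(* Both errors are balanced: the slope step costs [delta] in each of about [x] weighted periods,
   hence a bounded total, like the mixing error. *)
pose delta := nu / x; pose al := 1 - x^-1.
have nu_gt0 : 0 < nu by rewrite mulr_gt0.
have d0 : 0 < delta by rewrite divr_gt0.
have xi : x^-1 < 1 by rewrite invf_lt1 //; have := x32; lra.
have al0 : 0 < al by rewrite subr_gt0.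
have al1 : al < 1 by rewrite gtrBl invr_gt0.
have KOm k : iter k (lindley P D r) id 0 <= Om by exact: iter_lindley_id.
have hi0 : 0 < nu * (b + h) / h + delta.
  by rewrite addr_gt0 // divr_gt0 // mulr_gt0 // addr_gt0.
(* The upper end of the search for [S]: there the linear lower bound of the cost is
   [b * nu + h * delta], above the value [b * nu] at 0. *)
have fhi : lead 0 < lead (nu * (b + h) / h + delta).
  rewrite lead_at0; apply: lt_le_trans (lead_ge_h iD h0 b0 _ _).
  have -> : h * (nu * (b + h) / h + delta - nu) = b * nu + h * delta.
    by field; rewrite gt_eqF.
  by rewrite ltrDl mulr_gt0.
have fneg y z : y <= 0 -> z <= 0 -> lead y - lead z = b * (z - y).
  by move=> y0 z0; rewrite !(lead_neg iD D0 h b L0.+1) //; ring.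
have [S [Sb root]] := discounted_slope_root iD n (lead_lip iD h0 b0 L0.+1)
  (lead_cvx iD h0 b0 L0.+1) d0 (ltW al0) b0 hi0 fhi fneg Om0 KOm (r := r).
have SB := root_bound (ltW d0) Sb.
have wa := window_average af iy iq N0 nN rE BE
  d0 al0 al1 root KOm.
pose s := \sum_(k < n) al ^+ k.
have sE : s = (1 - al ^+ n) * x.
  have := subrX1 al n; rewrite -/s => e.
  have -> : 1 - al ^+ n = (1 - al) * s by rewrite -opprB e; ring.
  by rewrite /al opprB addrCA subrr addr0 mulrAC mulVf ?mul1r // gt_eqF.
have p0 : 0 <= al ^+ n by rewrite exprn_ge0 // ltW.
have p3 : al ^+ n * x ^+ 3 <= 27 by apply: discount_power => //; have := x32; lra.
have s0 : 0 <= s by apply: sumr_ge0 => k _; rewrite exprn_ge0 // ltW.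
pose E := m / theta * gam / (1 - gam).
have E0 : 0 <= E by rewrite !mulr_ge0 ?invr_ge0 // ltW.
(* Each iterate along the walk is within [E * gam ^+ k] of an upper bound for a TBS cost. Summing
   these errors gives the second factor [(1 - gam)^-1]. *)
have lower : s * (V - c * (mu - r)) - m / theta * gam / (1 - gam) ^+ 2 <=
    \sum_(k < n) al ^+ k * iter k (lindley P D r) (fun x => lead (S + x)) 0.
  apply: (@le_trans _ _ (\sum_(k < n) (al ^+ k * (V - c * (mu - r)) - E * gam ^+ k))).
    rewrite big_split /= -mulr_suml sumrN -mulr_sumr lerD2l lerN2.
    have -> : m / theta * gam / (1 - gam) ^+ 2 = E * (1 - gam)^-1.
      by rewrite /E expr2 invfM !mulrA.
    by apply: ler_wpM2l => //; exact: power_sum_le.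
  apply: ler_sum => k _; have ak0 : 0 <= al ^+ k by rewrite exprn_ge0 // ltW.
  have ak1 : al ^+ k <= 1 by rewrite exprn_ile1 // ltW.
  have := ler_wpM2l ak0 (HV k S).
  have -> : m / theta * gam ^+ k.+1 / (1 - gam) = E * gam ^+ k by rewrite exprS /E; ring.
  have : al ^+ k * (E * gam ^+ k) <= E * gam ^+ k.
    by rewrite ler_piMl // mulr_ge0 // exprn_ge0.
  rewrite !mulrDr; lra.
apply: (@budget _ x (al ^+ n) s V (c * (mu - r) + B) K0 K2 _ m (m / mn) nu Om
  (B / mn + 2 * nu + `|S| + Om) x32 xra ra1 p0 p3 sE nu0 Om0 (ltW m0) K20 K0m K2m mOm).
  have r0 : 0 <= m / mn by exact: le_trans ra1.
  have g1 : nu <= m / mn * nu by rewrite ler_peMl.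
  have g2 : Om <= m / mn * Om by rewrite ler_peMl.
  have g3 : B / mn <= m / mn * nu + m / mn * Om.
    rewrite ler_pdivrMr //; apply: le_trans (ltW hB) _.
    have -> : (m / mn * nu + m / mn * Om) * mn = m * nu + m * Om by field; rewrite gt_eqF.
    by rewrite lerD2r ler_wpM2r // le_max lexx.
  have g4 : delta <= nu / 32 by rewrite ler_wpM2l // lef_pV2 ?posrE.
  move: SB; rewrite !mulrDr; set q := m / mn * nu in g1 g3 *; set q' := m / mn * Om in g2 g3 *.
  have -> : 2 * (m / mn) * nu = 2 * q by rewrite -mulrA.
  have -> : 2 * (m / mn) * Om = 2 * q' by rewrite -mulrA.
  have -> : m / mn * (7 * nu) = 7 * q by rewrite mulrCA.
  have -> : m / mn * (4 * Om) = 4 * q' by rewrite mulrCA.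
  lra.
move: wa lower; rewrite -/s.
have -> : m / (1 - al) = m * x by rewrite /al opprB addrCA subrr addr0 invrK.
rewrite -/delta; set Z := _ * (_ + Om); set I := \sum_(k < n) _.
have -> : s * (V - (c * (mu - r) + B)) = s * (V - c * (mu - r)) - s * B by ring.
by set Q := s * (V - _); set QQ := 2 * m * delta * s; set BB := s * B; lra.
Qed.

End Subcritical.

Local Notation K2 := (m * gamma P D e0 * fine ((vartheta P D e0)^-1)%E * (1 - gamma P D e0) ^- 2).

Let mu0 := mean_gt0 iD D0 dev0.
Let eps_gt0 := eps0_gt0.

Hypothesis window : e0 ^- 2 <= n%:R.

Let x := Num.sqrt (n%:R : R).

Let xn : x ^+ 2 = n%:R. Proof. by rewrite sqr_sqrtr // ler0n. Qed.

Let reg : [/\ 256 * e0 <= 1, 32 <= x & 32 * (m / mn) <= x].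
Proof.
have win : e0 ^- 2 <= x ^+ 2 by rewrite xn.
exact: (regime eps_gt0 ra1
  eps0_small (sqrtr_ge0 _) win).
Qed.

Let K20 : 0 <= K2.
Proof.
have gl1 := gamma_lt1 iD D0 eps_gt0.
rewrite mulr_ge0 ?invr_ge0 ?exprn_ge0 ?subr_ge0 ?(ltW gl1) //.
rewrite mulr_ge0 ?(mulr_ge0 (ltW m0)) ?gamma_ge0 //.
exact: inv_vartheta_ge0.
Qed.

(** * Average arrivals close to or above the mean demand *)

Section Supercritical.
Variable f : @policy R L0 L.
Hypothesis af : admissible f.
Hypothesis iy : forall t, itg P (level f t.+1).
Hypothesis iq : forall t, itg P (placed_express f t.+1).

Lemma supercritical_bound (N : nat) (r B : R) : (0 < N)%N -> (n <= N)%N ->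
  r = (\sum_(t < N) arrived f t) / N%:R ->
  B = (\sum_(t < N + n) holding f t) / N%:R ->
  mu - r <= e0 -> U + 1 <= B.
Proof.
move=> N0 nN rE BE re; have [e1 _ _] := reg.
have [k [k0 kn ke1 ke2]] := window_length eps_gt0 e1 window.
have kk : (0 < k <= n)%N by rewrite k0.
have nc := near_critical af iy iq N0 nN rE BE kk (ltW eps_gt0) re.
have k00 := K0_ge.
have t1 := total_ge1.
have kg := K0_gt0.
have eg := eta0_gt0 iD dev0.
have ug := U_const_ge0.
have eb : eta0 P D <= Ex P (fun w => `|D w - mu|).
  apply: le_trans (eta0_le P D mu) _.
  by rewrite le_eqVlt; apply/orP; left; apply/eqP; apply: eq_Ex => w; exact: distrC.
have nk : 2 * (nu * mn) <= K0.
  apply: le_trans k00.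
  have h1 : mn <= m by rewrite le_max ge_min lexx.
  have h2 : mn <= m * (m / mn) by rewrite (le_trans h1) // ler_peMr // ltW.
  have nu0 : 0 <= nu by rewrite mulr_ge0 // ltW.
  have h3 := ler_wpM2r nu0 h2.
  have h4 : 0 <= m * (m / mn) * nu by rewrite mulr_ge0 // mulr_ge0 ?divr_ge0 // ltW.
  by move: h3 h4; rewrite (mulrC nu mn); set q := mn * nu; set q' := m * _ * _; lra.
apply: (near_critical_arith (sqrtr_ge0 _) (sqr_sqrtr (ler0n R k)) ke1 ke2 eps_gt0 eg eb mn0
  _ eps0_le_total
  eps0_le_eta0 _ _ nc).
- exact: lt_le_trans ltr01 t1.
- by apply: (le_trans nk); move: eg ug; set y := eta0 _ _; set z := U_const _ _ _ _ _ _ _; set k' := U0 _ _ _ _ _ * _; lra.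
- by move: eg kg; set y := eta0 _ _; set z := U_const _ _ _ _ _ _ _; set k' := U0 _ _ _ _ _ * _; lra.
Qed.

End Supercritical.

(** * From window estimates to an arbitrary policy *)

Section TbsValue.
Variable V : R.
Hypothesis HV : forall r S, 0 <= r <= mu ->
  (V%:E <= long_run_cost (tbs r S))%E.

Lemma tbs_value_le r S theta gam k : 0 <= r <= mu -> 0 < theta -> gam < 1 ->
  Ex P (fun w => expR (theta * (r - D w))) <= gam ->
  V <= c * (mu - r) + (iter k (lindley P D r) (fun x => lead (S + x)) 0
     + m / theta * gam ^+ k.+1 / (1 - gam)).
Proof.
move=> rm t0 g1 mgf; have /andP[r0 r1] := rm; rewrite -lee_fin; apply: le_trans (HV S rm) _.
exact: tbs_upper.
Qed.

Lemma tbs_value_le_U : V <= U.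
Proof.
(* Rate 0 is [mu - e] for [e = mu], so the exponent is taken there. Only convergence is needed: 0 is
   fixed by the walk of rate 0, hence the iterates are constant and the remainder vanishes as [k]
   grows. *)
have [theta [gam [t0 p0 p1 mgf0 _]]] := chernoff_tuned iD D0 mu0 (ltW m0) ltr01.
have mgf : Ex P (fun w => expR (theta * (0 - D w))) <= gam by apply: mgf0; rewrite subrr.
pose M := m / theta / (1 - gam).
rewrite U_constE; apply/ler_addgt0Pr => e ep.
have gk : M * gam ^+ k @[k --> \oo] --> M * 0.
  by apply: cvgMr; apply: cvg_expr; rewrite ger0_norm.
have e' : M * 0 < e by rewrite mulr0.
have [k _ hk] := cvgr_lt _ gk _ e'.
have r0 : 0 <= (0 : R) <= mu by rewrite lexx (ltW mu0).
apply: le_trans (tbs_value_le 0 k r0 t0 p1 mgf) _.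
rewrite (iter_lindley_fixed P D0) addr0 lead_at0 subr0 -addrA !lerD2l.
have := hk k.+1 (leqnSn k); rewrite /M => /ltW; congr (_ <= _); ring.
Qed.

(** The average arrival over a well-chosen horizon decides. If it is within [eps0] of the mean
    demand or above it, the holding cost exceeds that of [tbs 0 0], which bounds [V]; otherwise its
    rate is admissible for a TBS policy and mixes. *)
Lemma policy_bound (f : @policy R L0 L) Cst : admissible f ->
  (long_run_cost f < Cst%:E)%E -> V <= Cst + 4 * (K0 + K2) / x.
Proof.
move=> af fin; have [e1 x32 xra] := reg.
have iy t := (policy_integrable af fin t).1.
have iq t := (policy_integrable af fin t).2.
have K00 := K0_gt0.
have K0m := K0_ge.
have [theta [gam [t0 g0 g1 mgf K2m]]] := chernoff_tuned iD D0 eps_gt0 (ltW m0) K00.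
move: K2 K20 K2m => k2 k20 K2m.
have x0 : 0 < x by apply: lt_le_trans x32; rewrite ltr0n.
have q0 : 0 < (K0 + k2) / x by rewrite divr_gt0 // ltr_wpDr.
have c1 : 0 < 1 + c by rewrite addr_gt0.
(* The horizon error enters once directly and once through the express price, so [(1 + c) * de] is
   one unit of [(K0 + k2) / x]; added to the three of the window bound it makes four. *)
pose de := (K0 + k2) / x / (1 + c).
have de0 : 0 < de by rewrite divr_gt0.
have [N [_ N0 nN [h1 h2]]] := choose_horizon af 0 de0 fin.
have dq : de + c * de = (K0 + k2) / x by rewrite -[X in X + _]mul1r -mulrDl mulrC divfK // gt_eqF.
have cde : 0 < c * de by exact: mulr_gt0.
have -> : 4 * (K0 + k2) / x = 3 * (K0 + k2) / x + (K0 + k2) / x.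
  by rewrite -!mulrA; ring.
have q3 : 0 < 3 * (K0 + k2) / x by rewrite -mulrA mulr_gt0.
move: h1 h2; set r := _ / N%:R; set B := _ / N%:R => h1 h2.
have [re|re] := lerP (mu - r) e0.
  have UB := supercritical_bound af iy iq N0 nN (erefl r) (erefl B) re.
  apply: le_trans tbs_value_le_U _; move: UB h2; lra.
have r0 : 0 <= r.
  by apply: divr_ge0 => //; apply: sumr_ge0 => t _; exact: arrived_ge0.
have rmu : 0 <= r <= mu by rewrite r0 -subr_ge0 (le_trans _ (ltW re)) // ltW.
have mr : Ex P (fun w => expR (theta * (r - D w))) <= gam.
  by apply: mgf; rewrite lerBrDl -lerBrDr ltW.
have sb := subcritical_bound af iy iq N0 nN
  (erefl r) (erefl B) t0 g0 g1 mr (fun k S => tbs_value_le S k rmu t0 g1 mr)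
  mu0 xn x32 xra k20 K0m K2m.
move: h1 sb; rewrite mulrBr; lra.
Qed.

End TbsValue.

Lemma g_const_le_policy (f : @policy R L0 L) : admissible f ->
  (g%:E <= long_run_cost f)%E.
Proof.
move=> af; rewrite leNgt; apply/negP => hf.
have [Cst h1 h2] : exists2 Cst, (long_run_cost f < Cst%:E)%E & Cst < g.
  case: (long_run_cost f) hf => [a| |] //.
    rewrite lte_fin => ag; exists ((a + g) / 2); rewrite ?lte_fin; lra.
  by move=> _; exists (g - 1); rewrite ?ltNyr // gtrBl.
have de0 : 0 < (g - Cst) / 2 by rewrite divr_gt0 // subr_gt0.
have [N [_ N0 _ [_ hN]]] := choose_horizon af 0 de0 h1.
have NR : 0 < N%:R :> R by rewrite ltr0n.
have g0 := g_const_gt0.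
have : g <= (\sum_(t < N + n) holding f t) / N%:R.
  rewrite ler_pdivlMr //; apply: (@le_trans _ _ (\sum_(t < N + n) g)).
    by rewrite sumr_const card_ord -[g *+ _]mulr_natr ler_wpM2l ?(ltW g0) // ler_nat leq_addr.
  apply: ler_sum => t _; apply: Ex_ge_cst => [|w].
    exact: itg_lip (lead_lip iD h0 b0 _)
      (policy_integrable af h1 t).1.
  exact: g_const_le.
lra.
Qed.

(** The additive gap is at most [5 * (K0 + K2) / sqrt n], which the condition on [n] makes smaller
    than [eps * g]; and [g] bounds the optimal value from below. *)
Lemma best_tbs_ratio rstar Sstar eps :
  best_tbs P c h b L0 L Dt Dt' Ghat mu rstar Sstar -> 0 < eps ->
  25 * g ^- 2 * (K0 + K2) ^+ 2 * eps ^- 2 < n%:R ->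
  (tbs_cost P c h b L0 L Dt Dt' Ghat rstar Sstar
     / OPT P c h b L0 L Dt Dt' Ghat < (1 + eps)%:E)%E.
Proof.
move=> [rm hr hS] ep hn; set Vb := tbs_cost _ _ _ _ _ _ _ _ _ _ _.
have g0 := g_const_gt0.
have HV r S : 0 <= r <= mu -> (Vb <= long_run_cost (tbs r S))%E.
  move=> r01; apply: (@le_trans _ _ (tbs_value P c h b L0 L Dt Dt' Ghat r)); last first.
    by apply: ereal_inf_lbound; exists S.
  apply: le_trans (hr r r01); apply: le_ereal_inf_tmp => _ [S' _ <-]; exact: hS.
have Vfin : (Vb < +oo)%E.
  have [theta [gam [t0 _ p1 mgf0 _]]] := chernoff_tuned iD D0 mu0 (ltW m0) ltr01.
  have r0 : 0 <= (0 : R) <= mu by rewrite lexx (ltW mu0).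
  have mgf : Ex P (fun w => expR (theta * (0 - D w))) <= gam by apply: mgf0; rewrite subrr.
  apply: le_lt_trans (HV 0 0 r0) _; apply: le_lt_trans (ltry _).
  exact: (tbs_upper 0 0 (lexx 0) (ltW mu0) t0 p1 mgf).
have gV : (g%:E <= Vb)%E.
  by apply: g_const_le_policy; apply: tbs_admissible; case/andP: rm.
move: Vb HV Vfin gV => [V| |] // HV _ _.
set o := OPT _ _ _ _ _ _ _ _ _.
have go : (g%:E <= o)%E by apply: le_ereal_inf_tmp => _ [f af <-]; exact: g_const_le_policy.
have [_ x32 _] := reg; have x0 : 0 < x by apply: lt_le_trans x32; rewrite ltr0n.
have K00 := K0_gt0.
have K_gt0 : 0 < K0 + K2 by rewrite ltr_wpDr.
(* The fifth unit is the margin that contradicts [policy_bound]; its square is the constant 25 in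
   [Y0]. *)
have ho : ((V - 5 * (K0 + K2) / x)%:E <= o)%E.
  apply: le_ereal_inf_tmp => _ [f af <-]; rewrite leNgt; apply/negP => hf.
  have := policy_bound HV af hf; have := divr_gt0 K_gt0 x0.
  rewrite -!mulrA; lra.
have Kx : 5 * (K0 + K2) / x < eps * g.
  have l0 : 0 <= 5 * (K0 + K2) by apply: mulr_ge0; [rewrite ler0n|exact: ltW].
  have l1 : 0 <= eps * g * x by rewrite mulr_ge0 ?(ltW x0) // mulr_ge0 // ltW.
  rewrite ltr_pdivrMr // -(@ltr_pXn2r _ 2) ?nnegrE //.
  rewrite [ltRHS]exprMn xn -ltr_pdivrMl ?exprn_gt0 ?mulr_gt0 //.
  move: hn; set K := _ + _; set y := g_const _ _ _ _ _ in g0 *.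
  suff -> : ((eps * y) ^+ 2)^-1 * (5 * K) ^+ 2 = 25 * y ^- 2 * K ^+ 2 * eps ^- 2 by [].
  by field; rewrite !gt_eqF.
(* For an infinite optimal value the convention [1/oo = 0] makes the ratio 0. *)
move: o go ho => [a| |] //; last by rewrite /inve mule0 => _ _; rewrite lte_fin; lra.
rewrite !lee_fin => go ho; have o0 : 0 < a by exact: lt_le_trans go.
rewrite /inve gt_eqF //= -EFinM lte_fin ltr_pdivrMr //.
have := ler_wpM2l (ltW ep) go; rewrite mulrDl mul1r; lra.
Qed.

End Policies.

Unset Implicit Arguments.

Theorem theorem1 (R : realType) (d : measure_display) (T : measurableType d)
  (P : probability T R)
  (D : {RV P >-> R}) (Dt Dt' : int -> {RV P >-> R}) (Ghat : {RV P >-> nat})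
  (c h b : R) (L0 L : nat) (rstar Sstar eps : R) :
  (forall w, 0 <= D w) ->
  ('E_P[D] < +oo)%E ->
  (0 < 'V_P[D])%E ->
  (forall t, same_law P (Dt t) D) ->
  (forall t, same_law P (Dt' t) D) ->
  (forall k : nat, (1 <= k)%N -> P [set w | Ghat w = k] = (2 ^- k)%:E) ->
  mutually_independent P (primitives Dt Dt' Ghat) ->
  0 < c -> 0 < h -> 0 < b ->
  (L0 + 1 < L)%N ->
  best_tbs P c h b L0 L Dt Dt' Ghat (mean P D) rstar Sstar ->
  0 < eps < 1 ->
  (eps0 P c h b L0 D Dt') ^- 2 + Y0 P c h b L0 D Dt' * eps ^- 2 < L%:R ->
  (tbs_cost P c h b L0 L Dt Dt' Ghat rstar Sstar
     / OPT P c h b L0 L Dt Dt' Ghat < (1 + eps)%:E)%E.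
Proof.
move=> D0 ED var0 lawDt lawDt' lawG indep c0 h0 b0 L0L best /andP[ep0 ep1] hL.
have mD : measurable_fun setT D by exact: measurable_funPT.
have iD : itg P D.
  by apply: ge0_itg => //; move: ED; rewrite expectation.unlock.
have mDt t : measurable_fun setT (Dt t) by exact: measurable_funPT.
have mDt' t : measurable_fun setT (Dt' t) by exact: measurable_funPT.
have mG : measurable_fun setT Ghat by exact: measurable_funPT.
rewrite mean_Ex in best.
have nE : (L - L0)%:R = L%:R - L0%:R :> R.
  by rewrite natrB //; apply: leq_trans (ltnW L0L); rewrite leq_addr.
have w1 : 1 <= eps ^- 2 by rewrite invf_ge1 ?exprn_gt0 // expr_le1 // ltW.
have e0 : 0 <= eps0 P c h b L0 D Dt' ^- 2.
  by rewrite invr_ge0 exprn_ge0 // ltW //; exact: (eps0_gt0 L0 iD D0 mDt mDt' mG lawDt' indep c0 h0 b0 var0).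
move: hL; rewrite /Y0 -[_ + L0%:R + 1]addrA mulrDl; set A := 25 * _ * _ => hL.
have A0 : 0 <= A * eps ^- 2.
  apply: mulr_ge0; last exact: le_trans ler01 w1.
  rewrite /A; apply: mulr_ge0; last exact: sqr_ge0.
  by apply: mulr_ge0; [rewrite ler0n|rewrite invr_ge0 sqr_ge0].
(* The summand [L0 + 1] of [Y0] pays for passing from [L] to the window length [L - L0], since
   [eps ^- 2 >= 1]. *)
have lw : L0%:R <= (L0%:R + 1) * eps ^- 2 :> R.
  apply: (@le_trans _ _ (L0%:R + 1)); first by rewrite lerDl.
  by rewrite ler_peMr // addr_ge0.
have i1 : eps0 P c h b L0 D Dt' ^- 2 <= (L - L0)%:R.
  by move: hL A0 lw; rewrite nE; set u := A * _; set v := (_ + 1) * _; lra.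
apply: (best_tbs_ratio iD D0 mDt mDt' mG lawDt lawDt' lawG indep c0 h0 b0 L0L var0 i1 best ep0).
rewrite -/A nE; move: hL e0 lw; set u := A * _; set v := (_ + 1) * _; lra.
Qed.
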